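(* Let $z\in\mathbb{C}$ with $\Re z>0$ and let $s\in\mathbb{C}$ be not a positive integer. Then $$\lim_{q\to1-0}\Big\{\zeta(s,z:q)+\frac{(q-q^2)^s q^{-zs}}{\log q}\,\frac{\pi}{\sin\pi s}\Big\}=\zeta(s,z),$$ where $\zeta(s,z)$ is the Hurwitz zeta-function.
   Context: For $0<q<1$, $[x]_q=\frac{1-q^x}{1-q}$, and $\zeta(s,z:q)$ denotes the meromorphic continuation to the whole $s$-plane of $\sum_{k=0}^{\infty}q^{s(k+1)}/[k+z]_q^{\,s}$ (convergent for $\Re s>0$), with complex powers via the principal branch. The Hurwitz zeta-function $\zeta(s,z)$ is the meromorphic continuation of $\sum_{k=0}^\infty (k+z)^{-s}$ ($\Re s>1$). *)

(* Defs.v *)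
From Stdlib Require Import Reals.
From Coquelicot Require Import Coquelicot.

Local Open Scope R_scope.

Definition cexp (w : C) : C :=
  (exp (Re w) * cos (Im w), exp (Re w) * sin (Im w)).

(** Principal argument, with values in (-PI, PI] for w <> 0
    (half-angle formula arg w = 2 atan (Im w / (|w| + Re w)) off the
    closed negative real axis; PI on the negative real axis). *)
Definition carg (w : C) : R :=
  if Req_EM_T (Im w) 0 then (if Rlt_dec (Re w) 0 then PI else 0)
  else 2 * atan (Im w / (Cmod w + Re w)).

Definition Clog (w : C) : C := (ln (Cmod w), carg w).

Definition cpow (a s : C) : C := cexp (s * Clog a)%C.

Definition Ci : C := (0, 1).
Definition csin (w : C) : C :=
  ((cexp (Ci * w) - cexp (- (Ci * w))) / (2 * Ci))%C.

Definition qnum (q : R) (x : C) : C := ((1 - cpow q x) / (1 - q))%C.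

Definition qzeta_term (q : R) (z : C) (k : nat) (s : C) : C :=
  (cpow q (s * INR (S k)) / cpow (qnum q (INR k + z)) s)%C.

Definition hurwitz_term (z : C) (k : nat) (s : C) : C :=
  (1 / cpow (INR k + z) s)%C.

Definition qcorr (q : R) (z s : C) : C :=
  (cpow (q - q ^ 2) s * cpow q (- (z * s)) / ln q * (PI / csin (PI * s)))%C.

Fixpoint csum (a : nat -> C) (n : nat) : C :=
  match n with O => 0%C | S m => (csum a m + a m)%C end.

Definition series_converges_to (a : nat -> C) (L : C) : Prop :=
  forall eps, 0 < eps -> exists N : nat, forall n, (N <= n)%nat ->
    Cmod (csum a n - L) < eps.

Definition C_differentiable_at (F : C -> C) (s : C) : Prop :=
  exists l : C, forall eps, 0 < eps -> exists del, 0 < del /\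
    forall w, w <> s -> Cmod (w - s) < del ->
      Cmod ((F w - F s) / (w - s) - l) < eps.

Definition locally_discrete (P : C -> Prop) : Prop :=
  forall w : C, exists r, 0 < r /\ forall p, P p -> p <> w -> r <= Cmod (p - w).

(** F is a meromorphic function on C (holomorphic off a discrete set P,
    each point of P being at worst a pole), and it agrees with the sum of
    the series sum_k f k s on the region Omega (off P), where the series
    converges.  By the identity theorem such F is unique off the
    singularities: this is "the meromorphic continuation" of the series. *)
Definition is_meromorphic_continuation (f : nat -> C -> C) (Omega : C -> Prop)
    (F : C -> C) : Prop :=
  exists P : C -> Prop,
    locally_discrete P /\
    (forall s, ~ P s -> C_differentiable_at F s) /\
    (forall p, P p -> exists (m : nat) (M r : R), 0 < r /\
        forall w, w <> p -> Cmod (w - p) < r -> Cmod (w - p) ^ m * Cmod (F w) <= M) /\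
    (forall s, Omega s -> ~ P s -> series_converges_to (fun k => f k s) (F s)).

(** lim_{w -> s, w <> s} F w = v  (value of a meromorphic function at s,
    removable singularities being filled in). *)
Definition has_punctured_limit (F : C -> C) (s v : C) : Prop :=
  forall eps, 0 < eps -> exists del, 0 < del /\
    forall w, w <> s -> Cmod (w - s) < del -> Cmod (F w - v) < eps.

(* Main.v *)
Require Import Defs.
From Stdlib Require Import Reals Lra Lia Psatz Classical.
From Coquelicot Require Import Coquelicot.
Local Open Scope R_scope.

(** Write L = - log q and psi(y) = (exp(L y) - 1)^(- s). Up to the factor (1 - q)^s q^(s (1 - z)), which
    behaves like L^s, the q-zeta function is the sum of psi(z + k) over k >= 0, and the correction
    term is minus the integral of psi over (0, oo), namely - PI / (L sin (PI s)).
    Expanding psi by the binomial series in exp(- L y) turns the sum from k = N on into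
    sum_r c_r exp(- u_r y) / (1 - exp(- u_r)), with u_r = (s + r) L and y = z + N. Gregory's expansion
    1 / (1 - v) = 1 / u + sum_(j < m) a_j (1 - v)^j + O(u^m), v = exp(- u), then produces:
    the integral of psi from y on, which Euler's reflection formula combines with the correction into
    - (integral of psi over (0, y)), a series that continues to all s outside {1, 2, 3, ...};
    finite differences of psi at y; and a remainder which is O((Re y)^(- Re s - m)) uniformly in q.
    These formulas continue the q-zeta function to Re s > 1 - m, and letting q -> 1 and then N -> oo
    gives the continuation of the Hurwitz zeta function. Since the given continuations are only assumed
    pointwise complex differentiable, Goursat's theorem, Cauchy's formula, Weierstrass' convergence
    theorem and the identity theorem are needed to compare them with these formulas. *)

(** Finite differences replace the derivatives of an Euler-Maclaurin expansion because, on
    [exp (- u y)], a unit difference is multiplication by [1 - exp (- u)]: the summation formula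
    becomes an identity between the terms of one series in [r], with no integral remainder. The
    obstacle is uniformity in [q]. Term [r] of the remainder carries the weight [(L |s + r|)^m], and
    only a majorant of the binomial coefficients with the exact exponent [Re s] lets the sum over
    [r] compensate [L^m] and [(1 - q)^s]. The resulting bound fixes [N] before [q] moves, which is
    what permits the two limits to be taken one after the other. At [s = 0, - 1, - 2, ...] the
    correction has poles that cancel against those of the q-zeta function, so values are compared as
    limits over punctured neighbourhoods. At the positive integers the poles of the continued
    integral over (0, y) remain, whence the condition on [s]. *)

(** * Inequalities for the modulus *)

Lemma half_pos (x : R) : 0 < x -> 0 < x / 2.
Proof. lra. Qed.

Lemma Cmod_triangle_sub (a b c : C) : Cmod (a - c) <= Cmod (a - b) + Cmod (b - c).
Proof.
  replace (a - c)%C with ((a - b) + (b - c))%C by ring.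
  apply Cmod_triangle.
Qed.

Lemma Cmod_sub_sym (a b : C) : Cmod (a - b) = Cmod (b - a).
Proof. rewrite <- (Cmod_opp (a - b)). f_equal. ring. Qed.

Lemma Cmod_sub_ge (a b : C) : Cmod a - Cmod b <= Cmod (a - b).
Proof.
  assert (Cmod a <= Cmod (a - b) + Cmod b); [|lra].
  replace a with ((a - b) + b)%C at 1 by ring. apply Cmod_triangle.
Qed.

Lemma Cmod_add_ge (a b : C) : Cmod a - Cmod b <= Cmod (a + b).
Proof.
  replace (a + b)%C with (a - - b)%C by ring.
  rewrite <- (Cmod_opp b). apply Cmod_sub_ge.
Qed.

Lemma Cmod_sub_le (a b : C) : Cmod (a - b) <= Cmod a + Cmod b.
Proof. rewrite <- (Cmod_opp b). apply Cmod_triangle. Qed.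

Lemma im_le_Cmod (c : C) : Rabs (Im c) <= Cmod c.
Proof. eapply Rle_trans; [apply Rmax_r | apply Rmax_Cmod]. Qed.

Lemma Cmod_le_parts (c : C) : Cmod c <= Rabs (Re c) + Rabs (Im c).
Proof.
  replace c with (RtoC (Re c) + Ci * RtoC (Im c))%C at 1.
  2: { destruct c as [x y]. apply injective_projections; simpl; ring. }
  eapply Rle_trans; [apply Cmod_triangle|].
  rewrite Cmod_mult, Cmod_Ci, !Cmod_R. lra.
Qed.

Lemma Ceq_parts (a b : C) : Re a = Re b -> Im a = Im b -> a = b.
Proof. intros. now apply injective_projections. Qed.

Lemma re_minus (a b : C) : Re (a - b) = Re a - Re b.
Proof. reflexivity. Qed.

Lemma im_minus (a b : C) : Im (a - b) = Im a - Im b.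
Proof. reflexivity. Qed.

Lemma im_plus (a b : C) : Im (a + b) = Im a + Im b.
Proof. reflexivity. Qed.

Lemma im_opp (a : C) : Im (- a) = - Im a.
Proof. reflexivity. Qed.

Definition C_eq_dec (a b : C) : {a = b} + {a <> b}.
Proof.
  destruct (Req_EM_T (Re a) (Re b)) as [H1|H1].
  - destruct (Req_EM_T (Im a) (Im b)) as [H2|H2].
    + left. now apply Ceq_parts.
    + right. intros ->. now apply H2.
  - right. intros ->. now apply H1.
Defined.

Lemma Cmod_sub_pos (a b : C) : a <> b -> 0 < Cmod (a - b).
Proof. intros H. apply Cmod_gt_0. now apply Cminus_eq_contra. Qed.

Lemma eq_of_Cmod_small (a b : C) :
  (forall eps, 0 < eps -> Cmod (a - b) <= eps) -> a = b.
Proof.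
  intros H. apply Ceq_minus. apply Cmod_eq_0.
  apply Rle_antisym; [|apply Cmod_ge_0].
  apply le_epsilon. intros eps He. rewrite Rplus_0_l. now apply H.
Qed.

(** * Limits of complex-valued functions along a filter *)

(** Limits along a filter let the same algebra serve for [w -> s], [N -> oo] and [q -> 1]; distances
    are measured by [Cmod], as in the definitions of the statement. *)
Definition flim {T} (F : (T -> Prop) -> Prop) (f : T -> C) (l : C) : Prop :=
  forall eps, 0 < eps -> F (fun x => Cmod (f x - l) < eps).

Section Flim.
Context {T : Type} {F : (T -> Prop) -> Prop} {FF : Filter F}.

Lemma flim_ext_loc (f g : T -> C) l :
  F (fun x => f x = g x) -> flim F f l -> flim F g l.
Proof.
  intros He Hf eps Heps. specialize (Hf eps Heps).
  generalize (filter_and _ _ He Hf). apply filter_imp.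
  intros x [<- H]. exact H.
Qed.

Lemma flim_ext (f g : T -> C) l :
  (forall x, f x = g x) -> flim F f l -> flim F g l.
Proof. intros H. apply flim_ext_loc. now apply filter_forall. Qed.

Lemma flim_eq (f : T -> C) a b : a = b -> flim F f a -> flim F f b.
Proof. now intros ->. Qed.

Lemma flim_const (c : C) : flim F (fun _ => c) c.
Proof.
  intros eps He. apply filter_forall. intros _.
  replace (c - c)%C with (RtoC 0) by ring. now rewrite Cmod_0.
Qed.

Lemma flim_plus f g a b :
  flim F f a -> flim F g b -> flim F (fun x => f x + g x)%C (a + b)%C.
Proof.
  intros Hf Hg eps He.
  generalize (filter_and _ _ (Hf (eps/2) (half_pos _ He)) (Hg (eps/2) (half_pos _ He))).
  apply filter_imp. intros x [H1 H2].
  replace (f x + g x - (a + b))%C with ((f x - a) + (g x - b))%C by ring.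
  eapply Rle_lt_trans; [apply Cmod_triangle|lra].
Qed.

Lemma flim_squeeze f l (h : T -> R) :
  F (fun x => Cmod (f x - l) <= h x) ->
  (forall eps, 0 < eps -> F (fun x => h x < eps)) -> flim F f l.
Proof.
  intros H1 H2 eps He. generalize (filter_and _ _ H1 (H2 eps He)).
  apply filter_imp. intros x [A B]. lra.
Qed.

Lemma flim_mult f g a b :
  flim F f a -> flim F g b -> flim F (fun x => f x * g x)%C (a * b)%C.
Proof.
  intros Hf Hg eps He.
  set (A := Cmod a + 1). set (B := Cmod b + 1).
  assert (HA : 0 < A) by (unfold A; generalize (Cmod_ge_0 a); lra).
  assert (HB : 0 < B) by (unfold B; generalize (Cmod_ge_0 b); lra).
  set (e1 := Rmin 1 (eps / (2 * B))). set (e2 := eps / (2 * A)).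
  assert (He1 : 0 < e1) by (unfold e1; apply Rmin_glb_lt; [lra|apply Rdiv_lt_0_compat; lra]).
  assert (He2 : 0 < e2) by (unfold e2; apply Rdiv_lt_0_compat; lra).
  generalize (filter_and _ _ (Hf e1 He1) (Hg e2 He2)).
  apply filter_imp. intros x [H1 H2].
  replace (f x * g x - a * b)%C with (f x * (g x - b) + (f x - a) * b)%C by ring.
  eapply Rle_lt_trans; [apply Cmod_triangle|]. rewrite !Cmod_mult.
  assert (Hfx : Cmod (f x) <= A).
  { replace (f x) with ((f x - a) + a)%C by ring.
    eapply Rle_trans; [apply Cmod_triangle|]. unfold A.
    assert (e1 <= 1) by apply Rmin_l. lra. }
  assert (K1 : Cmod (f x) * Cmod (g x - b) <= A * Cmod (g x - b)).
  { apply Rmult_le_compat_r; [apply Cmod_ge_0|exact Hfx]. }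
  assert (K2 : A * Cmod (g x - b) < A * e2) by (apply Rmult_lt_compat_l; lra).
  assert (K3 : A * e2 = eps / 2) by (unfold e2; field; lra).
  assert (K4 : Cmod (f x - a) * Cmod b <= e1 * B).
  { apply Rmult_le_compat; try apply Cmod_ge_0; unfold B; lra. }
  assert (K5 : e1 * B <= eps / 2).
  { replace (eps/2) with (eps / (2 * B) * B) by (field; lra).
    apply Rmult_le_compat_r; [lra|apply Rmin_r]. }
  lra.
Qed.

Lemma flim_opp f a : flim F f a -> flim F (fun x => - f x)%C (- a)%C.
Proof.
  intros Hf. apply flim_ext with (fun x => (- (1)) * f x)%C; [intros; ring|].
  replace (- a)%C with (- (1) * a)%C by ring.
  apply flim_mult; [apply flim_const|exact Hf].
Qed.

Lemma flim_minus f g a b :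
  flim F f a -> flim F g b -> flim F (fun x => f x - g x)%C (a - b)%C.
Proof. intros. apply flim_plus; [|apply flim_opp]; assumption. Qed.

Lemma flim_away_from_0 f a : a <> RtoC 0 -> flim F f a ->
  F (fun x => Cmod a / 2 < Cmod (f x)).
Proof.
  intros Ha Hf. apply Cmod_gt_0 in Ha.
  generalize (Hf (Cmod a / 2) (half_pos _ Ha)). apply filter_imp. intros x Hx.
  generalize (Cmod_sub_ge a (a - f x)). rewrite (Cmod_sub_sym a (f x)).
  replace (a - (a - f x))%C with (f x) by ring. lra.
Qed.

Lemma flim_inv f a : a <> RtoC 0 -> flim F f a -> flim F (fun x => / f x)%C (/ a)%C.
Proof.
  intros Ha Hf. generalize (flim_away_from_0 f a Ha Hf). intros H0.
  assert (Hp := proj1 (Cmod_gt_0 a) Ha).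
  apply flim_squeeze with (fun x => 2 / (Cmod a * Cmod a) * Cmod (f x - a)).
  - revert H0. apply filter_imp. intros x Hx.
    assert (Hfx : f x <> RtoC 0) by (apply Cmod_gt_0; lra).
    replace (/ f x - / a)%C with ((a - f x) / (f x * a))%C by (field; auto).
    rewrite Cmod_div by (now apply Cmult_neq_0).
    rewrite Cmod_mult, (Cmod_sub_sym a).
    unfold Rdiv. rewrite (Rmult_comm (Cmod (f x - a))).
    apply Rmult_le_compat_r; [apply Cmod_ge_0|].
    replace (2 * / (Cmod a * Cmod a)) with (/ ((Cmod a / 2) * Cmod a)) by (field; lra).
    apply Rinv_le_contravar; [nra|].
    apply Rmult_le_compat_r; lra.
  - intros eps He. set (k := 2 / (Cmod a * Cmod a)).
    assert (Hk : 0 < k) by (apply Rdiv_lt_0_compat; nra).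
    generalize (Hf (eps / k) (Rdiv_lt_0_compat _ _ He Hk)).
    apply filter_imp. intros x Hx.
    apply Rmult_lt_compat_l with (r := k) in Hx; [|exact Hk].
    replace (k * (eps / k)) with eps in Hx by (field; lra). exact Hx.
Qed.

Lemma flim_div f g a b : b <> RtoC 0 ->
  flim F f a -> flim F g b -> flim F (fun x => f x / g x)%C (a / b)%C.
Proof. intros. apply flim_mult; [|apply flim_inv]; assumption. Qed.

Lemma flim_unique `{PF : !ProperFilter' F} f a b : flim F f a -> flim F f b -> a = b.
Proof.
  intros Ha Hb. apply eq_of_Cmod_small. intros eps He.
  apply Rnot_lt_le. intros Hlt. apply (filter_not_empty (F := F)).
  generalize (filter_and _ _ (Ha (eps/2) (half_pos _ He)) (Hb (eps/2) (half_pos _ He))).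
  apply filter_imp. intros x [H1 H2].
  generalize (Cmod_triangle_sub a (f x) b). rewrite (Cmod_sub_sym a (f x)). lra.
Qed.

Lemma flim_Cmod_le `{PF : !ProperFilter' F} f l m M :
  flim F f l -> F (fun x => Cmod (f x - m) <= M) -> Cmod (l - m) <= M.
Proof.
  intros Hf HM. apply Rnot_lt_le. intros Hlt.
  apply (filter_not_empty (F := F)).
  generalize (filter_and _ _ HM (Hf (Cmod (l - m) - M) (proj2 (Rlt_0_minus _ _) Hlt))).
  apply filter_imp. intros x [H1 H2].
  generalize (Cmod_triangle_sub l (f x) m). rewrite (Cmod_sub_sym l (f x)). lra.
Qed.

End Flim.

Definition cnbhs (s : C) : (C -> Prop) -> Prop :=
  fun P => exists del, 0 < del /\ forall w, Cmod (w - s) < del -> P w.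

Global Instance cnbhs_proper (s : C) : ProperFilter (cnbhs s).
Proof.
  split.
  - intros P [d [Hd H]]. exists s. apply H.
    replace (s - s)%C with (RtoC 0) by ring. now rewrite Cmod_0.
  - split.
    + exists 1. split; [lra|auto].
    + intros P Q [d1 [H1 K1]] [d2 [H2 K2]]. exists (Rmin d1 d2). split.
      * now apply Rmin_glb_lt.
      * intros w Hw. split.
        -- apply K1. eapply Rlt_le_trans; [exact Hw|apply Rmin_l].
        -- apply K2. eapply Rlt_le_trans; [exact Hw|apply Rmin_r].
    + intros P Q HPQ [d [Hd H]]. exists d. split; auto.
Qed.

Lemma cnbhs_point (s : C) (P : C -> Prop) : cnbhs s P -> P s.
Proof.
  intros [d [Hd H]]. apply H.
  replace (s - s)%C with (RtoC 0) by ring. now rewrite Cmod_0.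
Qed.

Lemma cnbhs_ball (s : C) r : 0 < r -> cnbhs s (fun w => Cmod (w - s) < r).
Proof. intros. exists r. split; auto. Qed.

Definition ccont (f : C -> C) (s : C) : Prop := flim (cnbhs s) f (f s).

Lemma flim_comp {T} (F : (T -> Prop) -> Prop) {FF : Filter F} (f : T -> C) (g : C -> C) a :
  flim F f a -> ccont g a -> flim F (fun x => g (f x)) (g a).
Proof.
  intros Hf Hg eps He. destruct (Hg eps He) as [d [Hd H]].
  generalize (Hf d Hd). apply filter_imp. intros x. apply H.
Qed.

Lemma flim_id s : flim (cnbhs s) (fun w => w) s.
Proof. intros eps He. now apply cnbhs_ball. Qed.

(** * Complex differentiability *)

(** Caratheodory's form of the derivative: the difference quotient is a function [phi] continuous at
    [s], so the product and chain rules become algebraic identities without division. *)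
Definition is_cderiv (f : C -> C) (s l : C) : Prop :=
  exists phi : C -> C,
    (forall w, f w = (f s + phi w * (w - s))%C) /\ phi s = l /\ ccont phi s.

Definition cholo (f : C -> C) (s : C) : Prop := exists l, is_cderiv f s l.

Lemma is_cderiv_eps (f : C -> C) (s l : C) : is_cderiv f s l <->
  forall eps, 0 < eps -> cnbhs s (fun w => Cmod (f w - f s - l * (w - s)) <= eps * Cmod (w - s)).
Proof.
  split.
  - intros [phi [H1 [<- H3]]] eps He. generalize (H3 eps He).
    apply filter_imp. intros w Hw. rewrite (H1 w).
    replace (f s + phi w * (w - s) - f s - phi s * (w - s))%C
      with ((phi w - phi s) * (w - s))%C by ring.
    rewrite Cmod_mult. apply Rmult_le_compat_r; [apply Cmod_ge_0|lra].
  - intros H.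
    exists (fun w => if C_eq_dec w s then l else ((f w - f s) / (w - s))%C).
    split; [|split].
    + intros w. destruct (C_eq_dec w s) as [->|Hw]; [ring|].
      field. now apply Cminus_eq_contra.
    + destruct (C_eq_dec s s); congruence.
    + intros eps He. destruct (C_eq_dec s s) as [_|]; [|congruence].
      generalize (H (eps/2) (half_pos _ He)). apply filter_imp. intros w Hw.
      destruct (C_eq_dec w s) as [->|Hne].
      { replace (l - l)%C with (RtoC 0) by ring. now rewrite Cmod_0. }
      assert (Hp := Cmod_sub_pos _ _ Hne).
      replace ((f w - f s) / (w - s) - l)%C
        with ((f w - f s - l * (w - s)) / (w - s))%C
        by (field; now apply Cminus_eq_contra).
      rewrite Cmod_div by now apply Cminus_eq_contra.
      apply Rle_lt_trans with (eps/2); [|lra].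
      apply Rmult_le_reg_r with (Cmod (w - s)); [exact Hp|].
      unfold Rdiv at 1. rewrite Rmult_assoc, Rinv_l, Rmult_1_r; lra.
Qed.

Lemma cholo_of_differentiable (f : C -> C) (s : C) : C_differentiable_at f s -> cholo f s.
Proof.
  intros [l H]. exists l. apply is_cderiv_eps. intros eps He.
  destruct (H eps He) as [d [Hd K]]. exists d. split; [exact Hd|].
  intros w Hw. destruct (C_eq_dec w s) as [->|Hne].
  - replace (f s - f s - l * (s - s))%C with (RtoC 0) by ring.
    rewrite Cmod_0. apply Rmult_le_pos; [lra|apply Cmod_ge_0].
  - specialize (K w Hne Hw).
    replace (f w - f s - l * (w - s))%C
      with (((f w - f s) / (w - s) - l) * (w - s))%C
      by (field; now apply Cminus_eq_contra).
    rewrite Cmod_mult. apply Rmult_le_compat_r; [apply Cmod_ge_0|lra].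
Qed.

Lemma is_cderiv_cont f s l : is_cderiv f s l -> ccont f s.
Proof.
  intros [phi [H1 [H2 H3]]]. unfold ccont.
  apply flim_ext with (fun w => f s + phi w * (w - s))%C; [intros; symmetry; apply H1|].
  apply flim_eq with (f s + phi s * (s - s))%C; [ring|].
  apply flim_plus; [apply flim_const|]. apply flim_mult; [exact H3|].
  apply flim_minus; [apply flim_id|apply flim_const].
Qed.

Lemma cholo_cont f s : cholo f s -> ccont f s.
Proof. intros [l H]. eapply is_cderiv_cont, H. Qed.

Lemma is_cderiv_ext_loc f g s l :
  cnbhs s (fun w => f w = g w) -> is_cderiv f s l -> is_cderiv g s l.
Proof.
  rewrite !is_cderiv_eps. intros He Hf eps Heps.
  generalize (filter_and _ _ He (Hf eps Heps)). apply filter_imp.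
  intros w [E K]. now rewrite <- E, <- (cnbhs_point _ _ He).
Qed.

Lemma is_cderiv_ext f g s l :
  (forall w, f w = g w) -> is_cderiv f s l -> is_cderiv g s l.
Proof. intros H. apply is_cderiv_ext_loc. now apply filter_forall. Qed.

Lemma cholo_ext_loc f g s : cnbhs s (fun w => f w = g w) -> cholo f s -> cholo g s.
Proof. intros H [l K]. exists l. revert K. now apply is_cderiv_ext_loc. Qed.

Lemma cholo_ext f g s : (forall w, f w = g w) -> cholo f s -> cholo g s.
Proof. intros H [l K]. exists l. revert K. now apply is_cderiv_ext. Qed.

Lemma is_cderiv_unique f s a b : is_cderiv f s a -> is_cderiv f s b -> a = b.
Proof.
  rewrite !is_cderiv_eps. intros Ha Hb. apply eq_of_Cmod_small. intros eps He.
  destruct (filter_and _ _ (Ha (eps/2) (half_pos _ He)) (Hb (eps/2) (half_pos _ He))) as [d [Hd H]].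
  set (w := (s + RtoC (d/2))%C).
  assert (Hw : (w - s = RtoC (d/2))%C) by (unfold w; ring).
  assert (Hm : Cmod (w - s) = d/2) by (rewrite Hw, Cmod_R, Rabs_pos_eq; lra).
  destruct (H w ltac:(lra)) as [H1 H2].
  assert (K : Cmod ((a - b) * (w - s)) <= eps * Cmod (w - s)).
  { replace ((a - b) * (w - s))%C
      with ((f w - f s - b * (w - s)) - (f w - f s - a * (w - s)))%C by ring.
    eapply Rle_trans; [apply Cmod_sub_le|]. lra. }
  rewrite Cmod_mult, Hm in K. apply Rmult_le_reg_r with (d/2); lra.
Qed.

Lemma is_cderiv_const c s : is_cderiv (fun _ => c) s 0.
Proof.
  exists (fun _ => RtoC 0). split; [intros; ring|]. split; [reflexivity|apply flim_const].
Qed.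

Lemma is_cderiv_id s : is_cderiv (fun w => w) s 1.
Proof.
  exists (fun _ => RtoC 1). split; [intros; ring|]. split; [reflexivity|apply flim_const].
Qed.

Lemma is_cderiv_plus f g s a b :
  is_cderiv f s a -> is_cderiv g s b -> is_cderiv (fun w => f w + g w)%C s (a + b)%C.
Proof.
  intros [p [P1 [<- P3]]] [q [Q1 [<- Q3]]].
  exists (fun w => p w + q w)%C. split; [|split].
  - intros w. rewrite (P1 w), (Q1 w). ring.
  - reflexivity.
  - apply (flim_plus p q); assumption.
Qed.

Lemma is_cderiv_mult f g s a b :
  is_cderiv f s a -> is_cderiv g s b ->
  is_cderiv (fun w => f w * g w)%C s (a * g s + f s * b)%C.
Proof.
  intros Hf Hg. generalize (is_cderiv_cont _ _ _ Hg). intros Hc. revert Hf Hg.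
  intros [p [P1 [<- P3]]] [q [Q1 [<- Q3]]].
  exists (fun w => p w * g w + f s * q w)%C. split; [|split].
  - intros w. rewrite (P1 w), (Q1 w). ring.
  - reflexivity.
  - unfold ccont. apply flim_plus; apply flim_mult; try assumption. apply flim_const.
Qed.

Lemma is_cderiv_comp f g s a b :
  is_cderiv f s a -> is_cderiv g (f s) b -> is_cderiv (fun w => g (f w)) s (b * a)%C.
Proof.
  intros Hf Hg. generalize (is_cderiv_cont _ _ _ Hf). intros Hc. revert Hf Hg.
  intros [p [P1 [<- P3]]] [q [Q1 [<- Q3]]].
  exists (fun w => q (f w) * p w)%C. split; [|split].
  - intros w. rewrite (Q1 (f w)). rewrite (P1 w) at 2. ring.
  - reflexivity.
  - unfold ccont. apply flim_mult; [|assumption]. apply (flim_comp (cnbhs s) f q (f s)); assumption.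
Qed.

Lemma is_cderiv_inv f s a : f s <> RtoC 0 ->
  is_cderiv f s a -> is_cderiv (fun w => / f w)%C s (- a / (f s * f s))%C.
Proof.
  intros H0 Hf. generalize (is_cderiv_cont _ _ _ Hf). intros Hc.
  destruct Hf as [p [P1 [<- P3]]].
  (* Caratheodory's identity must hold for every [w], also where [f w = 0]. There the inverse is
     replaced by the value that makes the identity true, which changes nothing near [s]. *)
  assert (K : is_cderiv (fun w => if C_eq_dec (f w) 0 then / f s - p w / (f s * f s) * (w - s) else / f w)%C s
                (- p s / (f s * f s))%C).
  { exists (fun w => if C_eq_dec (f w) 0 then - p w / (f s * f s) else - p w / (f w * f s))%C.
    split; [|split].
    - intros w. destruct (C_eq_dec (f s) 0) as [|_]; [contradiction|].
      destruct (C_eq_dec (f w) 0) as [E|E]; [field; auto|].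
      assert (P : (p w * (w - s) = f w - f s)%C) by (rewrite (P1 w); ring).
      replace (- p w / (f w * f s) * (w - s))%C with (- (p w * (w - s)) / (f w * f s))%C
        by (field; auto).
      rewrite P. field. auto.
    - destruct (C_eq_dec (f s) 0); [contradiction|reflexivity].
    - unfold ccont. destruct (C_eq_dec (f s) 0) as [|_]; [contradiction|].
      apply flim_ext_loc with (fun w => - p w / (f w * f s))%C.
      + generalize (flim_away_from_0 _ _ H0 Hc). apply filter_imp. intros w Hw.
        destruct (C_eq_dec (f w) 0) as [E|]; [|reflexivity].
        rewrite E, Cmod_0 in Hw. generalize (Cmod_ge_0 (f s)). lra.
      + apply flim_div; [now apply Cmult_neq_0|now apply flim_opp|].
        apply flim_mult; [exact Hc|apply flim_const]. }
  revert K. apply is_cderiv_ext_loc.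
  generalize (flim_away_from_0 _ _ H0 Hc). apply filter_imp. intros w Hw.
  destruct (C_eq_dec (f w) 0) as [E|]; [|reflexivity].
  rewrite E, Cmod_0 in Hw. generalize (Cmod_ge_0 (f s)). lra.
Qed.

Lemma cholo_const c s : cholo (fun _ => c) s.
Proof. eexists. apply is_cderiv_const. Qed.

Lemma cholo_id s : cholo (fun w => w) s.
Proof. eexists. apply is_cderiv_id. Qed.

Lemma cholo_plus f g s : cholo f s -> cholo g s -> cholo (fun w => f w + g w)%C s.
Proof. intros [a Ha] [b Hb]. eexists. apply is_cderiv_plus; eassumption. Qed.

Lemma cholo_mult f g s : cholo f s -> cholo g s -> cholo (fun w => f w * g w)%C s.
Proof. intros [a Ha] [b Hb]. eexists. apply is_cderiv_mult; eassumption. Qed.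

Lemma cholo_comp f g s : cholo f s -> cholo g (f s) -> cholo (fun w => g (f w)) s.
Proof. intros [a Ha] [b Hb]. eexists. eapply is_cderiv_comp; eassumption. Qed.

Lemma cholo_opp f s : cholo f s -> cholo (fun w => - f w)%C s.
Proof.
  intros H. apply cholo_ext with (fun w => (- (1)) * f w)%C; [intros; ring|].
  apply cholo_mult; [apply cholo_const|exact H].
Qed.

Lemma cholo_minus f g s : cholo f s -> cholo g s -> cholo (fun w => f w - g w)%C s.
Proof. intros. apply cholo_plus; [|apply cholo_opp]; assumption. Qed.

Lemma cholo_inv f s : f s <> RtoC 0 -> cholo f s -> cholo (fun w => / f w)%C s.
Proof. intros H0 [a Ha]. eexists. apply is_cderiv_inv; eassumption. Qed.

Lemma cholo_div f g s : g s <> RtoC 0 -> cholo f s -> cholo g s -> cholo (fun w => f w / g w)%C s.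
Proof. intros. apply cholo_mult; [|apply cholo_inv]; assumption. Qed.

Lemma cholo_pow f n s : cholo f s -> cholo (fun w => f w ^ n)%C s.
Proof.
  intros H. induction n as [|n IH]; [apply (cholo_const 1)|].
  apply (cholo_mult f (fun w => f w ^ n)%C); assumption.
Qed.

Lemma cholo_csum (f : nat -> C -> C) n s :
  (forall k, (k < n)%nat -> cholo (f k) s) -> cholo (fun w => csum (fun k => f k w) n) s.
Proof.
  induction n as [|n IH]; intros H; [apply (cholo_const 0)|].
  apply (cholo_plus (fun w => csum (fun k => f k w) n) (f n)).
  - apply IH. intros k Hk. apply H. lia.
  - apply H. lia.
Qed.

Lemma is_cderiv_affine a d s : is_cderiv (fun w => a + w * d)%C s d.
Proof.
  exists (fun _ => d). split; [intros; ring|]. split; [reflexivity|apply flim_const].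
Qed.

(** Used at filled-in singularities, where a growth bound is all that is known near [p]. *)
Lemma cholo_of_quadratic (f : C -> C) (p : C) M :
  f p = RtoC 0 -> cnbhs p (fun w => Cmod (f w) <= M * (Cmod (w - p) * Cmod (w - p))) ->
  is_cderiv f p 0.
Proof.
  intros H0 H. apply is_cderiv_eps. intros eps He.
  set (M' := Rabs M + 1). assert (HM : 0 < M') by (unfold M'; generalize (Rabs_pos M); lra).
  generalize (filter_and _ _ H (cnbhs_ball p (eps / M') (Rdiv_lt_0_compat _ _ He HM))).
  apply filter_imp. intros w [K1 K2]. rewrite H0.
  replace (f w - 0 - 0 * (w - p))%C with (f w) by ring.
  assert (Hp := Cmod_ge_0 (w - p)).
  assert (K3 : M' * Cmod (w - p) <= eps).
  { apply Rmult_lt_compat_l with (r := M') in K2; [|lra].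
    replace (M' * (eps / M')) with eps in K2 by (field; lra). lra. }
  apply Rle_trans with (M' * Cmod (w - p) * Cmod (w - p)).
  - rewrite Rmult_assoc. eapply Rle_trans; [exact K1|].
    apply Rmult_le_compat_r; [nra|]. unfold M'. generalize (RRle_abs M). lra.
  - now apply Rmult_le_compat_r.
Qed.

(** * Integrals of complex-valued functions of a real variable *)

Definition cint (g : R -> C) (a b : R) : C :=
  (RInt (fun t => Re (g t)) a b, RInt (fun t => Im (g t)) a b).

Definition ex_cint (g : R -> C) (a b : R) : Prop :=
  ex_RInt (fun t => Re (g t)) a b /\ ex_RInt (fun t => Im (g t)) a b.

Definition rcont (g : R -> C) (t : R) : Prop :=
  continuous (fun t => Re (g t)) t /\ continuous (fun t => Im (g t)) t.

Definition is_rderiv (g : R -> C) (t : R) (l : C) : Prop :=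
  is_derive (fun t => Re (g t)) t (Re l) /\ is_derive (fun t => Im (g t)) t (Im l).

Lemma Cmod_affine_sub (a d : C) (t u : R) :
  Cmod ((a + RtoC u * d) - (a + RtoC t * d)) = Rabs (u - t) * Cmod d.
Proof.
  replace ((a + RtoC u * d) - (a + RtoC t * d))%C with (RtoC (u - t) * d)%C
    by (rewrite RtoC_minus; ring).
  now rewrite Cmod_mult, Cmod_R.
Qed.

Lemma cnbhs_affine (a d : C) (t : R) (P : C -> Prop) :
  cnbhs (a + RtoC t * d) P -> locally t (fun u => P (a + RtoC u * d)%C).
Proof.
  intros [e [He H]].
  assert (Hd : 0 < Cmod d + 1) by (generalize (Cmod_ge_0 d); lra).
  assert (Hp : 0 < e / (Cmod d + 1)) by (apply Rdiv_lt_0_compat; lra).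
  exists (mkposreal _ Hp). intros u Hu. apply H. rewrite Cmod_affine_sub.
  change (Rabs (u - t) < e / (Cmod d + 1)) in Hu.
  apply Rle_lt_trans with (Rabs (u - t) * (Cmod d + 1)).
  - apply Rmult_le_compat_l; [apply Rabs_pos|lra].
  - apply Rmult_lt_compat_r with (r := Cmod d + 1) in Hu; [|lra].
    replace (e / (Cmod d + 1) * (Cmod d + 1)) with e in Hu by (field; lra). exact Hu.
Qed.

Lemma rcont_affine (f : C -> C) (a d : C) (t : R) :
  ccont f (a + RtoC t * d)%C -> rcont (fun u => f (a + RtoC u * d)%C) t.
Proof.
  intros H. split; apply filterlim_locally; intros eps;
    generalize (cnbhs_affine a d t _ (H eps (cond_pos eps))); apply filter_imp; intros u Hu.
  - change (Rabs (Re (f (a + RtoC u * d)%C) - Re (f (a + RtoC t * d)%C)) < eps).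
    rewrite <- re_minus. eapply Rle_lt_trans; [apply re_le_Cmod|exact Hu].
  - change (Rabs (Im (f (a + RtoC u * d)%C) - Im (f (a + RtoC t * d)%C)) < eps).
    rewrite <- im_minus. eapply Rle_lt_trans; [apply im_le_Cmod|exact Hu].
Qed.

Lemma is_rderiv_affine (f : C -> C) (a d : C) (t : R) (l : C) :
  is_cderiv f (a + RtoC t * d)%C l -> is_rderiv (fun u => f (a + RtoC u * d)%C) t (l * d)%C.
Proof.
  intros H.
  assert (K : forall eps, 0 < eps -> locally t (fun u =>
     Cmod (f (a + RtoC u * d)%C - f (a + RtoC t * d)%C - RtoC (u - t) * (l * d)) <= eps * Rabs (u - t))).
  { intros eps He. rewrite is_cderiv_eps in H.
    assert (Hd : 0 < Cmod d + 1) by (generalize (Cmod_ge_0 d); lra).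
    assert (Hp : 0 < eps / (Cmod d + 1)) by (apply Rdiv_lt_0_compat; lra).
    generalize (cnbhs_affine a d t _ (H _ Hp)). apply filter_imp. intros u Hu.
    rewrite Cmod_affine_sub in Hu.
    replace (l * (a + RtoC u * d - (a + RtoC t * d)))%C with (RtoC (u - t) * (l * d))%C in Hu
      by (rewrite RtoC_minus; ring).
    eapply Rle_trans; [exact Hu|].
    replace (eps * Rabs (u - t)) with (eps / (Cmod d + 1) * (Rabs (u - t) * (Cmod d + 1)))
      by (field; lra).
    apply Rmult_le_compat_l; [lra|]. apply Rmult_le_compat_l; [apply Rabs_pos|lra]. }
  split; (split; [apply is_linear_scal_l|]);
    intros x Hx; apply (is_filter_lim_locally_unique t) in Hx; subst x;
    intros eps; generalize (K eps (cond_pos eps)); apply filter_imp; intros u Hu;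
    change (norm (minus u t)) with (Rabs (u - t)).
  - change (Rabs ((Re (f (a + RtoC u * d)%C) - Re (f (a + RtoC t * d)%C)) - (u - t) * Re (l * d)%C) <= eps * Rabs (u - t)).
    rewrite <- re_scal_l, <- !re_minus. eapply Rle_trans; [apply re_le_Cmod|exact Hu].
  - change (Rabs ((Im (f (a + RtoC u * d)%C) - Im (f (a + RtoC t * d)%C)) - (u - t) * Im (l * d)%C) <= eps * Rabs (u - t)).
    rewrite <- im_scal_l, <- !im_minus. eapply Rle_trans; [apply im_le_Cmod|exact Hu].
Qed.

Lemma ex_cint_cont g a b : a <= b ->
  (forall t, a <= t <= b -> rcont g t) -> ex_cint g a b.
Proof.
  intros Hab H. split; apply (ex_RInt_continuous (V := R_CompleteNormedModule));
    rewrite Rmin_left, Rmax_right by lra; intros t Ht.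
  - exact (proj1 (H t Ht)).
  - exact (proj2 (H t Ht)).
Qed.

Lemma cint_ext g h a b : a <= b ->
  (forall t, a <= t <= b -> g t = h t) -> cint g a b = cint h a b.
Proof.
  intros Hab H. unfold cint. f_equal; apply RInt_ext;
    rewrite Rmin_left, Rmax_right by lra; intros t Ht; rewrite H; auto; lra.
Qed.

Lemma cint_plus g h a b : ex_cint g a b -> ex_cint h a b ->
  cint (fun t => g t + h t)%C a b = (cint g a b + cint h a b)%C.
Proof.
  intros [H1 H2] [K1 K2]. apply Ceq_parts; simpl.
  - now apply (RInt_plus (V := R_CompleteNormedModule)).
  - now apply (RInt_plus (V := R_CompleteNormedModule)).
Qed.

Lemma cint_scal c g a b : ex_cint g a b ->
  cint (fun t => c * g t)%C a b = (c * cint g a b)%C.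
Proof.
  intros [H1 H2].
  assert (E : forall k (u : R -> R), ex_RInt u a b -> RInt (fun t => k * u t) a b = k * RInt u a b).
  { intros k u Hu. now apply (RInt_scal (V := R_CompleteNormedModule)). }
  assert (E' : forall k (u : R -> R), ex_RInt u a b -> ex_RInt (fun t => k * u t) a b).
  { intros k u Hu. now apply (ex_RInt_scal (V := R_NormedModule)). }
  apply Ceq_parts; unfold cint; simpl fst; simpl snd.
  - change (RInt (fun t => minus (Re c * Re (g t)) (Im c * Im (g t))) a b
      = Re c * RInt (fun t => Re (g t)) a b - Im c * RInt (fun t => Im (g t)) a b).
    rewrite (RInt_minus (V := R_CompleteNormedModule)) by auto. now rewrite !E.
  - change (RInt (fun t => plus (Re c * Im (g t)) (Im c * Re (g t))) a b
      = Re c * RInt (fun t => Im (g t)) a b + Im c * RInt (fun t => Re (g t)) a b).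
    rewrite (RInt_plus (V := R_CompleteNormedModule)) by auto. now rewrite !E.
Qed.

Lemma ex_cint_sub g a b c : a <= b <= c -> ex_cint g a c -> ex_cint g a b /\ ex_cint g b c.
Proof.
  intros H [H1 H2]. repeat split.
  - now apply (ex_RInt_Chasles_1 (V := R_CompleteNormedModule) _ a b c).
  - now apply (ex_RInt_Chasles_1 (V := R_CompleteNormedModule) _ a b c).
  - now apply (ex_RInt_Chasles_2 (V := R_CompleteNormedModule) _ a b c).
  - now apply (ex_RInt_Chasles_2 (V := R_CompleteNormedModule) _ a b c).
Qed.

Lemma cint_Chasles g a b c : a <= b <= c -> ex_cint g a c ->
  cint g a c = (cint g a b + cint g b c)%C.
Proof.
  intros H Hg. destruct (ex_cint_sub _ _ _ _ H Hg) as [[H1 H2] [K1 K2]].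
  apply Ceq_parts; simpl; symmetry; now apply (RInt_Chasles (V := R_CompleteNormedModule)).
Qed.

(** The factor 2 comes from bounding the real and the imaginary part separately. *)
Lemma cint_norm_le g a b M : a <= b -> ex_cint g a b ->
  (forall t, a <= t <= b -> Cmod (g t) <= M) -> Cmod (cint g a b) <= 2 * M * (b - a).
Proof.
  intros Hab [H1 H2] HM.
  assert (E : forall u : R -> R, ex_RInt u a b -> (forall t, a <= t <= b -> Rabs (u t) <= M) ->
     Rabs (RInt u a b) <= M * (b - a)).
  { intros u Hu Hb. rewrite (Rmult_comm M). apply abs_RInt_le_const; auto. }
  eapply Rle_trans; [apply Cmod_le_parts|]. unfold cint; simpl.
  replace (2 * M * (b - a)) with (M * (b - a) + M * (b - a)) by ring.
  apply Rplus_le_compat; apply E; auto; intros t Ht.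
  - eapply Rle_trans; [apply re_le_Cmod|auto].
  - eapply Rle_trans; [apply im_le_Cmod|auto].
Qed.

Lemma cint_derive G g a b : a <= b ->
  (forall t, a <= t <= b -> is_rderiv G t (g t)) ->
  (forall t, a <= t <= b -> rcont g t) -> cint g a b = (G b - G a)%C.
Proof.
  intros Hab HG Hg. apply Ceq_parts; simpl; apply is_RInt_unique.
  - apply (is_RInt_derive (V := R_CompleteNormedModule) (fun t => Re (G t)));
      rewrite Rmin_left, Rmax_right by lra; intros t Ht;
      [exact (proj1 (HG t Ht))|exact (proj1 (Hg t Ht))].
  - apply (is_RInt_derive (V := R_CompleteNormedModule) (fun t => Im (G t)));
      rewrite Rmin_left, Rmax_right by lra; intros t Ht;
      [exact (proj2 (HG t Ht))|exact (proj2 (Hg t Ht))].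
Qed.

(** * Integrals along the boundary of a rectangle *)

(** Counterclockwise orientation: bottom minus top, then right minus left, where [dw = Ci dt] on the
    vertical sides. *)
Definition rint (f : C -> C) (x0 x1 y0 y1 : R) : C :=
  (cint (fun t => f (t, y0)) x0 x1 - cint (fun t => f (t, y1)) x0 x1
   + Ci * (cint (fun t => f (x1, t)) y0 y1 - cint (fun t => f (x0, t)) y0 y1))%C.

Definition rect (x0 x1 y0 y1 : R) (w : C) : Prop :=
  x0 <= Re w <= x1 /\ y0 <= Im w <= y1.

Definition bdry (x0 x1 y0 y1 : R) (w : C) : Prop :=
  rect x0 x1 y0 y1 w /\ (Re w = x0 \/ Re w = x1 \/ Im w = y0 \/ Im w = y1).

Lemma horizontal_affine (y t : R) : ((0, y) + RtoC t * 1)%C = (t, y).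
Proof. apply Ceq_parts; simpl; ring. Qed.

Lemma vertical_affine (x t : R) : ((x, 0) + RtoC t * Ci)%C = (x, t).
Proof. apply Ceq_parts; simpl; ring. Qed.

Lemma rcont_horizontal f y t : ccont f (t, y) -> rcont (fun u => f (u, y)) t.
Proof.
  intros H. rewrite <- horizontal_affine in H. apply rcont_affine in H.
  destruct H as [H1 H2]. split.
  - revert H1. apply continuous_ext. intros u. now rewrite horizontal_affine.
  - revert H2. apply continuous_ext. intros u. now rewrite horizontal_affine.
Qed.

Lemma rcont_vertical f x t : ccont f (x, t) -> rcont (fun u => f (x, u)) t.
Proof.
  intros H. rewrite <- vertical_affine in H. apply rcont_affine in H.
  destruct H as [H1 H2]. split.
  - revert H1. apply continuous_ext. intros u. now rewrite vertical_affine.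
  - revert H2. apply continuous_ext. intros u. now rewrite vertical_affine.
Qed.

Lemma is_rderiv_horizontal f y t l : is_cderiv f (t, y) l -> is_rderiv (fun u => f (u, y)) t l.
Proof.
  intros H. rewrite <- horizontal_affine in H. apply is_rderiv_affine in H.
  destruct H as [H1 H2]. replace (l * 1)%C with l in H1, H2 by ring. split.
  - revert H1. apply is_derive_ext. intros u. now rewrite horizontal_affine.
  - revert H2. apply is_derive_ext. intros u. now rewrite horizontal_affine.
Qed.

Lemma is_rderiv_vertical f x t l : is_cderiv f (x, t) l -> is_rderiv (fun u => f (x, u)) t (l * Ci)%C.
Proof.
  intros H. rewrite <- vertical_affine in H. apply is_rderiv_affine in H.
  destruct H as [H1 H2]. split.
  - revert H1. apply is_derive_ext. intros u. now rewrite vertical_affine.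
  - revert H2. apply is_derive_ext. intros u. now rewrite vertical_affine.
Qed.

Section Rect.
Variables (x0 x1 y0 y1 : R).
Hypotheses (Hx : x0 <= x1) (Hy : y0 <= y1).

Lemma bdry_sides (P : C -> Prop) : (forall w, bdry x0 x1 y0 y1 w -> P w) ->
  (forall t, x0 <= t <= x1 -> P (t, y0)) /\ (forall t, x0 <= t <= x1 -> P (t, y1)) /\
  (forall t, y0 <= t <= y1 -> P (x0, t)) /\ (forall t, y0 <= t <= y1 -> P (x1, t)).
Proof.
  intros H. split; [|split; [|split]]; intros t Ht; apply H; unfold bdry, rect; simpl; split; try lra; tauto.
Qed.

Lemma ex_cint_sides f : (forall w, bdry x0 x1 y0 y1 w -> ccont f w) ->
  ex_cint (fun t => f (t, y0)) x0 x1 /\ ex_cint (fun t => f (t, y1)) x0 x1 /\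
  ex_cint (fun t => f (x0, t)) y0 y1 /\ ex_cint (fun t => f (x1, t)) y0 y1.
Proof.
  intros H. destruct (bdry_sides _ H) as [H1 [H2 [H3 H4]]].
  split; [|split; [|split]]; apply ex_cint_cont; auto; intros t Ht.
  - apply rcont_horizontal; auto.
  - apply rcont_horizontal; auto.
  - apply rcont_vertical; auto.
  - apply rcont_vertical; auto.
Qed.

Lemma rint_ext f g : (forall w, bdry x0 x1 y0 y1 w -> f w = g w) ->
  rint f x0 x1 y0 y1 = rint g x0 x1 y0 y1.
Proof.
  intros H. destruct (bdry_sides _ H) as [H1 [H2 [H3 H4]]]. unfold rint.
  rewrite (cint_ext (fun t => f (t, y0)) (fun t => g (t, y0))) by auto.
  rewrite (cint_ext (fun t => f (t, y1)) (fun t => g (t, y1))) by auto.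
  rewrite (cint_ext (fun t => f (x0, t)) (fun t => g (x0, t))) by auto.
  rewrite (cint_ext (fun t => f (x1, t)) (fun t => g (x1, t))) by auto. reflexivity.
Qed.

Lemma rint_plus f g : (forall w, bdry x0 x1 y0 y1 w -> ccont f w) ->
  (forall w, bdry x0 x1 y0 y1 w -> ccont g w) ->
  rint (fun w => f w + g w)%C x0 x1 y0 y1 = (rint f x0 x1 y0 y1 + rint g x0 x1 y0 y1)%C.
Proof.
  intros Hf Hg. destruct (ex_cint_sides _ Hf) as [H1 [H2 [H3 H4]]].
  destruct (ex_cint_sides _ Hg) as [K1 [K2 [K3 K4]]]. unfold rint.
  rewrite !cint_plus by auto. ring.
Qed.

Lemma rint_scal c f : (forall w, bdry x0 x1 y0 y1 w -> ccont f w) ->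
  rint (fun w => c * f w)%C x0 x1 y0 y1 = (c * rint f x0 x1 y0 y1)%C.
Proof.
  intros Hf. destruct (ex_cint_sides _ Hf) as [H1 [H2 [H3 H4]]]. unfold rint.
  rewrite !cint_scal by auto. ring.
Qed.

Lemma rint_norm_le f M : (forall w, bdry x0 x1 y0 y1 w -> ccont f w) ->
  (forall w, bdry x0 x1 y0 y1 w -> Cmod (f w) <= M) ->
  Cmod (rint f x0 x1 y0 y1) <= 4 * M * ((x1 - x0) + (y1 - y0)).
Proof.
  intros Hf HM. destruct (ex_cint_sides _ Hf) as [H1 [H2 [H3 H4]]].
  destruct (bdry_sides _ HM) as [K1 [K2 [K3 K4]]]. unfold rint.
  eapply Rle_trans; [apply Cmod_triangle|]. rewrite Cmod_mult, Cmod_Ci, Rmult_1_l.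
  generalize (Cmod_sub_le (cint (fun t => f (t, y0)) x0 x1) (cint (fun t => f (t, y1)) x0 x1)).
  generalize (Cmod_sub_le (cint (fun t => f (x1, t)) y0 y1) (cint (fun t => f (x0, t)) y0 y1)).
  generalize (cint_norm_le _ _ _ M Hx H1 K1) (cint_norm_le _ _ _ M Hx H2 K2)
    (cint_norm_le _ _ _ M Hy H3 K3) (cint_norm_le _ _ _ M Hy H4 K4). lra.
Qed.

(** By the fundamental theorem each side contributes a difference of corner values of [F], and these
    cancel around the rectangle. *)
Lemma rint_primitive F f : (forall w, bdry x0 x1 y0 y1 w -> is_cderiv F w (f w)) ->
  (forall w, bdry x0 x1 y0 y1 w -> ccont f w) -> rint f x0 x1 y0 y1 = 0.
Proof.
  intros HF Hf. destruct (ex_cint_sides _ Hf) as [_ [_ [E3 E4]]].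
  destruct (bdry_sides _ HF) as [H1 [H2 [H3 H4]]].
  destruct (bdry_sides _ Hf) as [K1 [K2 [K3 K4]]]. unfold rint.
  assert (A : forall y, (forall t, x0 <= t <= x1 -> is_cderiv F (t, y) (f (t, y))) ->
     (forall t, x0 <= t <= x1 -> ccont f (t, y)) ->
     cint (fun t => f (t, y)) x0 x1 = (F (x1, y) - F (x0, y))%C).
  { intros y A1 A2. apply (cint_derive (fun t => F (t, y))); auto; intros t Ht.
    - apply is_rderiv_horizontal. auto.
    - apply rcont_horizontal. auto. }
  assert (B : forall x, (forall t, y0 <= t <= y1 -> is_cderiv F (x, t) (f (x, t))) ->
     (forall t, y0 <= t <= y1 -> ccont f (x, t)) ->
     (Ci * cint (fun t => f (x, t)) y0 y1)%C = (F (x, y1) - F (x, y0))%C).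
  { intros x A1 A2.
    rewrite <- (cint_scal Ci).
    2: { apply ex_cint_cont; auto. intros t Ht. apply rcont_vertical. auto. }
    apply (cint_derive (fun t => F (x, t))); auto; intros t Ht.
    - rewrite Cmult_comm. apply is_rderiv_vertical. auto.
    - apply (rcont_vertical (fun w => Ci * f w)%C).
      unfold ccont. apply flim_mult; [apply flim_const|apply A2; auto]. }
  rewrite !A by auto.
  replace (Ci * (cint (fun t => f (x1, t)) y0 y1 - cint (fun t => f (x0, t)) y0 y1))%C
    with (Ci * cint (fun t => f (x1, t)) y0 y1 - Ci * cint (fun t => f (x0, t)) y0 y1)%C by ring.
  rewrite !B by auto. ring.
Qed.

End Rect.

Lemma rint_split_x f x0 m x1 y0 y1 : x0 <= m <= x1 -> y0 <= y1 ->
  (forall w, bdry x0 x1 y0 y1 w -> ccont f w) ->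
  rint f x0 x1 y0 y1 = (rint f x0 m y0 y1 + rint f m x1 y0 y1)%C.
Proof.
  intros Hm Hy Hf. destruct (ex_cint_sides x0 x1 y0 y1 ltac:(lra) Hy f Hf) as [H1 [H2 _]].
  unfold rint. rewrite !(cint_Chasles _ x0 m x1) by auto. ring.
Qed.

Lemma rint_split_y f x0 x1 y0 m y1 : y0 <= m <= y1 -> x0 <= x1 ->
  (forall w, bdry x0 x1 y0 y1 w -> ccont f w) ->
  rint f x0 x1 y0 y1 = (rint f x0 x1 y0 m + rint f x0 x1 m y1)%C.
Proof.
  intros Hm Hy Hf. destruct (ex_cint_sides x0 x1 y0 y1 Hy ltac:(lra) f Hf) as [_ [_ [H1 H2]]].
  unfold rint. rewrite !(cint_Chasles _ y0 m y1) by auto. ring.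
Qed.

Lemma is_cderiv_eq f s a b : a = b -> is_cderiv f s a -> is_cderiv f s b.
Proof. now intros ->. Qed.

Lemma ccont_const c s : ccont (fun _ => c) s.
Proof. unfold ccont. apply flim_const. Qed.

Lemma ccont_id s : ccont (fun w => w) s.
Proof. unfold ccont. apply flim_id. Qed.

Lemma ccont_plus f g s : ccont f s -> ccont g s -> ccont (fun w => f w + g w)%C s.
Proof. unfold ccont. intros. now apply flim_plus. Qed.

Lemma ccont_mult f g s : ccont f s -> ccont g s -> ccont (fun w => f w * g w)%C s.
Proof. unfold ccont. intros. now apply flim_mult. Qed.

Lemma ccont_minus f g s : ccont f s -> ccont g s -> ccont (fun w => f w - g w)%C s.
Proof. unfold ccont. intros. now apply flim_minus. Qed.

Lemma nested_intervals (a d : nat -> R) :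
  (forall n, 0 <= d n) -> (forall n, a n <= a (S n)) ->
  (forall n, a (S n) + d (S n) <= a n + d n) -> exists l, forall n, a n <= l <= a n + d n.
Proof.
  intros Hd Ha Hb.
  assert (A : forall n k, a n <= a (n + k)%nat).
  { intros n k. induction k as [|k IH]; [rewrite Nat.add_0_r; lra|].
    rewrite Nat.add_succ_r. specialize (Ha (n + k)%nat). lra. }
  assert (B : forall n k, a (n + k)%nat + d (n + k)%nat <= a n + d n).
  { intros n k. induction k as [|k IH]; [rewrite Nat.add_0_r; lra|].
    rewrite Nat.add_succ_r. specialize (Hb (n + k)%nat). lra. }
  assert (U : forall n m, a m <= a n + d n).
  { intros n m. destruct (Nat.le_ge_cases n m) as [H|H].
    - replace m with (n + (m - n))%nat by lia. specialize (B n (m - n)%nat).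
      specialize (Hd (n + (m - n))%nat). lra.
    - replace n with (m + (n - m))%nat by lia. specialize (A m (n - m)%nat).
      specialize (Hd (m + (n - m))%nat). lra. }
  destruct (completeness (fun x => exists n, x = a n)) as [l [Hl1 Hl2]].
  - exists (a O + d O). intros x [n ->]. apply U.
  - exists (a O). now exists O.
  - exists l. intros n. split.
    + apply Hl1. now exists n.
    + apply Hl2. intros x [m ->]. apply U.
Qed.

(** * Goursat's theorem *)

Section Goursat.
Variable f : C -> C.

Let Q (c : C) (w h : R) : R := Cmod (rint f (Re c) (Re c + w) (Im c) (Im c + h)).

(** Comparison of reals is decidable here, so a quarter carrying at least a fourth of the integral
    is computed and no choice principle is needed. Only its lower left corner is recorded. *)
Definition quarter (c : C) (w h : R) : C :=
  if Rle_dec (Q c w h) (4 * Q c (w/2) (h/2)) then c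
  else if Rle_dec (Q c w h) (4 * Q (Re c + w/2, Im c) (w/2) (h/2)) then (Re c + w/2, Im c)
  else if Rle_dec (Q c w h) (4 * Q (Re c, Im c + h/2) (w/2) (h/2)) then (Re c, Im c + h/2)
  else (Re c + w/2, Im c + h/2).

Lemma quarter_spec (c : C) w h : 0 <= w -> 0 <= h ->
  (forall v, rect (Re c) (Re c + w) (Im c) (Im c + h) v -> ccont f v) ->
  Q c w h <= 4 * Q (quarter c w h) (w/2) (h/2) /\
  Re c <= Re (quarter c w h) /\ Re (quarter c w h) + w/2 <= Re c + w /\
  Im c <= Im (quarter c w h) /\ Im (quarter c w h) + h/2 <= Im c + h.
Proof.
  intros Hw Hh Hf. unfold quarter.
  destruct (Rle_dec _ _) as [H1|H1]; [repeat split; simpl; lra|].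
  destruct (Rle_dec _ _) as [H2|H2]; [repeat split; simpl; lra|].
  destruct (Rle_dec _ _) as [H3|H3]; [repeat split; simpl; lra|].
  split; [|repeat split; simpl; lra].
  apply Rnot_le_lt in H1. apply Rnot_le_lt in H2. apply Rnot_le_lt in H3.
  (* If all four quarters failed the test, the triangle inequality for the sum of their integrals
     would be violated. *)
  apply Rnot_lt_le. intros H4.
  revert H1 H2 H3 H4. unfold Q. cbn [Re Im fst snd].
  replace (Re c + w/2 + w/2) with (Re c + w) by field.
  replace (Im c + h/2 + h/2) with (Im c + h) by field.
  intros H1 H2 H3 H4.
  assert (E : rint f (Re c) (Re c + w) (Im c) (Im c + h) =
     (rint f (Re c) (Re c + w/2) (Im c) (Im c + h/2) + rint f (Re c) (Re c + w/2) (Im c + h/2) (Im c + h)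
     + (rint f (Re c + w/2) (Re c + w) (Im c) (Im c + h/2) + rint f (Re c + w/2) (Re c + w) (Im c + h/2) (Im c + h)))%C).
  { rewrite (rint_split_x f (Re c) (Re c + w/2) (Re c + w)); try lra.
    - f_equal; apply rint_split_y; try lra; intros v [[V1 V2] _]; apply Hf; split; lra.
    - intros v [[V1 V2] _]; apply Hf; split; lra. }
  rewrite E in *.
  set (A := rint f (Re c) (Re c + w/2) (Im c) (Im c + h/2)) in *.
  set (B := rint f (Re c) (Re c + w/2) (Im c + h/2) (Im c + h)) in *.
  set (D := rint f (Re c + w/2) (Re c + w) (Im c) (Im c + h/2)) in *.
  set (G := rint f (Re c + w/2) (Re c + w) (Im c + h/2) (Im c + h)) in *.
  generalize (Cmod_triangle (A + B) (D + G)) (Cmod_triangle A B) (Cmod_triangle D G). lra.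
Qed.

Fixpoint quarters (c : C) (w h : R) (n : nat) : C :=
  match n with O => c | S n => quarter (quarters c w h n) (w / 2 ^ n) (h / 2 ^ n) end.

Lemma rint_affine_0 (c a b : C) x0 x1 y0 y1 : x0 <= x1 -> y0 <= y1 ->
  rint (fun w => a + b * (w - c))%C x0 x1 y0 y1 = 0.
Proof.
  intros Hx Hy. apply rint_primitive with (fun w => a * w + b / 2 * ((w - c) * (w - c)))%C; auto.
  - intros w _.
    assert (D : is_cderiv (fun v => v - c)%C w 1).
    { apply is_cderiv_eq with (1 + 0)%C; [ring|].
      apply (is_cderiv_plus (fun v => v) (fun _ => - c)%C); [apply is_cderiv_id|apply is_cderiv_const]. }
    eapply is_cderiv_eq.
    2: { apply is_cderiv_plus.
      - apply is_cderiv_mult; [apply is_cderiv_const|apply is_cderiv_id].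
      - apply is_cderiv_mult; [apply is_cderiv_const|].
        apply (is_cderiv_mult _ _ _ _ _ D D). }
    cbv beta. field.
  - intros w _. apply ccont_plus; [apply ccont_const|]. apply ccont_mult; [apply ccont_const|].
    apply ccont_minus; [apply ccont_id|apply ccont_const].
Qed.

Lemma half_size (w : R) n : w / 2 ^ n / 2 = w / 2 ^ S n.
Proof. simpl. field. apply pow_nonzero. lra. Qed.

Lemma goursat x0 x1 y0 y1 : x0 <= x1 -> y0 <= y1 ->
  (forall v, rect x0 x1 y0 y1 v -> cholo f v) -> rint f x0 x1 y0 y1 = 0.
Proof.
  intros Hx Hy Hf.
  set (w := x1 - x0). set (h := y1 - y0). set (c := quarters (x0, y0) w h).
  assert (Hp : forall n, 0 < 2 ^ n) by (intros; apply pow_lt; lra).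
  assert (Hw : forall n, 0 <= w / 2 ^ n) by (intros; apply Rdiv_le_0_compat; [unfold w; lra|auto]).
  assert (Hh : forall n, 0 <= h / 2 ^ n) by (intros; apply Rdiv_le_0_compat; [unfold h; lra|auto]).
  assert (Inv : forall n, x0 <= Re (c n) /\ Re (c n) + w / 2 ^ n <= x1 /\
                          y0 <= Im (c n) /\ Im (c n) + h / 2 ^ n <= y1 /\
                          Q (c O) w h <= 4 ^ n * Q (c n) (w / 2 ^ n) (h / 2 ^ n)).
  { intros n. induction n as [|n [I1 [I2 [I3 [I4 I5]]]]].
    - unfold c; simpl. rewrite !Rdiv_1_r. unfold w, h. repeat split; lra.
    - change (c (S n)) with (quarter (c n) (w / 2 ^ n) (h / 2 ^ n)).
      destruct (quarter_spec (c n) (w / 2 ^ n) (h / 2 ^ n)) as [J0 [J1 [J2 [J3 J4]]]]; auto.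
      { intros v [V1 V2]. apply cholo_cont, Hf. split; lra. }
      rewrite !half_size in *. repeat split; try lra.
      eapply Rle_trans; [exact I5|].
      replace (4 ^ S n * Q (quarter (c n) (w / 2 ^ n) (h / 2 ^ n)) (w / 2 ^ S n) (h / 2 ^ S n))
        with (4 ^ n * (4 * Q (quarter (c n) (w / 2 ^ n) (h / 2 ^ n)) (w / 2 ^ S n) (h / 2 ^ S n)))
        by (simpl; ring).
      apply Rmult_le_compat_l; [apply pow_le; lra|exact J0]. }
  assert (Mon : forall n, Re (c n) <= Re (c (S n)) /\
            Re (c (S n)) + w / 2 ^ S n <= Re (c n) + w / 2 ^ n /\
            Im (c n) <= Im (c (S n)) /\ Im (c (S n)) + h / 2 ^ S n <= Im (c n) + h / 2 ^ n).
  { intros n. destruct (Inv n) as [I1 [I2 [I3 [I4 I5]]]].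
    change (c (S n)) with (quarter (c n) (w / 2 ^ n) (h / 2 ^ n)).
    destruct (quarter_spec (c n) (w / 2 ^ n) (h / 2 ^ n)) as [J0 [J1 [J2 [J3 J4]]]]; auto.
    { intros v [V1 V2]. apply cholo_cont, Hf. split; lra. }
    rewrite !half_size in *. repeat split; lra. }
  destruct (nested_intervals (fun n => Re (c n)) (fun n => w / 2 ^ n)) as [lx Hlx];
    [auto|intros; apply Mon|intros; apply Mon|].
  destruct (nested_intervals (fun n => Im (c n)) (fun n => h / 2 ^ n)) as [ly Hly];
    [auto|intros; apply Mon|intros; apply Mon|].
  set (p := (lx, ly) : C).
  destruct (Hf p) as [l Hl].
  { specialize (Hlx O). specialize (Hly O). destruct (Inv O) as [I1 [I2 [I3 [I4 _]]]].
    unfold Rdiv in *. rewrite pow_O, Rinv_1, !Rmult_1_r in *.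
    split; [change (Re p) with lx|change (Im p) with ly]; lra. }
  apply Cmod_eq_0. apply Rle_antisym; [|apply Cmod_ge_0]. apply le_epsilon. intros eps He.
  rewrite Rplus_0_l.
  set (S0 := w + h). assert (HS0 : 0 <= S0) by (unfold S0, w, h; lra).
  (* The final bound is [4 * e * (S0 * S0)]; the summand 1 covers a rectangle reduced to a point. *)
  set (e := eps / (4 * (S0 * S0 + 1))).
  assert (He' : 0 < e) by (apply Rdiv_lt_0_compat; nra).
  rewrite is_cderiv_eps in Hl. destruct (Hl e He') as [d [Hd K]].
  assert (Hn : exists n, S0 / 2 ^ n < d).
  { assert (H2 : Rabs 2 > 1) by (rewrite Rabs_pos_eq; lra).
    destruct (Pow_x_infinity 2 H2 (S0 / d + 1)) as [n Hn].
    exists n. specialize (Hn n (le_n _)). rewrite Rabs_pos_eq in Hn by (apply Rlt_le, Hp).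
    specialize (Hp n). apply Rmult_lt_reg_r with (2 ^ n); [exact Hp|].
    unfold Rdiv at 1. rewrite Rmult_assoc, Rinv_l, Rmult_1_r by lra.
    apply Rlt_le_trans with (d * (S0 / d + 1)); [|apply Rmult_le_compat_l; lra].
    replace (d * (S0 / d + 1)) with (S0 + d) by (field; lra). lra. }
  destruct Hn as [n Hn]. destruct (Inv n) as [I1 [I2 [I3 [I4 I5]]]].
  specialize (Hlx n). specialize (Hly n).
  set (wn := w / 2 ^ n) in *. set (hn := h / 2 ^ n) in *.
  assert (HS : S0 / 2 ^ n = wn + hn) by (unfold S0, wn, hn; field; apply Rgt_not_eq, Hp).
  assert (Hwn : 0 <= wn) by apply Hw. assert (Hhn : 0 <= hn) by apply Hh.
  assert (Hdist : forall v, rect (Re (c n)) (Re (c n) + wn) (Im (c n)) (Im (c n) + hn) v ->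
     Cmod (v - p) <= wn + hn).
  { intros v [V1 V2]. eapply Rle_trans; [apply Cmod_le_parts|].
    rewrite re_minus, im_minus. change (Re p) with lx. change (Im p) with ly.
    apply Rplus_le_compat; apply Rabs_le; lra. }
  assert (Hin : forall v, bdry (Re (c n)) (Re (c n) + wn) (Im (c n)) (Im (c n) + hn) v -> cholo f v).
  { intros v [[V1 V2] _]. apply Hf. split; lra. }
  assert (Hrem : forall v, cholo f v -> ccont (fun v => f v - f p - l * (v - p))%C v).
  { intros v Hv. repeat apply ccont_minus; try apply ccont_const.
    - apply cholo_cont; auto.
    - apply ccont_mult; [apply ccont_const|]. apply ccont_minus; [apply ccont_id|apply ccont_const]. }
  (* Only the error of the affine approximation at [p] remains: at most [e] times the size,
     integrated over a perimeter proportional to the size, which balances the factor [4 ^ n]. *)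
  assert (EQ : rint f (Re (c n)) (Re (c n) + wn) (Im (c n)) (Im (c n) + hn) =
     rint (fun v => f v - f p - l * (v - p))%C (Re (c n)) (Re (c n) + wn) (Im (c n)) (Im (c n) + hn)).
  { rewrite (rint_ext _ _ _ _) with (g := fun v => ((f p + l * (v - p)) + (f v - f p - l * (v - p)))%C)
      by (lra || (intros; ring)).
    rewrite rint_plus; try lra.
    - rewrite rint_affine_0 by lra. ring.
    - intros v _. apply ccont_plus; [apply ccont_const|]. apply ccont_mult; [apply ccont_const|].
      apply ccont_minus; [apply ccont_id|apply ccont_const].
    - intros v Hv. auto. }
  assert (QB : Q (c n) wn hn <= 4 * (e * (wn + hn)) * (wn + hn)).
  { unfold Q. rewrite EQ. eapply Rle_trans.
    - apply rint_norm_le with (M := e * (wn + hn)); try lra.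
      + intros v Hv. auto.
      + intros v [Hv _]. assert (D := Hdist v Hv).
        eapply Rle_trans; [apply K; lra|]. apply Rmult_le_compat_l; lra.
    - right. ring. }
  assert (QE : Q (c O) w h = Cmod (rint f x0 x1 y0 y1)).
  { unfold Q, c, w, h; simpl. do 2 f_equal; lra. }
  rewrite <- QE. eapply Rle_trans; [exact I5|].
  apply Rle_trans with (4 ^ n * (4 * (e * (wn + hn)) * (wn + hn))).
  { apply Rmult_le_compat_l; [apply pow_le; lra|exact QB]. }
  rewrite <- HS.
  replace (4 ^ n) with (2 ^ n * 2 ^ n) by (rewrite <- Rpow_mult_distr; f_equal; ring).
  replace (2 ^ n * 2 ^ n * (4 * (e * (S0 / 2 ^ n)) * (S0 / 2 ^ n))) with (4 * e * (S0 * S0))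
    by (field; apply Rgt_not_eq, Hp).
  assert (E4 : 4 * e * (S0 * S0 + 1) = eps) by (unfold e; field; nra).
  nra.
Qed.

End Goursat.

(** * Cauchy's formula *)

(** Two vertical and two horizontal cuts along the sides of the small square leave four rectangles
    free of [b], on which Goursat's theorem applies. *)
Lemma rint_shrink f (b : C) x0 x1 y0 y1 e : 0 < e ->
  x0 < Re b - e -> Re b + e < x1 -> y0 < Im b - e -> Im b + e < y1 ->
  (forall v, rect x0 x1 y0 y1 v -> v <> b -> cholo f v) ->
  rint f x0 x1 y0 y1 = rint f (Re b - e) (Re b + e) (Im b - e) (Im b + e).
Proof.
  intros He H1 H2 H3 H4 Hf.
  assert (Hc : forall u0 u1 v0 v1, x0 <= u0 -> u1 <= x1 -> y0 <= v0 -> v1 <= y1 ->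
      (Re b < u0 \/ u1 < Re b \/ Im b < v0 \/ v1 < Im b \/
       (u0 <> Re b /\ u1 <> Re b /\ v0 <> Im b /\ v1 <> Im b)) ->
      forall w, bdry u0 u1 v0 v1 w -> ccont f w).
  { intros u0 u1 v0 v1 K1 K2 K3 K4 K5 w [[W1 W2] W3]. apply cholo_cont, Hf.
    - split; lra.
    - intros ->. intuition lra. }
  assert (Hz : forall u0 u1 v0 v1, x0 <= u0 -> u0 <= u1 -> u1 <= x1 -> y0 <= v0 -> v0 <= v1 -> v1 <= y1 ->
      (Re b < u0 \/ u1 < Re b \/ Im b < v0 \/ v1 < Im b) -> rint f u0 u1 v0 v1 = 0).
  { intros u0 u1 v0 v1 K1 K2 K3 K4 K5 K6 K7. apply goursat; auto.
    intros w [W1 W2]. apply Hf; [split; lra|]. intros ->. lra. }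
  rewrite (rint_split_x f x0 (Re b - e) x1); [|lra|lra|apply Hc; lra].
  rewrite (rint_split_x f (Re b - e) (Re b + e) x1); [|lra|lra|apply Hc; lra].
  rewrite (rint_split_y f (Re b - e) (Re b + e) y0 (Im b - e) y1); [|lra|lra|apply Hc; lra].
  rewrite (rint_split_y f (Re b - e) (Re b + e) (Im b - e) (Im b + e) y1); [|lra|lra|apply Hc; lra].
  rewrite (Hz x0 (Re b - e)), (Hz (Re b + e) x1), (Hz (Re b - e) (Re b + e) y0 (Im b - e)),
    (Hz (Re b - e) (Re b + e) (Im b + e) y1) by lra.
  ring.
Qed.

Lemma interior_margin (b : C) x0 x1 y0 y1 : x0 < Re b < x1 -> y0 < Im b < y1 ->
  exists r, 0 < r /\ forall e, 0 < e < r ->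
    x0 < Re b - e /\ Re b + e < x1 /\ y0 < Im b - e /\ Im b + e < y1.
Proof.
  intros H1 H2.
  exists (Rmin (Rmin (Re b - x0) (x1 - Re b)) (Rmin (Im b - y0) (y1 - Im b))). split.
  - repeat apply Rmin_glb_lt; lra.
  - intros e [E1 E2].
    assert (A1 := Rmin_l (Rmin (Re b - x0) (x1 - Re b)) (Rmin (Im b - y0) (y1 - Im b))).
    assert (A2 := Rmin_r (Rmin (Re b - x0) (x1 - Re b)) (Rmin (Im b - y0) (y1 - Im b))).
    assert (A3 := Rmin_l (Re b - x0) (x1 - Re b)). assert (A4 := Rmin_r (Re b - x0) (x1 - Re b)).
    assert (A5 := Rmin_l (Im b - y0) (y1 - Im b)). assert (A6 := Rmin_r (Im b - y0) (y1 - Im b)).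
    lra.
Qed.

(** The contour shrinks to squares around [b] whose perimeter tends to 0 while [f] stays bounded. *)
Lemma goursat_bounded_point f (b : C) M r x0 x1 y0 y1 :
  x0 < Re b < x1 -> y0 < Im b < y1 -> 0 < r ->
  (forall v, rect x0 x1 y0 y1 v -> v <> b -> cholo f v) ->
  (forall v, v <> b -> Cmod (v - b) < r -> Cmod (f v) <= M) ->
  rint f x0 x1 y0 y1 = 0.
Proof.
  intros Hx Hy Hr Hf HM. destruct (interior_margin b x0 x1 y0 y1 Hx Hy) as [r' [Hr' Hin]].
  apply Cmod_eq_0. apply Rle_antisym; [|apply Cmod_ge_0]. apply le_epsilon. intros eps Heps.
  rewrite Rplus_0_l. set (M' := Rabs M + 1).
  assert (HM' : 0 < M') by (unfold M'; generalize (Rabs_pos M); lra).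
  set (e := Rmin (Rmin (r'/2) (r/4)) (eps / (16 * M'))).
  assert (E3 : 0 < eps / (16 * M')) by (apply Rdiv_lt_0_compat; lra).
  assert (He : 0 < e) by (unfold e; repeat apply Rmin_glb_lt; lra).
  assert (E1 : e <= r'/2) by (eapply Rle_trans; [apply Rmin_l|apply Rmin_l]).
  assert (E2 : e <= r/4) by (eapply Rle_trans; [apply Rmin_l|apply Rmin_r]).
  assert (E4 : e <= eps / (16 * M')) by apply Rmin_r.
  destruct (Hin e ltac:(lra)) as [I1 [I2 [I3 I4]]].
  rewrite (rint_shrink f b x0 x1 y0 y1 e) by assumption.
  assert (Hb : forall w, bdry (Re b - e) (Re b + e) (Im b - e) (Im b + e) w -> w <> b).
  { intros w [_ W] ->. lra. }
  eapply Rle_trans; [apply rint_norm_le with (M := M'); try lra|].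
  - intros w Hw. apply cholo_cont, Hf; [|now apply Hb].
    destruct Hw as [[W1 W2] _]. split; lra.
  - intros w Hw. apply Rle_trans with M; [|unfold M'; generalize (RRle_abs M); lra].
    apply HM; [now apply Hb|]. destruct Hw as [[W1 W2] _].
    eapply Rle_lt_trans; [apply Cmod_le_parts|]. rewrite re_minus, im_minus.
    assert (Rabs (Re w - Re b) <= e) by (apply Rabs_le; lra).
    assert (Rabs (Im w - Im b) <= e) by (apply Rabs_le; lra). lra.
  - replace (Re b + e - (Re b - e) + (Im b + e - (Im b - e))) with (4 * e) by ring.
    apply Rmult_le_compat_l with (r := 16 * M') in E4; [|lra].
    replace (16 * M' * (eps / (16 * M'))) with eps in E4 by (field; lra). lra.
Qed.

Lemma atan_ratio_half_pi (e : R) : 0 < e -> atan (e / e) - atan (- e / e) = PI / 2.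
Proof.
  intros He. replace (e / e) with 1 by (field; lra). replace (- e / e) with (Ropp 1) by (field; lra).
  rewrite atan_opp, atan_1. field.
Qed.


(** On a side of a square centred at the pole the logarithmic part of the primitive is even and
    cancels, while the arctangent gains [PI / 2]; four such sides make up [2 * PI * Ci]. *)
Lemma cint_inv_vertical (c k e : R) : 0 < e -> k = e \/ k = - e ->
  cint (fun t => / (k, t - c)%R)%C (c - e) (c + e) = RtoC (k / e * (PI / 2)).
Proof.
  intros He Hk. assert (Hk2 : k * k = e * e) by (destruct Hk; subst; ring).
  assert (Hk0 : k <> 0) by (destruct Hk; lra).
  assert (P : forall t, 0 < (t - c) * (t - c) + e * e)
    by (intros t; generalize (Rle_0_sqr (t - c)); unfold Rsqr; nra).
  rewrite (cint_ext _ (fun t => (k / ((t - c) * (t - c) + e * e), - (t - c) / ((t - c) * (t - c) + e * e)))); [|lra|].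
  2: { intros t _. unfold Cinv; simpl. f_equal; f_equal; nra. }
  rewrite (cint_derive (fun t => (k / e * atan ((t - c) / e), - ln ((t - c) * (t - c) + e * e) / 2)) _ (c - e) (c + e)).
  - apply Ceq_parts; simpl.
    + assert (A := atan_ratio_half_pi e He).
      transitivity (k / e * (atan (e / e) - atan (- e / e))); [|now rewrite A].
      replace (c + e - c) with e by ring. replace (c - e - c) with (- e) by ring. ring.
    + replace ((c + e - c) * (c + e - c)) with (e * e) by ring.
      replace ((c - e - c) * (c - e - c)) with (e * e) by ring. field.
  - lra.
  - intros t _. specialize (P t). split; simpl; auto_derive.
    + lra.
    + field. split; [nra|]. lra.
    + apply P.
    + field. unfold Rminus in *. nra.
  - intros t _. specialize (P t). split; simpl.
    + apply (ex_derive_continuous (V := R_NormedModule)). auto_derive. unfold Rminus in *. nra.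
    + apply (ex_derive_continuous (V := R_NormedModule)). auto_derive. unfold Rminus in *. nra.
Qed.

Lemma cint_inv_horizontal (c k e : R) : 0 < e -> k = e \/ k = - e ->
  cint (fun t => / (t - c, k)%R)%C (c - e) (c + e) = (- (Ci * RtoC (k / e * (PI / 2))))%C.
Proof.
  intros He Hk. assert (Hk2 : k * k = e * e) by (destruct Hk; subst; ring).
  assert (P : forall t, 0 < (t - c) * (t - c) + e * e)
    by (intros t; generalize (Rle_0_sqr (t - c)); unfold Rsqr; nra).
  rewrite (cint_ext _ (fun t => ((t - c) / ((t - c) * (t - c) + e * e), - k / ((t - c) * (t - c) + e * e)))); [|lra|].
  2: { intros t _. unfold Cinv; simpl. f_equal; f_equal; nra. }
  rewrite (cint_derive (fun t => (ln ((t - c) * (t - c) + e * e) / 2, - (k / e * atan ((t - c) / e)))) _ (c - e) (c + e)).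
  - apply Ceq_parts; simpl.
    + replace ((c + e - c) * (c + e - c)) with (e * e) by ring.
      replace ((c - e - c) * (c - e - c)) with (e * e) by ring. field. lra.
    + assert (A := atan_ratio_half_pi e He).
      transitivity (- (k / e * (atan (e / e) - atan (- e / e)))); [|rewrite A; ring].
      replace (c + e - c) with e by ring. replace (c - e - c) with (- e) by ring. ring.
  - lra.
  - intros t _. specialize (P t). split; simpl; auto_derive.
    + apply P.
    + field. unfold Rminus in *. nra.
    + lra.
    + field. split; [nra|]. lra.
  - intros t _. specialize (P t). split; simpl.
    + apply (ex_derive_continuous (V := R_NormedModule)). auto_derive. unfold Rminus in *. nra.
    + apply (ex_derive_continuous (V := R_NormedModule)). auto_derive. unfold Rminus in *. nra.
Qed.

Lemma cholo_sub_const b v : cholo (fun w => w - b)%C v.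
Proof. apply cholo_minus; [apply cholo_id|apply cholo_const]. Qed.

Lemma rint_inv_sub (b : C) x0 x1 y0 y1 : x0 < Re b < x1 -> y0 < Im b < y1 ->
  rint (fun w => / (w - b))%C x0 x1 y0 y1 = (2 * PI * Ci)%C.
Proof.
  intros Hx Hy. destruct (interior_margin b x0 x1 y0 y1 Hx Hy) as [r [Hr Hin]].
  set (e := r / 2). assert (He : 0 < e < r) by (unfold e; lra).
  destruct (Hin e He) as [I1 [I2 [I3 I4]]].
  rewrite (rint_shrink _ b x0 x1 y0 y1 e); try lra.
  2: { intros v _ Hv. apply cholo_inv; [now apply Cminus_eq_contra|apply cholo_sub_const]. }
  unfold rint.
  assert (S1 : forall t u, ((t, u) - b)%C = (t - Re b, u - Im b)) by reflexivity.
  assert (Ep : Im b + e - Im b = e) by ring. assert (Em : Im b - e - Im b = - e) by ring.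
  assert (Fp : Re b + e - Re b = e) by ring. assert (Fm : Re b - e - Re b = - e) by ring.
  rewrite (cint_ext _ (fun t => / (t - Re b, - e)%R)%C); [|lra|intros; now rewrite S1, Em].
  rewrite (cint_ext (fun t => / ((t, Im b + e)%R - b))%C (fun t => / (t - Re b, e)%R)%C); [|lra|intros; now rewrite S1, Ep].
  rewrite (cint_ext (fun t => / ((Re b + e, t)%R - b))%C (fun t => / (e, t - Im b)%R)%C); [|lra|intros; now rewrite S1, Fp].
  rewrite (cint_ext (fun t => / ((Re b - e, t)%R - b))%C (fun t => / (- e, t - Im b)%R)%C); [|lra|intros; now rewrite S1, Fm].
  rewrite !cint_inv_horizontal, !cint_inv_vertical by (lra || tauto).
  apply Ceq_parts; simpl; field; lra.
Qed.

Lemma two_pi_i_neq_0 : (2 * PI * Ci)%C <> 0.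
Proof.
  intros E. apply (f_equal Im) in E. simpl in E. generalize PI_RGT_0. nra.
Qed.

Lemma Cmod_two_pi_i_ge : 1 <= Cmod (2 * PI * Ci).
Proof.
  rewrite !Cmod_mult, Cmod_Ci, !Cmod_R, !Rabs_pos_eq; generalize PI_RGT_0 PI2_1; lra.
Qed.

Lemma cauchy_formula f (b : C) x0 x1 y0 y1 : x0 < Re b < x1 -> y0 < Im b < y1 ->
  (forall v, rect x0 x1 y0 y1 v -> cholo f v) ->
  rint (fun w => f w / (w - b))%C x0 x1 y0 y1 = (2 * PI * Ci * f b)%C.
Proof.
  intros Hx Hy Hf.
  assert (Hb : forall w, bdry x0 x1 y0 y1 w -> w <> b).
  { intros w [_ W] ->. lra. }
  assert (Hd : forall v, v <> b -> rect x0 x1 y0 y1 v -> cholo (fun w => (f w - f b) / (w - b))%C v).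
  { intros v Hv Hr. apply cholo_div; [now apply Cminus_eq_contra| |apply cholo_sub_const].
    apply cholo_minus; [auto|apply cholo_const]. }
  assert (Hi : forall v, v <> b -> cholo (fun w => / (w - b))%C v).
  { intros v Hv. apply cholo_inv; [now apply Cminus_eq_contra|apply cholo_sub_const]. }
  rewrite (rint_ext x0 x1 y0 y1 ltac:(lra) ltac:(lra) _
    (fun w => (f w - f b) / (w - b) + f b * / (w - b))%C).
  2: { intros w Hw. field. apply Cminus_eq_contra. auto. }
  rewrite rint_plus; try lra.
  - rewrite rint_scal; try lra.
    + rewrite rint_inv_sub by lra.
      destruct (Hf b) as [l Hl]; [split; lra|]. rewrite is_cderiv_eps in Hl.
      destruct (Hl 1 Rlt_0_1) as [d [Hd1 K]].
      (* Differentiability at [b] bounds the difference quotient nearby, so its integral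
         vanishes. *)
      rewrite (goursat_bounded_point _ b (Cmod l + 1) d); try lra.
      * ring.
      * intros v Hr Hv. now apply Hd.
      * intros v Hv Hv2. specialize (K v Hv2).
        assert (Hp := Cmod_sub_pos _ _ Hv).
        rewrite Cmod_div by now apply Cminus_eq_contra.
        apply Rmult_le_reg_r with (Cmod (v - b)); [exact Hp|].
        unfold Rdiv. rewrite Rmult_assoc, Rinv_l, Rmult_1_r by lra.
        replace (f v - f b)%C with ((f v - f b - l * (v - b)) + l * (v - b))%C by ring.
        eapply Rle_trans; [apply Cmod_triangle|]. rewrite Cmod_mult. lra.
    + intros w Hw. apply cholo_cont, Hi. auto.
  - intros w Hw. apply cholo_cont, Hd; [auto|apply Hw].
  - intros w Hw. apply ccont_mult; [apply ccont_const|]. apply cholo_cont, Hi. auto.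
Qed.

(** * Consequences of Cauchy's formula *)

(** Squares play the part of circles. The square lies in the disc of radius [2 * r] and its boundary
    outside the open disc of radius [r]; hence these two radii in the hypotheses below. *)
Definition sqint (f : C -> C) (p : C) (r : R) : C :=
  rint f (Re p - r) (Re p + r) (Im p - r) (Im p + r).

Lemma square_dist (p w : C) r :
  rect (Re p - r) (Re p + r) (Im p - r) (Im p + r) w -> Cmod (w - p) <= 2 * r.
Proof.
  intros [H1 H2]. eapply Rle_trans; [apply Cmod_le_parts|]. rewrite re_minus, im_minus.
  assert (Rabs (Re w - Re p) <= r) by (apply Rabs_le; lra).
  assert (Rabs (Im w - Im p) <= r) by (apply Rabs_le; lra). lra.
Qed.

Lemma square_bdry_dist (p w : C) r : 0 < r ->
  bdry (Re p - r) (Re p + r) (Im p - r) (Im p + r) w -> r <= Cmod (w - p) <= 2 * r.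
Proof.
  intros Hr [H1 H2]. split; [|now apply square_dist].
  destruct H2 as [H2|[H2|[H2|H2]]].
  - eapply Rle_trans; [|apply re_le_Cmod]. rewrite re_minus, H2.
    rewrite Rabs_left1; lra.
  - eapply Rle_trans; [|apply re_le_Cmod]. rewrite re_minus, H2.
    rewrite Rabs_pos_eq; lra.
  - eapply Rle_trans; [|apply im_le_Cmod]. rewrite im_minus, H2.
    rewrite Rabs_left1; lra.
  - eapply Rle_trans; [|apply im_le_Cmod]. rewrite im_minus, H2.
    rewrite Rabs_pos_eq; lra.
Qed.

Section Disc.
Variables (f : C -> C) (p : C) (r M : R).
Hypothesis Hr : 0 < r.
Hypothesis Hf : forall w, Cmod (w - p) <= 2 * r -> cholo f w.
Hypothesis HM : forall w, r <= Cmod (w - p) <= 2 * r -> Cmod (f w) <= M.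

Lemma sqint_kernel_le (g : C -> C) K : 0 <= K ->
  (forall w, r <= Cmod (w - p) <= 2 * r -> cholo g w /\ Cmod (g w) <= K) ->
  Cmod (sqint (fun w => f w * g w)%C p r) <= 16 * r * (M * K).
Proof.
  intros HK Hg. unfold sqint. eapply Rle_trans.
  - apply rint_norm_le with (M := M * K); try lra.
    + intros w Hw. apply square_bdry_dist in Hw; [|exact Hr].
      apply cholo_cont, cholo_mult; [apply Hf; lra|now apply Hg].
    + intros w Hw. apply square_bdry_dist in Hw; [|exact Hr].
      rewrite Cmod_mult. apply Rmult_le_compat; try apply Cmod_ge_0; auto. now apply Hg.
  - right. ring.
Qed.

Lemma kernel_dist (b w : C) : Cmod (b - p) <= r / 2 -> r <= Cmod (w - p) ->
  r / 2 <= Cmod (w - b).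
Proof.
  intros Hb Hw. generalize (Cmod_triangle_sub w b p). lra.
Qed.

Lemma cauchy_disc (b : C) : Cmod (b - p) <= r / 2 ->
  sqint (fun w => f w * / (w - b))%C p r = (2 * PI * Ci * f b)%C.
Proof.
  intros Hb.
  assert (H1 := re_le_Cmod (b - p)). assert (H2 := im_le_Cmod (b - p)).
  rewrite re_minus in H1. rewrite im_minus in H2.
  apply Rabs_le_between in H1. apply Rabs_le_between in H2.
  assert (Hx : Re p - r < Re b < Re p + r) by lra.
  assert (Hy : Im p - r < Im b < Im p + r) by lra.
  refine (cauchy_formula f b _ _ _ _ Hx Hy _). intros v Hv. apply Hf. now apply square_dist.
Qed.

Lemma inv_kernel (b w : C) : Cmod (b - p) <= r / 2 -> r <= Cmod (w - p) ->
  (w - b)%C <> 0 /\ cholo (fun v => / (v - b))%C w /\ Cmod (/ (w - b)) <= 2 / r.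
Proof.
  intros Hb Hw. assert (D := kernel_dist b w Hb Hw).
  assert (N : (w - b)%C <> 0) by (apply Cmod_gt_0; lra).
  split; [exact N|]. split.
  - apply cholo_inv; [exact N|apply cholo_sub_const].
  - rewrite Cmod_inv by exact N. replace (2 / r) with (/ (r / 2)) by (field; lra).
    apply Rinv_le_contravar; lra.
Qed.

Definition taylor_kernel (n : nat) (h w : C) : C := ((/ (w - p)) ^ n * / (w - (p + h)))%C.

(** [taylor_rem n h] is the coefficient of [h ^ n] in the Taylor expansion of [f (p + h)]
    stopped at order [n]: the remainder is [h ^ n * taylor_rem n h]. *)
Definition taylor_rem (n : nat) (h : C) : C :=
  (sqint (fun w => f w * taylor_kernel n h w) p r / (2 * PI * Ci))%C.

Let center_dist (h : C) : Cmod h <= r / 2 -> Cmod (p + h - p) <= r / 2.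
Proof. replace (p + h - p)%C with h by ring. auto. Qed.

Lemma taylor_kernel_spec n (h w : C) : Cmod h <= r / 2 -> r <= Cmod (w - p) ->
  cholo (taylor_kernel n h) w /\ Cmod (taylor_kernel n h w) <= (2 / r) ^ S n.
Proof.
  intros Hh Hw. destruct (inv_kernel (p + h) w (center_dist h Hh) Hw) as [_ [B1 B2]].
  assert (H0 : Cmod (p - p) <= r / 2).
  { replace (p - p)%C with (RtoC 0) by ring. rewrite Cmod_0. lra. }
  destruct (inv_kernel p w H0 Hw) as [_ [C1 C2]]. unfold taylor_kernel. split.
  - apply cholo_mult; [|exact B1]. now apply (cholo_pow (fun w => / (w - p))%C).
  - rewrite Cmod_mult, Cmod_pow, <- tech_pow_Rmult, (Rmult_comm (2 / r)).
    apply Rmult_le_compat; auto using Cmod_ge_0; [apply pow_le, Cmod_ge_0|].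
    apply pow_incr. split; [apply Cmod_ge_0|exact C2].
Qed.

Lemma Cmod_div_two_pi_i (x : C) : Cmod (x / (2 * PI * Ci)) <= Cmod x.
Proof.
  rewrite Cmod_div by apply two_pi_i_neq_0. unfold Rdiv.
  rewrite <- (Rmult_1_r (Cmod x)) at 2. apply Rmult_le_compat_l; [apply Cmod_ge_0|].
  rewrite <- Rinv_1. apply Rinv_le_contravar; [lra|apply Cmod_two_pi_i_ge].
Qed.

Lemma taylor_rem_le n (h : C) : Cmod h <= r / 2 ->
  Cmod (taylor_rem n h) <= 16 * r * (M * (2 / r) ^ S n).
Proof.
  intros Hh. unfold taylor_rem. eapply Rle_trans; [apply Cmod_div_two_pi_i|].
  apply sqint_kernel_le.
  - apply pow_le, Rdiv_le_0_compat; lra.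
  - intros w Hw. now apply taylor_kernel_spec.
Qed.

Lemma taylor_rem_0 (h : C) : Cmod h <= r / 2 -> taylor_rem 0 h = f (p + h)%C.
Proof.
  intros Hh. unfold taylor_rem.
  replace (sqint (fun w => f w * taylor_kernel 0 h w)%C p r) with (2 * PI * Ci * f (p + h))%C.
  - generalize two_pi_i_neq_0. generalize (2 * PI * Ci)%C. intros K HK. field. exact HK.
  - rewrite <- cauchy_disc by now apply center_dist.
    unfold sqint. apply rint_ext; try lra. intros w _. unfold taylor_kernel. simpl. ring.
Qed.

(** The identity [1 / (w - p - h) = 1 / (w - p) + h / ((w - p) (w - p - h))] under the integral
    sign. *)
Lemma taylor_rem_S n (h : C) : Cmod h <= r / 2 ->
  taylor_rem n h = (taylor_rem n 0 + h * taylor_rem (S n) h)%C.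
Proof.
  intros Hh. assert (H0 : Cmod 0 <= r / 2) by (rewrite Cmod_0; lra).
  unfold taylor_rem.
  replace (sqint (fun w => f w * taylor_kernel n h w)%C p r)
    with (sqint (fun w => f w * taylor_kernel n 0 w)%C p r
          + h * sqint (fun w => f w * taylor_kernel (S n) h w)%C p r)%C.
  { generalize two_pi_i_neq_0. generalize (2 * PI * Ci)%C. intros K HK. field. exact HK. }
  unfold sqint.
  assert (Hlr : Re p - r <= Re p + r) by lra. assert (Hud : Im p - r <= Im p + r) by lra.
  assert (K : forall m k, Cmod k <= r / 2 -> forall w, bdry (Re p - r) (Re p + r) (Im p - r) (Im p + r) w ->
    ccont (fun w => f w * taylor_kernel m k w)%C w).
  { intros m k Hk w Hw. apply square_bdry_dist in Hw; [|exact Hr].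
    apply cholo_cont, cholo_mult; [apply Hf; lra|now apply taylor_kernel_spec]. }
  rewrite <- rint_scal by auto.
  rewrite <- (rint_plus _ _ _ _ Hlr Hud).
  - apply rint_ext; try lra. intros w Hw. apply square_bdry_dist in Hw; [|exact Hr].
    destruct (inv_kernel _ w (center_dist h Hh) (proj1 Hw)) as [N1 _].
    destruct (inv_kernel _ w (center_dist 0 H0) (proj1 Hw)) as [N2 _].
    unfold taylor_kernel. simpl Cpow.
    replace (w - (p + 0))%C with (w - p)%C in * by ring.
    generalize ((/ (w - p)) ^ n)%C. intros A. field. auto.
  - auto.
  - intros w Hw. apply ccont_mult; [apply ccont_const|auto].
Qed.

Lemma cauchy_estimate (b : C) : Cmod (b - p) <= r / 2 -> Cmod (f b) <= 32 * M.
Proof.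
  intros Hb. replace b with (p + (b - p))%C by ring. rewrite <- taylor_rem_0 by exact Hb.
  eapply Rle_trans; [apply taylor_rem_le, Hb|]. right. field. lra.
Qed.

(** The error constant depends on [M] and [r] alone, so the estimate survives passage to a limit of
    functions. *)
Lemma taylor_expansion1 (h : C) : Cmod h <= r / 2 ->
  Cmod (f (p + h)%C - f p - taylor_rem 1 0 * h) <= 128 * M / (r * r) * (Cmod h * Cmod h).
Proof.
  intros Hh. rewrite <- taylor_rem_0 by exact Hh. rewrite (taylor_rem_S 0) by exact Hh.
  rewrite (taylor_rem_S 1) by exact Hh.
  replace (taylor_rem 0 0) with (f p).
  2: { rewrite taylor_rem_0; [f_equal; ring|rewrite Cmod_0; lra]. }
  replace (f p + h * (taylor_rem 1 0 + h * taylor_rem 2 h) - f p - taylor_rem 1 0 * h)%C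
    with (taylor_rem 2 h * (h * h))%C by ring.
  rewrite !Cmod_mult. apply Rmult_le_compat_r.
  - apply Rmult_le_pos; apply Cmod_ge_0.
  - eapply Rle_trans; [apply taylor_rem_le, Hh|]. right. field. lra.
Qed.

End Disc.

Lemma cnbhs_shift (p : C) (P : C -> Prop) : cnbhs 0 (fun h => P (p + h)%C) -> cnbhs p P.
Proof.
  intros [d [Hd H]]. exists d. split; [exact Hd|]. intros w Hw.
  replace w with (p + (w - p))%C by ring. apply H.
  now replace (w - p - 0)%C with (w - p)%C by ring.
Qed.

Lemma is_cderiv_of_second_order (f : C -> C) (p l : C) r K : 0 < r ->
  (forall h, Cmod h <= r -> Cmod (f (p + h)%C - f p - l * h) <= K * (Cmod h * Cmod h)) ->
  is_cderiv f p l.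
Proof.
  intros Hr H.
  assert (Q : is_cderiv (fun w => f w - f p - l * (w - p))%C p 0).
  { apply (cholo_of_quadratic _ p K).
    - ring.
    - apply cnbhs_shift. exists r. split; [exact Hr|]. intros h Hh.
      replace (h - 0)%C with h in Hh by ring.
      replace (p + h - p)%C with h by ring. apply H. lra. }
  assert (A : is_cderiv (fun w => f p + w * l - p * l)%C p l).
  { apply is_cderiv_ext with (fun w => (f p - p * l) + w * l)%C; [intros; ring|].
    apply is_cderiv_affine. }
  apply is_cderiv_eq with (0 + l)%C; [ring|].
  generalize (is_cderiv_plus _ _ _ _ _ Q A). apply is_cderiv_ext. intros w. ring.
Qed.

Lemma Ccomplete (u : nat -> C) :
  (forall eps, 0 < eps -> exists N, forall n m, (N <= n)%nat -> (N <= m)%nat -> Cmod (u n - u m) < eps) ->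
  exists l, flim eventually u l.
Proof.
  intros H.
  destruct (Rcomplete.R_complete (fun n => Re (u n))) as [x Hx].
  { intros eps He. destruct (H eps He) as [N HN]. exists N. intros n m Hn Hm.
    eapply Rle_lt_trans; [|apply (HN n m); lia]. unfold R_dist.
    rewrite <- re_minus. apply re_le_Cmod. }
  destruct (Rcomplete.R_complete (fun n => Im (u n))) as [y Hy].
  { intros eps He. destruct (H eps He) as [N HN]. exists N. intros n m Hn Hm.
    eapply Rle_lt_trans; [|apply (HN n m); lia]. unfold R_dist.
    rewrite <- im_minus. apply im_le_Cmod. }
  exists (x, y). intros eps He.
  destruct (Hx (eps/2) (half_pos _ He)) as [N1 H1]. destruct (Hy (eps/2) (half_pos _ He)) as [N2 H2].
  exists (Nat.max N1 N2). intros n Hn. eapply Rle_lt_trans; [apply Cmod_le_parts|].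
  specialize (H1 n ltac:(lia)). specialize (H2 n ltac:(lia)). unfold R_dist in *.
  rewrite re_minus, im_minus. simpl Re. simpl Im. lra.
Qed.

(** * Weierstrass' convergence theorem *)

Lemma cholo_uniform_limit (f : nat -> C -> C) (g : C -> C) (p : C) r : 0 < r ->
  (forall n w, Cmod (w - p) <= 2 * r -> cholo (f n) w) ->
  (forall eps, 0 < eps -> exists N, forall n w, (N <= n)%nat -> Cmod (w - p) <= 2 * r ->
     Cmod (f n w - g w) <= eps) ->
  cholo g p.
Proof.
  intros Hr Hf Hg. destruct (Hg 1 Rlt_0_1) as [N0 HN0].
  (* No bound on [f n] is given, but the differences from one fixed member are bounded by 2. *)
  set (d := fun n w => (f (N0 + n)%nat w - f N0 w)%C).
  assert (Hd : forall n w, Cmod (w - p) <= 2 * r -> cholo (d n) w).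
  { intros n w Hw. apply cholo_minus; auto. }
  assert (Hd2 : forall n w, r <= Cmod (w - p) <= 2 * r -> Cmod (d n w) <= 2).
  { intros n w [_ Hw]. unfold d. eapply Rle_trans; [apply (Cmod_triangle_sub _ (g w))|].
    rewrite (Cmod_sub_sym (g w)).
    assert (A := HN0 (N0 + n)%nat w ltac:(lia) Hw). assert (B := HN0 N0 w ltac:(lia) Hw). lra. }
  set (k := fun n => taylor_rem (d n) p r 1 0).
  assert (Hk : forall n, is_cderiv (d n) p (k n)).
  { intros n. apply is_cderiv_of_second_order with (r / 2) (128 * 2 / (r * r)); [lra|]. intros h Hh.
    exact (taylor_expansion1 (d n) p r 2 Hr (Hd n) (Hd2 n) h Hh). }
  destruct (Ccomplete k) as [l Hl].
  { intros eps He. set (e := eps * r / 256).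
    assert (He' : 0 < e) by (unfold e; apply Rdiv_lt_0_compat; [nra|lra]).
    destruct (Hg e He') as [N HN]. exists N. intros n m Hn Hm.
    set (dd := fun w => (d n w - d m w)%C).
    assert (Hdd : forall w, Cmod (w - p) <= 2 * r -> cholo dd w).
    { intros w Hw. apply cholo_minus; auto. }
    assert (Hdd2 : forall w, r <= Cmod (w - p) <= 2 * r -> Cmod (dd w) <= 2 * e).
    { intros w [_ Hw]. unfold dd, d.
      replace (f (N0 + n)%nat w - f N0 w - (f (N0 + m)%nat w - f N0 w))%C
        with (f (N0 + n)%nat w - f (N0 + m)%nat w)%C by ring.
      eapply Rle_trans; [apply (Cmod_triangle_sub _ (g w))|]. rewrite (Cmod_sub_sym (g w)).
      assert (A := HN (N0 + n)%nat w ltac:(lia) Hw). assert (B := HN (N0 + m)%nat w ltac:(lia) Hw). lra. }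
    assert (E : (k n - k m)%C = taylor_rem dd p r 1 0).
    { apply is_cderiv_unique with dd p.
      - apply is_cderiv_ext with (fun w => d n w + - (1) * d m w)%C; [intros; unfold dd; ring|].
        eapply is_cderiv_eq; [|apply is_cderiv_plus; [apply Hk|
           apply is_cderiv_mult; [apply is_cderiv_const|apply Hk]]]. cbv beta. ring.
      - apply is_cderiv_of_second_order with (r / 2) (128 * (2 * e) / (r * r)); [lra|]. intros h Hh.
        exact (taylor_expansion1 dd p r (2 * e) Hr Hdd Hdd2 h Hh). }
    assert (H0 : Cmod 0 <= r / 2) by (rewrite Cmod_0; lra).
    rewrite E. eapply Rle_lt_trans; [exact (taylor_rem_le dd p r (2 * e) Hr Hdd Hdd2 1 0 H0)|].
    unfold e. replace (16 * r * (2 * (eps * r / 256) * (2 / r) ^ 2)) with (eps / 2) by (field; lra). lra. }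
  assert (Hlim : forall w, Cmod (w - p) <= 2 * r -> flim eventually (fun n => d n w) (g w - f N0 w)%C).
  { intros w Hw eps He. destruct (Hg (eps/2) (half_pos _ He)) as [N HN]. exists N. intros n Hn.
    unfold d. replace (f (N0 + n)%nat w - f N0 w - (g w - f N0 w))%C with (f (N0 + n)%nat w - g w)%C by ring.
    eapply Rle_lt_trans; [apply HN; [lia|exact Hw]|lra]. }
  assert (Hp : Cmod (p - p) <= 2 * r).
  { replace (p - p)%C with (RtoC 0) by ring. rewrite Cmod_0. lra. }
  (* The second-order estimate, uniform in [n], passes to the limit and exhibits [l] as
     derivative. *)
  assert (K : is_cderiv (fun w => g w - f N0 w)%C p l).
  { apply is_cderiv_of_second_order with (r / 2) (128 * 2 / (r * r)); [lra|]. intros h Hh.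
    replace (g (p + h) - f N0 (p + h) - (g p - f N0 p) - l * h)%C
      with (g (p + h) - f N0 (p + h) - (g p - f N0 p) - l * h - 0)%C by ring.
    apply (flim_Cmod_le (F := eventually) (fun n => d n (p + h)%C - d n p - k n * h)%C).
    - apply flim_minus; [apply flim_minus; apply Hlim|].
      + replace (p + h - p)%C with h by ring. lra.
      + exact Hp.
      + apply flim_mult; [exact Hl|apply flim_const].
    - apply filter_forall. intros n.
      replace (d n (p + h) - d n p - k n * h - 0)%C with (d n (p + h) - d n p - k n * h)%C by ring.
      exact (taylor_expansion1 (d n) p r 2 Hr (Hd n) (Hd2 n) h Hh). }
  apply cholo_ext with (fun w => (g w - f N0 w) + f N0 w)%C; [intros; ring|].
  apply cholo_plus; [now exists l|]. now apply Hf.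
Qed.

(** * Holomorphic division by a linear factor *)

Lemma Cmod_sub_self (p : C) : Cmod (p - p) = 0.
Proof. replace (p - p)%C with (RtoC 0) by ring. apply Cmod_0. Qed.

Lemma ccont_bounded f p : ccont f p -> cnbhs p (fun w => Cmod (f w) <= Cmod (f p) + 1).
Proof.
  intros H. generalize (H 1 Rlt_0_1). apply filter_imp. intros w Hw.
  replace (f w) with ((f w - f p) + f p)%C by ring.
  eapply Rle_trans; [apply Cmod_triangle|]. lra.
Qed.

(** The difference quotient extends over [p], its value and derivative there being the Taylor
    coefficients of order 1 and 2. This serves to split off the simple zeros of [1 + cexp v] and
    [1 - cexp (- u)], and to generate Gregory's coefficients. *)
Lemma cholo_divide f p rho : 0 < rho ->
  (forall w, Cmod (w - p) < rho -> cholo f w) ->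
  exists g, (forall w, f w = f p + (w - p) * g w)%C /\
    (forall w, Cmod (w - p) < rho -> cholo g w) /\ is_cderiv f p (g p).
Proof.
  intros Hrho Hf.
  assert (Hc : ccont f p) by (apply cholo_cont, Hf; rewrite Cmod_sub_self; exact Hrho).
  destruct (ccont_bounded f p Hc) as [d [Hd HM]].
  set (M := Cmod (f p) + 1) in *.
  set (r := Rmin d rho / 4).
  assert (Hr : 0 < r) by (unfold r; generalize (Rmin_glb_lt d rho 0 Hd Hrho); lra).
  assert (Hr1 : 2 * r < d) by (unfold r in *; generalize (Rmin_l d rho); lra).
  assert (Hr2 : 2 * r < rho) by (unfold r in *; generalize (Rmin_r d rho); lra).
  assert (Hf' : forall w, Cmod (w - p) <= 2 * r -> cholo f w) by (intros; apply Hf; lra).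
  assert (HM' : forall w, r <= Cmod (w - p) <= 2 * r -> Cmod (f w) <= M) by (intros; apply HM; lra).
  set (T := taylor_rem f p r).
  assert (H0 : Cmod 0 <= r / 2) by (rewrite Cmod_0; lra).
  assert (TS : forall n h, Cmod h <= r / 2 -> T n h = (T n 0 + h * T (S n) h)%C).
  { intros n h Hh. exact (taylor_rem_S f p r Hr Hf' n h Hh). }
  assert (T0 : forall h, Cmod h <= r / 2 -> f (p + h)%C = T O h).
  { intros h Hh. symmetry. exact (taylor_rem_0 f p r Hr Hf' h Hh). }
  set (g := fun w => if C_eq_dec w p then T 1%nat 0 else ((f w - f p) / (w - p))%C).
  assert (Hg : forall w, f w = (f p + (w - p) * g w)%C).
  { intros w. unfold g. destruct (C_eq_dec w p) as [->|Hw]; [ring|].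
    field. now apply Cminus_eq_contra. }
  assert (Hg1 : forall h, Cmod h <= r / 2 -> g (p + h)%C = T 1%nat h).
  { intros h Hh. unfold g. destruct (C_eq_dec (p + h)%C p) as [E|E].
    - f_equal. replace h with (p + h - p)%C by ring. rewrite E. ring.
    - replace (p + h - p)%C with h by ring.
      assert (Hh0 : h <> 0) by (intros ->; apply E; ring).
      replace (f p) with (T O 0) by (rewrite <- T0 by exact H0; f_equal; ring).
      rewrite T0 by exact Hh. rewrite (TS O h Hh). field. exact Hh0. }
  assert (Hgp : cholo g p).
  { exists (T 2%nat 0). apply is_cderiv_of_second_order with (r / 2) (16 * r * (M * (2 / r) ^ 4)); [lra|].
    intros h Hh. rewrite Hg1 by exact Hh. rewrite (TS 1%nat h Hh), (TS 2%nat h Hh).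
    replace (g p) with (T 1%nat 0) by (rewrite <- Hg1 by exact H0; f_equal; ring).
    replace (T 1%nat 0 + h * (T 2%nat 0 + h * T 3%nat h) - T 1%nat 0 - T 2%nat 0 * h)%C
      with (T 3%nat h * (h * h))%C by ring.
    rewrite !Cmod_mult. apply Rmult_le_compat_r; [apply Rmult_le_pos; apply Cmod_ge_0|].
    exact (taylor_rem_le f p r M Hr Hf' HM' 3 h Hh). }
  exists g. split; [exact Hg|]. split.
  - intros w Hw. destruct (C_eq_dec w p) as [->|Hne]; [exact Hgp|].
    apply cholo_ext_loc with (fun v => (f v - f p) / (v - p))%C.
    + exists (Cmod (w - p)). split; [now apply Cmod_sub_pos|]. intros v Hv.
      unfold g. destruct (C_eq_dec v p) as [->|]; [|reflexivity].
      rewrite Cmod_sub_sym in Hv. lra.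
    + apply cholo_div; [now apply Cminus_eq_contra| |apply cholo_sub_const].
      apply cholo_minus; [auto|apply cholo_const].
  - exists g. split; [|split]; [|reflexivity|now apply cholo_cont].
    intros w. rewrite (Hg w) at 1. ring.
Qed.

(** * The identity theorem *)

(** Applying Cauchy's bound to [f w / (w - a) ^ n] and letting [n] grow. *)
Lemma identity_disc f a r rho M : 0 < r -> 0 < rho ->
  (forall w, Cmod (w - a) <= 2 * r -> cholo f w /\ Cmod (f w) <= M) ->
  (forall w, Cmod (w - a) < rho -> f w = 0) ->
  forall b, Cmod (b - a) <= r / 2 -> f b = 0.
Proof.
  intros Hr Hrho Hf H0 b Hb.
  destruct (C_eq_dec b a) as [->|Hba]; [apply H0; rewrite Cmod_sub_self; exact Hrho|].
  assert (HM : 0 <= M).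
  { eapply Rle_trans; [apply Cmod_ge_0|]. apply (Hf a). rewrite Cmod_sub_self. lra. }
  assert (Hp := Cmod_sub_pos _ _ Hba).
  assert (B : forall n, Cmod (f b) <= 32 * M * (1 / 2) ^ n).
  { intros n. set (g := fun w => (f w / (w - a) ^ n)%C).
    assert (Hg : forall w, Cmod (w - a) <= 2 * r -> cholo g w).
    { intros w Hw. destruct (C_eq_dec w a) as [->|Hwa].
      - apply cholo_ext_loc with (fun _ => RtoC 0); [|apply cholo_const].
        exists rho. split; [exact Hrho|]. intros v Hv. unfold g. rewrite H0 by exact Hv.
        unfold Cdiv. ring.
      - apply cholo_div.
        + now apply Cpow_nz, Cminus_eq_contra.
        + now apply Hf.
        + apply (cholo_pow (fun w => w - a)%C), cholo_sub_const. }
    assert (HgM : forall w, r <= Cmod (w - a) <= 2 * r -> Cmod (g w) <= M * / r ^ n).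
    { intros w [W1 W2]. unfold g.
      assert (Hw : (w - a)%C <> 0) by (apply Cmod_gt_0; lra).
      rewrite Cmod_div by now apply Cpow_nz. rewrite Cmod_pow.
      apply Rmult_le_compat; [apply Cmod_ge_0| |now apply Hf|].
      - apply Rlt_le, Rinv_0_lt_compat, pow_lt. lra.
      - apply Rinv_le_contravar; [now apply pow_lt|]. apply pow_incr. lra. }
    assert (K := cauchy_estimate g a r _ Hr Hg HgM b Hb). unfold g in K.
    rewrite Cmod_div, Cmod_pow in K by now apply Cpow_nz, Cminus_eq_contra.
    assert (Hq : 0 < Cmod (b - a) ^ n) by now apply pow_lt.
    apply Rmult_le_compat_r with (r := Cmod (b - a) ^ n) in K; [|lra].
    unfold Rdiv in K. rewrite Rmult_assoc, Rinv_l, Rmult_1_r in K by lra.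
    eapply Rle_trans; [exact K|].
    replace (32 * (M * / r ^ n) * Cmod (b - a) ^ n) with (32 * M * (Cmod (b - a) / r) ^ n)
      by (unfold Rdiv; rewrite Rpow_mult_distr, pow_inv; ring).
    apply Rmult_le_compat_l; [lra|]. apply pow_incr. split.
    - apply Rdiv_le_0_compat; lra.
    - apply Rmult_le_reg_r with r; [exact Hr|]. unfold Rdiv. rewrite Rmult_assoc, Rinv_l; lra. }
  apply Cmod_eq_0. apply Rle_antisym; [|apply Cmod_ge_0]. apply le_epsilon. intros eps He.
  rewrite Rplus_0_l.
  assert (Hk : 0 < eps / (32 * M + 1)) by (apply Rdiv_lt_0_compat; lra).
  assert (H12 : Rabs (1/2) < 1) by (rewrite Rabs_pos_eq; lra).
  destruct (pow_lt_1_zero (1/2) H12 _ Hk) as [n Hn].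
  specialize (Hn n (le_n _)). rewrite Rabs_pos_eq in Hn by (apply pow_le; lra).
  eapply Rle_trans; [apply (B n)|].
  apply Rle_trans with ((32 * M + 1) * (1 / 2) ^ n).
  - apply Rmult_le_compat_r; [apply pow_le; lra|lra].
  - apply Rmult_lt_compat_l with (r := 32 * M + 1) in Hn; [|lra].
    replace ((32 * M + 1) * (eps / (32 * M + 1))) with eps in Hn by (field; lra). lra.
Qed.

(** The value at [p] itself is left free, so arbitrary values of total functions at their poles do
    no harm. *)
Definition mer_at (f : C -> C) (p : C) : Prop :=
  exists (m : nat) (M r : R), 0 < r /\ forall w, w <> p -> Cmod (w - p) < r ->
    cholo f w /\ Cmod (w - p) ^ m * Cmod (f w) <= M.

Definition zero_near (f : C -> C) (p : C) : Prop :=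
  exists r, 0 < r /\ forall w, w <> p -> Cmod (w - p) < r -> f w = 0.

(** [identity_disc] needs a full disc of zeros; the punctured neighbourhood contains such discs
    arbitrarily close to [p]. *)
Lemma zero_near_disc f p : zero_near f p ->
  forall e, 0 < e -> exists a rho, 0 < rho /\ Cmod (a - p) < e /\
    forall w, Cmod (w - a) < rho -> f w = 0.
Proof.
  intros [r [Hr H]] e He. set (d := Rmin r e / 2).
  assert (Hd : 0 < d) by (unfold d; generalize (Rmin_glb_lt r e 0 Hr He); lra).
  assert (D1 : 2 * d <= r) by (unfold d; generalize (Rmin_l r e); lra).
  assert (D2 : 2 * d <= e) by (unfold d; generalize (Rmin_r r e); lra).
  assert (E : Cmod (p + d - p) = d).
  { replace (p + d - p)%C with (RtoC d) by ring. rewrite Cmod_R, Rabs_pos_eq; lra. }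
  exists (p + d)%C, d. split; [exact Hd|]. split; [lra|]. intros w Hw. apply H.
  - intros ->. rewrite Cmod_sub_sym in Hw. lra.
  - generalize (Cmod_triangle_sub w (p + d) p). lra.
Qed.

(** The factor [(w - p) ^ (m + 2)] clears the pole and leaves a quadratic bound, so the product is
    differentiable at [p] as well and the identity theorem in a disc applies to it. *)
Lemma mer_zero_spread f p : mer_at f p ->
  exists d, 0 < d /\ forall q, Cmod (q - p) < d -> zero_near f q -> zero_near f p.
Proof.
  intros [m [M [r [Hr H]]]].
  set (g := fun w => ((w - p) ^ (m + 2) * f w)%C).
  assert (Mp : 0 <= Rabs M) by apply Rabs_pos.
  assert (Hb : forall w, Cmod (w - p) < r -> Cmod (g w) <= Rabs M * (Cmod (w - p) * Cmod (w - p))).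
  { intros w Hw. unfold g. rewrite Cmod_mult, Cmod_pow. destruct (C_eq_dec w p) as [->|Hwp].
    - rewrite Cmod_sub_self, pow_add. simpl. lra.
    - destruct (H w Hwp Hw) as [_ K]. rewrite pow_add.
      replace (Cmod (w - p) ^ m * Cmod (w - p) ^ 2 * Cmod (f w))
        with (Cmod (w - p) ^ m * Cmod (f w) * (Cmod (w - p) * Cmod (w - p))) by ring.
      apply Rmult_le_compat_r; [apply Rmult_le_pos; apply Cmod_ge_0|].
      generalize (RRle_abs M). lra. }
  assert (Hgp : g p = 0).
  { apply Cmod_eq_0. apply Rle_antisym; [|apply Cmod_ge_0].
    eapply Rle_trans; [apply Hb; rewrite Cmod_sub_self; exact Hr|]. rewrite Cmod_sub_self. lra. }
  assert (Hg : forall w, Cmod (w - p) < r -> cholo g w).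
  { intros w Hw. destruct (C_eq_dec w p) as [->|Hwp].
    - exists 0. apply (cholo_of_quadratic g p (Rabs M) Hgp). exists r. split; auto.
    - apply cholo_mult; [apply (cholo_pow (fun w => w - p)%C), cholo_sub_const|now apply H]. }
  (* The centre [a] of a disc of zeros lies within [r / 16] of [p]. Then the disc of radius [r / 2]
     about [a] stays within [r] of [p], and the one of radius [r / 8] contains all points within
     [r / 16] of [p]. *)
  exists (r / 32). split; [lra|]. intros q Hq Zq.
  destruct (zero_near_disc f q Zq (r / 32)) as [a [rho [Hrho [Ha Za]]]]; [lra|].
  assert (Hap : Cmod (a - p) < r / 16) by (generalize (Cmod_triangle_sub a q p); lra).
  exists (r / 16). split; [lra|]. intros w Hwp Hw.
  assert (Gw : g w = 0).
  { apply (identity_disc g a (r / 4) rho (Rabs M * (r * r))); [lra|exact Hrho| | |].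
    - intros v Hv. assert (Hv' : Cmod (v - p) < r) by (generalize (Cmod_triangle_sub v a p); lra).
      split; [auto|]. eapply Rle_trans; [now apply Hb|]. apply Rmult_le_compat_l; [exact Mp|].
      generalize (Cmod_ge_0 (v - p)). nra.
    - intros v Hv. unfold g. rewrite Za by exact Hv. ring.
    - generalize (Cmod_triangle_sub w p a). rewrite (Cmod_sub_sym p a). lra. }
  unfold g in Gw. destruct (C_eq_dec (f w) 0) as [|Hfw]; [assumption|].
  exfalso. revert Gw. apply Cmult_neq_0; [|exact Hfw]. now apply Cpow_nz, Cminus_eq_contra.
Qed.

Lemma mer_zero_locally_constant f p : mer_at f p ->
  exists d, 0 < d /\ forall q, Cmod (q - p) < d -> (zero_near f q <-> zero_near f p).
Proof.
  intros H. destruct (classic (zero_near f p)) as [Z|Z].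
  - destruct Z as [r [Hr Z]]. exists r. split; [exact Hr|]. intros q Hq. split.
    + intros _. exists r. split; auto.
    + intros _. destruct (C_eq_dec q p) as [->|Hqp]; [exists r; split; auto|].
      assert (Hp := Cmod_sub_pos _ _ Hqp).
      exists (Rmin (Cmod (q - p)) (r - Cmod (q - p))). split; [apply Rmin_glb_lt; lra|].
      intros w _ Hw. apply Z.
      * intros ->. rewrite Cmod_sub_sym in Hw. generalize (Rmin_l (Cmod (q - p)) (r - Cmod (q - p))). lra.
      * generalize (Cmod_triangle_sub w q p) (Rmin_r (Cmod (q - p)) (r - Cmod (q - p))). lra.
  - destruct (mer_zero_spread f p H) as [d [Hd K]]. exists d. split; [exact Hd|].
    intros q Hq. split; [now apply K|tauto].
Qed.

(** Connectedness of the unit interval, by the supremum of the initial stretches on which [P]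
    fails. *)
Lemma locally_constant_unit_interval (P : R -> Prop) :
  (forall t, 0 <= t <= 1 -> exists d, 0 < d /\
     forall u, 0 <= u <= 1 -> Rabs (u - t) < d -> (P u <-> P t)) -> P 1 -> P 0.
Proof.
  intros H H1. apply NNPP. intros H0.
  set (E := fun t => 0 <= t <= 1 /\ forall u, 0 <= u <= t -> ~ P u).
  destruct (completeness E) as [T [T1 T2]].
  - exists 1. intros t [Ht _]. lra.
  - exists 0. split; [lra|]. intros u Hu. now replace u with 0 by lra.
  - assert (T0 : 0 <= T).
    { apply T1. split; [lra|]. intros u Hu. now replace u with 0 by lra. }
    assert (T3 : T <= 1) by (apply T2; intros t [Ht _]; lra).
    destruct (H T (conj T0 T3)) as [d [Hd K]].
    assert (HE : exists t, E t /\ T - d < t).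
    { apply NNPP. intros Hn. assert (T <= T - d); [|lra]. apply T2. intros t Ht.
      apply Rnot_lt_le. intros Hlt. apply Hn. now exists t. }
    destruct HE as [t [[Ht1 Ht2] Ht3]].
    assert (HtT : t <= T) by (apply T1; split; auto).
    assert (NT : ~ P T).
    { rewrite <- (K t); [apply Ht2; lra|lra|]. rewrite Rabs_left1; lra. }
    assert (EN : forall v, 0 <= v <= 1 -> v < T + d -> E v).
    { intros v Hv1 Hv2. split; [exact Hv1|]. intros u Hu.
      destruct (Rle_lt_dec u t) as [L|L]; [apply Ht2; lra|].
      rewrite (K u); [exact NT|lra|]. apply Rabs_def1; lra. }
    destruct (Rlt_le_dec 1 (T + d)) as [L|L].
    + destruct (EN 1) as [_ N]; [lra|lra|]. apply (N 1); [lra|exact H1].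
    + assert (T + d / 2 <= T); [|lra]. apply T1. apply EN; lra.
Qed.

(** Vanishing near a point is an open and closed condition along the segment; poles met on the way
    are harmless. *)
Lemma identity_segment f (a b : C) :
  (forall t, 0 <= t <= 1 -> mer_at f (a + RtoC t * (b - a))%C) ->
  zero_near f b -> zero_near f a.
Proof.
  intros Hm Hb.
  replace a with (a + RtoC 0 * (b - a))%C by ring.
  apply (locally_constant_unit_interval (fun t => zero_near f (a + RtoC t * (b - a))%C)).
  - intros t Ht. destruct (mer_zero_locally_constant f _ (Hm t Ht)) as [d [Hd K]].
    assert (Hl : 0 < Cmod (b - a) + 1) by (generalize (Cmod_ge_0 (b - a)); lra).
    exists (d / (Cmod (b - a) + 1)). split; [now apply Rdiv_lt_0_compat|].
    intros u Hu Hut. apply K. rewrite Cmod_affine_sub.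
    apply Rle_lt_trans with (Rabs (u - t) * (Cmod (b - a) + 1)).
    + apply Rmult_le_compat_l; [apply Rabs_pos|lra].
    + apply Rmult_lt_compat_r with (r := Cmod (b - a) + 1) in Hut; [|exact Hl].
      replace (d / (Cmod (b - a) + 1) * (Cmod (b - a) + 1)) with d in Hut by (field; lra). exact Hut.
  - now replace (a + RtoC 1 * (b - a))%C with b by ring.
Qed.

(** * Closure properties of local meromorphy *)

Lemma mer_at_of_cholo f p : cnbhs p (cholo f) -> mer_at f p.
Proof.
  intros H. assert (Hc := ccont_bounded f p (cholo_cont _ _ (cnbhs_point _ _ H))).
  destruct (filter_and _ _ H Hc) as [d [Hd K]].
  exists O, (Cmod (f p) + 1), d. split; [exact Hd|]. intros w _ Hw.
  destruct (K w Hw) as [K1 K2]. split; [exact K1|]. simpl. lra.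
Qed.

Lemma mer_at_weaken f p : mer_at f p ->
  exists m0 M r, 0 < r /\ r <= 1 /\ forall m, (m0 <= m)%nat ->
    forall w, w <> p -> Cmod (w - p) < r -> cholo f w /\ Cmod (w - p) ^ m * Cmod (f w) <= M.
Proof.
  intros [m0 [M [r [Hr H]]]]. exists m0, M, (Rmin r 1).
  split; [apply Rmin_glb_lt; lra|]. split; [apply Rmin_r|].
  intros m Hm w Hwp Hw. assert (L1 := Rmin_l r 1). assert (L2 := Rmin_r r 1).
  destruct (H w Hwp ltac:(lra)) as [K1 K2]. split; [exact K1|].
  replace m with (m0 + (m - m0))%nat by lia. rewrite pow_add.
  assert (P0 := Cmod_ge_0 (w - p)).
  assert (P1 : Cmod (w - p) ^ (m - m0) <= 1).
  { rewrite <- (pow1 (m - m0)). apply pow_incr. lra. }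
  assert (P2 : 0 <= Cmod (w - p) ^ (m - m0)) by now apply pow_le.
  assert (P3 : 0 <= Cmod (w - p) ^ m0 * Cmod (f w)).
  { apply Rmult_le_pos; [now apply pow_le|apply Cmod_ge_0]. }
  nra.
Qed.

Lemma mer_at_plus f g p : mer_at f p -> mer_at g p -> mer_at (fun w => f w + g w)%C p.
Proof.
  intros Hf Hg. destruct (mer_at_weaken f p Hf) as [m1 [M1 [r1 [R1 [_ K1]]]]].
  destruct (mer_at_weaken g p Hg) as [m2 [M2 [r2 [R2 [_ K2]]]]].
  exists (Nat.max m1 m2), (M1 + M2), (Rmin r1 r2). split; [now apply Rmin_glb_lt|].
  intros w Hwp Hw. assert (L1 := Rmin_l r1 r2). assert (L2 := Rmin_r r1 r2).
  destruct (K1 (Nat.max m1 m2) ltac:(lia) w Hwp ltac:(lra)) as [A1 A2].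
  destruct (K2 (Nat.max m1 m2) ltac:(lia) w Hwp ltac:(lra)) as [B1 B2].
  split; [now apply cholo_plus|].
  eapply Rle_trans; [apply Rmult_le_compat_l; [apply pow_le, Cmod_ge_0|apply Cmod_triangle]|]. lra.
Qed.

Lemma mer_at_mult f g p : mer_at f p -> mer_at g p -> mer_at (fun w => f w * g w)%C p.
Proof.
  intros [m1 [M1 [r1 [R1 K1]]]] [m2 [M2 [r2 [R2 K2]]]].
  exists (m1 + m2)%nat, (M1 * M2), (Rmin r1 r2). split; [now apply Rmin_glb_lt|].
  intros w Hwp Hw. assert (L1 := Rmin_l r1 r2). assert (L2 := Rmin_r r1 r2).
  destruct (K1 w Hwp ltac:(lra)) as [A1 A2]. destruct (K2 w Hwp ltac:(lra)) as [B1 B2].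
  split; [now apply cholo_mult|]. rewrite Cmod_mult, pow_add.
  replace (Cmod (w - p) ^ m1 * Cmod (w - p) ^ m2 * (Cmod (f w) * Cmod (g w)))
    with ((Cmod (w - p) ^ m1 * Cmod (f w)) * (Cmod (w - p) ^ m2 * Cmod (g w))) by ring.
  apply Rmult_le_compat; auto; apply Rmult_le_pos; try apply pow_le; apply Cmod_ge_0.
Qed.

Lemma mer_at_const c p : mer_at (fun _ => c) p.
Proof. apply mer_at_of_cholo. apply filter_forall. intros w. apply cholo_const. Qed.

Lemma mer_at_minus f g p : mer_at f p -> mer_at g p -> mer_at (fun w => f w - g w)%C p.
Proof.
  intros Hf Hg.
  assert (K : mer_at (fun w => f w + (- (1)) * g w)%C p).
  { apply mer_at_plus; [exact Hf|]. apply mer_at_mult; [apply mer_at_const|exact Hg]. }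
  destruct K as [m [M [r [Hr K]]]]. exists m, M, r. split; [exact Hr|].
  intros w Hwp Hw. destruct (K w Hwp Hw) as [K1 K2]. split.
  - revert K1. apply cholo_ext. intros v. ring.
  - replace (f w - g w)%C with (f w + (- (1)) * g w)%C by ring. exact K2.
Qed.

(** Near a simple zero [|f w|] is at least [|l| |w - p| / 2], so the inverse has a pole of order
    one. *)
Lemma mer_at_inv f p l : cnbhs p (cholo f) -> is_cderiv f p l -> f p = 0 -> l <> 0 ->
  mer_at (fun w => / f w)%C p.
Proof.
  intros Hf Hl Hp Hl0. assert (Hlp := proj1 (Cmod_gt_0 l) Hl0).
  rewrite is_cderiv_eps in Hl. specialize (Hl (Cmod l / 2) (half_pos _ Hlp)).
  destruct (filter_and _ _ Hf Hl) as [d [Hd K]].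
  exists 1%nat, (2 / Cmod l), d. split; [exact Hd|]. intros w Hwp Hw.
  destruct (K w Hw) as [K1 K2]. rewrite Hp in K2.
  assert (Hwp' := Cmod_sub_pos _ _ Hwp).
  assert (Low : Cmod l / 2 * Cmod (w - p) <= Cmod (f w)).
  { assert (T := Cmod_sub_ge (l * (w - p)) (l * (w - p) - f w)).
    replace (l * (w - p) - (l * (w - p) - f w))%C with (f w) in T by ring.
    rewrite Cmod_mult in T.
    replace (f w - 0 - l * (w - p))%C with (- (l * (w - p) - f w))%C in K2 by ring.
    rewrite Cmod_opp in K2. lra. }
  assert (Pos : 0 < Cmod (f w)) by nra.
  assert (Nz : f w <> 0) by now apply Cmod_gt_0.
  split; [now apply cholo_inv|]. rewrite Cmod_inv by exact Nz. rewrite pow_1.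
  apply Rmult_le_reg_r with (Cmod (f w)); [exact Pos|].
  rewrite Rmult_assoc, Rinv_l, Rmult_1_r by lra.
  apply Rmult_le_compat_l with (r := 2 / Cmod l) in Low; [|apply Rlt_le, Rdiv_lt_0_compat; lra].
  replace (2 / Cmod l * (Cmod l / 2 * Cmod (w - p))) with (Cmod (w - p)) in Low by (field; lra).
  exact Low.
Qed.

Lemma mer_at_of_continuation f Om F : is_meromorphic_continuation f Om F -> forall p, mer_at F p.
Proof.
  intros [P [HP [H1 [H2 _]]]] p. destruct (HP p) as [d [Hd K]].
  destruct (classic (P p)) as [Pp|Np].
  - destruct (H2 p Pp) as [m [M [r [Hr B]]]]. exists m, M, (Rmin r d).
    split; [now apply Rmin_glb_lt|]. intros w Hwp Hw.
    assert (L1 := Rmin_l r d). assert (L2 := Rmin_r r d). split.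
    + apply cholo_of_differentiable, H1. intros Pw. specialize (K w Pw Hwp). lra.
    + apply B; [exact Hwp|lra].
  - apply mer_at_of_cholo. exists d. split; [exact Hd|]. intros w Hw.
    apply cholo_of_differentiable, H1. intros Pw. apply Np.
    destruct (C_eq_dec w p) as [<-|Hwp]; [exact Pw|]. specialize (K w Pw Hwp). lra.
Qed.

(** * The complex exponential and logarithm *)

Lemma cexp_plus (a b : C) : cexp (a + b) = (cexp a * cexp b)%C.
Proof.
  unfold cexp. rewrite re_plus, im_plus, exp_plus, cos_plus, sin_plus.
  apply Ceq_parts; simpl; ring.
Qed.

Lemma cexp_RtoC (x : R) : cexp x = RtoC (exp x).
Proof. unfold cexp. simpl. rewrite cos_0, sin_0. apply Ceq_parts; simpl; ring. Qed.

Lemma cexp_0 : cexp 0 = 1.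
Proof. now rewrite cexp_RtoC, exp_0. Qed.

Lemma Cmod_cexp (a : C) : Cmod (cexp a) = exp (Re a).
Proof.
  unfold cexp, Cmod. simpl fst. simpl snd.
  replace ((exp (Re a) * cos (Im a)) ^ 2 + (exp (Re a) * sin (Im a)) ^ 2)
    with (exp (Re a) ^ 2 * (Rsqr (sin (Im a)) + Rsqr (cos (Im a)))) by (unfold Rsqr; ring).
  rewrite sin2_cos2, Rmult_1_r. apply sqrt_pow2, Rlt_le, exp_pos.
Qed.

Lemma cexp_neq_0 (a : C) : cexp a <> 0.
Proof. apply Cmod_gt_0. rewrite Cmod_cexp. apply exp_pos. Qed.

Lemma cexp_opp (a : C) : cexp (- a) = (/ cexp a)%C.
Proof.
  assert (E : (cexp (- a) * cexp a)%C = 1).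
  { rewrite <- cexp_plus. replace (- a + a)%C with (RtoC 0) by ring. apply cexp_0. }
  replace (cexp (- a)) with (cexp (- a) * cexp a * / cexp a)%C by (field; apply cexp_neq_0).
  rewrite E. ring.
Qed.

Lemma cexp_minus (a b : C) : cexp (a - b) = (cexp a / cexp b)%C.
Proof. unfold Cminus. now rewrite cexp_plus, cexp_opp. Qed.

Lemma cexp_INR (n : nat) (a : C) : cexp (INR n * a) = (cexp a ^ n)%C.
Proof.
  induction n as [|n IH].
  - simpl. rewrite <- cexp_0. f_equal. ring.
  - rewrite S_INR, RtoC_plus. simpl Cpow. rewrite <- IH, <- cexp_plus. f_equal. ring.
Qed.

Lemma Rabs_sin_le (t : R) : Rabs (sin t) <= Rabs t.
Proof.
  assert (P : forall x, 0 < x -> Rabs (sin x) <= x).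
  { intros x Hx. apply Rabs_le. split; [|now apply Rlt_le, sin_lt_x].
    destruct (Rle_lt_dec x PI) as [H|H].
    - generalize (sin_ge_0 x). lra.
    - generalize (SIN_bound x) PI_4 PI2_1. lra. }
  destruct (Rtotal_order t 0) as [H|[->|H]].
  - rewrite (Rabs_left t) by exact H. rewrite <- (Rabs_Ropp (sin t)), <- sin_neg. apply P. lra.
  - rewrite sin_0, Rabs_R0. lra.
  - rewrite (Rabs_pos_eq t) by lra. now apply P.
Qed.

Lemma one_minus_cos_le (t : R) : 0 <= 1 - cos t <= t * t / 2.
Proof.
  replace t with (2 * (t / 2)) at 1 2 by field. rewrite cos_2a_sin.
  assert (H := Rabs_sin_le (t / 2)). apply Rsqr_le_abs_1 in H. unfold Rsqr in H. nra.
Qed.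

Lemma sin_minus_id_le (t : R) : Rabs t <= 1 -> Rabs (sin t - t) <= t * t.
Proof.
  intros Ht.
  destruct (MVT_gen (fun x => sin x - x) 0 t (fun x => cos x - 1)) as [c [Hc E]].
  - intros x _. auto_derive; [trivial|ring].
  - intros x _. apply continuity_pt_minus; [apply continuity_sin|apply continuity_pt_id].
  - rewrite sin_0, !Rminus_0_r in E. rewrite E, Rabs_mult.
    assert (Hc' : Rabs c <= Rabs t).
    { unfold Rmin, Rmax in Hc. destruct (Rle_dec 0 t).
      - rewrite !Rabs_pos_eq; lra.
      - rewrite !Rabs_left1; lra. }
    assert (C1 := one_minus_cos_le c).
    assert (K : c * c <= t * t) by (apply Rsqr_le_abs_1 in Hc'; exact Hc').
    assert (T : Rabs t * Rabs t = t * t) by (rewrite <- Rabs_mult; apply Rabs_pos_eq; nra).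
    assert (T0 := Rabs_pos t).
    assert (A : Rabs (cos c - 1) <= Rabs t) by (rewrite Rabs_left1; nra).
    nra.
Qed.

Lemma exp_second_order (x : R) : Rabs x <= 1 / 2 -> Rabs (exp x - 1 - x) <= 2 * (x * x).
Proof.
  intros Hx. apply Rabs_le_between in Hx. assert (A := exp_ineq1_le x). assert (B := exp_ineq1_le (- x)).
  rewrite exp_Ropp in B. assert (E := exp_pos x).
  assert (U : exp x * (1 - x) <= 1).
  { apply Rmult_le_compat_l with (r := exp x) in B; [|lra]. rewrite Rinv_r in B; lra. }
  rewrite Rabs_pos_eq by lra. nra.
Qed.

(** As [cexp] is built from real functions, its derivative at 0 rests on second-order bounds for
    [exp], [cos] and [sin]; the addition formula then carries it to every point. *)
Lemma is_cderiv_cexp_0 : is_cderiv cexp 0 1.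
Proof.
  apply is_cderiv_of_second_order with (1/2) 12; [lra|]. intros h Hh.
  rewrite cexp_0. replace (0 + h)%C with h by ring.
  assert (Hx := re_le_Cmod h). assert (Hy := im_le_Cmod h).
  destruct h as [x y]. unfold Re, Im in Hx, Hy. simpl fst in *. simpl snd in *.
  set (d := Cmod (x, y)) in *.
  assert (Ex := exp_second_order x ltac:(lra)). assert (Sy := sin_minus_id_le y ltac:(lra)).
  assert (Cy := one_minus_cos_le y).
  assert (Dx : x * x <= d * d) by (apply Rsqr_le_abs_1; rewrite (Rabs_pos_eq d); [exact Hx|apply Cmod_ge_0]).
  assert (Dy : y * y <= d * d) by (apply Rsqr_le_abs_1; rewrite (Rabs_pos_eq d); [exact Hy|apply Cmod_ge_0]).
  assert (D0 : 0 <= d) by apply Cmod_ge_0.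
  apply Rabs_le_between in Ex. assert (E0 := exp_pos x).
  assert (Xb := Hx). apply Rabs_le_between in Xb.
  assert (E2 : exp x <= 2) by nra.
  eapply Rle_trans; [apply Cmod_le_parts|]. unfold cexp. simpl.
  assert (A : Rabs (exp x * cos y + - (1) + - (1 * x - 0 * y)) <= 4 * (d * d)).
  { replace (exp x * cos y + - (1) + - (1 * x - 0 * y)) with ((exp x - 1 - x) - exp x * (1 - cos y)) by ring.
    assert (0 <= exp x * (1 - cos y) <= 2 * (y * y / 2)).
    { split; [apply Rmult_le_pos; lra|]. apply Rmult_le_compat; lra. }
    apply Rabs_le. lra. }
  assert (B : Rabs (exp x * sin y + - 0 + - (1 * y + 0 * x)) <= 8 * (d * d)).
  { replace (exp x * sin y + - 0 + - (1 * y + 0 * x)) with (exp x * (sin y - y) + (exp x - 1) * y) by ring.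
    eapply Rle_trans; [apply Rabs_triang|]. rewrite !Rabs_mult, (Rabs_pos_eq (exp x)) by lra.
    assert (B1 : exp x * Rabs (sin y - y) <= 2 * (d * d)).
    { apply Rmult_le_compat; try lra. apply Rabs_pos. }
    assert (B2 : Rabs (exp x - 1) <= 2 * d).
    { replace (exp x - 1) with ((exp x - 1 - x) + x) by ring. eapply Rle_trans; [apply Rabs_triang|].
      rewrite (Rabs_pos_eq (exp x - 1 - x)) by (generalize (exp_ineq1_le x); lra). nra. }
    assert (B3 : Rabs (exp x - 1) * Rabs y <= 2 * d * d).
    { apply Rmult_le_compat; try apply Rabs_pos; lra. }
    lra. }
  lra.
Qed.

Lemma is_cderiv_cexp (a : C) : is_cderiv cexp a (cexp a).
Proof.
  apply is_cderiv_ext with (fun w => cexp a * cexp (- a + w * 1))%C.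
  { intros w. rewrite <- cexp_plus. f_equal. ring. }
  assert (A : is_cderiv (fun w => cexp (- a + w * 1)%C) a (1 * 1)%C).
  { apply (is_cderiv_comp (fun w => - a + w * 1)%C cexp).
    - apply is_cderiv_affine.
    - replace (- a + a * 1)%C with (RtoC 0) by ring. apply is_cderiv_cexp_0. }
  eapply is_cderiv_eq; [|apply is_cderiv_mult; [apply is_cderiv_const|exact A]].
  cbv beta. ring.
Qed.

Lemma cholo_cexp f a : cholo f a -> cholo (fun w => cexp (f w)) a.
Proof. intros H. apply cholo_comp; [exact H|]. eexists. apply is_cderiv_cexp. Qed.

Lemma ccont_cexp a : ccont cexp a.
Proof. eapply is_cderiv_cont, is_cderiv_cexp. Qed.

Lemma is_cderiv_cexp_comp f a l : is_cderiv f a l -> is_cderiv (fun w => cexp (f w)) a (cexp (f a) * l)%C.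
Proof. intros H. eapply is_cderiv_comp; [exact H|apply is_cderiv_cexp]. Qed.

Lemma cexp_eq_1 (u : C) : Rabs (Im u) < PI -> cexp u = 1 -> u = 0.
Proof.
  intros Hi E.
  assert (Hr : exp (Re u) = 1) by (rewrite <- Cmod_cexp, E; apply Cmod_1).
  assert (R0 : Re u = 0) by (apply exp_inv; now rewrite exp_0).
  apply (f_equal Im) in E. unfold cexp in E. simpl in E. rewrite Hr, Rmult_1_l in E.
  apply Rabs_def2 in Hi. apply Ceq_parts; [exact R0|]. simpl.
  destruct (Rtotal_order (Im u) 0) as [H|[H|H]]; [|exact H|].
  - generalize (sin_gt_0 (- Im u)). rewrite sin_neg. lra.
  - generalize (sin_gt_0 (Im u)). lra.
Qed.

(** * The principal logarithm on the right half-plane *)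

Lemma carg_right (w : C) : 0 < Re w -> carg w = 2 * atan (Im w / (Cmod w + Re w)).
Proof.
  intros H. unfold carg. destruct (Req_EM_T (Im w) 0) as [E|E]; [|reflexivity].
  destruct (Rlt_dec (Re w) 0) as [|_]; [lra|]. rewrite E. unfold Rdiv. rewrite Rmult_0_l, atan_0. ring.
Qed.

Lemma Re_pos_Cmod (w : C) : 0 < Re w -> 0 < Cmod w.
Proof. intros H. generalize (re_le_Cmod w) (RRle_abs (Re w)). lra. Qed.

Lemma Re_pos_neq_0 (w : C) : 0 < Re w -> w <> 0.
Proof. intros H. apply Cmod_gt_0. now apply Re_pos_Cmod. Qed.

(** With [t] the tangent of half the argument, [1 + t^2 = 2 |w| / (|w| + Re w)]; the double-angle
    formulas then return [Re w] and [Im w]. *)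
Lemma cexp_Clog (w : C) : 0 < Re w -> cexp (Clog w) = w.
Proof.
  intros H. assert (Hm := Re_pos_Cmod w H). assert (Hm2 := Cmod2_alt w).
  unfold cexp, Clog. simpl Re. simpl Im. rewrite exp_ln by exact Hm. rewrite carg_right by exact H.
  set (t := Im w / (Cmod w + Re w)).
  assert (D : 0 < 1 + t * t) by nra.
  assert (Hc : cos (atan t) ^ 2 = / (1 + t * t)).
  { rewrite cos_atan. unfold Rdiv. rewrite Rmult_1_l.
    replace (t²) with (t * t) by reflexivity. rewrite pow_inv, pow2_sqrt by lra. reflexivity. }
  assert (Hs : sin (atan t) = t * cos (atan t)).
  { rewrite cos_atan, sin_atan. unfold Rdiv. ring. }
  rewrite cos_2a, sin_2a, Hs.
  replace (cos (atan t) * cos (atan t) - t * cos (atan t) * (t * cos (atan t)))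
    with (cos (atan t) ^ 2 * (1 - t * t)) by ring.
  replace (2 * (t * cos (atan t)) * cos (atan t)) with (cos (atan t) ^ 2 * (2 * t)) by ring.
  rewrite Hc.
  assert (T : t * (Cmod w + Re w) = Im w) by (unfold t; field; lra).
  assert (T2 : (1 + t * t) * (Cmod w + Re w) = 2 * Cmod w).
  { apply Rmult_eq_reg_r with (Cmod w + Re w); [|lra].
    replace ((1 + t * t) * (Cmod w + Re w) * (Cmod w + Re w))
      with ((Cmod w + Re w) ^ 2 + (t * (Cmod w + Re w)) ^ 2) by ring.
    rewrite T. nra. }
  assert (T3 : / (1 + t * t) = (Cmod w + Re w) / (2 * Cmod w)).
  { rewrite <- T2. field. split; lra. }
  apply Ceq_parts.
  - change (Cmod w * (/ (1 + t * t) * (1 - t * t)) = Re w).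
    apply Rmult_eq_reg_r with (1 + t * t); [|lra].
    replace (Cmod w * (/ (1 + t * t) * (1 - t * t)) * (1 + t * t)) with (Cmod w * (1 - t * t)) by (field; lra).
    apply Rmult_eq_reg_r with (Cmod w + Re w); [|lra].
    assert (T4 : t * t * (Cmod w + Re w) = Cmod w - Re w) by lra. nra.
  - change (Cmod w * (/ (1 + t * t) * (2 * t)) = Im w). rewrite T3, <- T. field. lra.
Qed.

Section RealFlim.
Context {T : Type} {F : (T -> Prop) -> Prop} {FF : Filter F}.

Lemma flim_real_comp (u : T -> R) (g : R -> R) l : continuity_pt g l ->
  flim F (fun x => RtoC (u x)) l -> flim F (fun x => RtoC (g (u x))) (g l).
Proof.
  intros Hg Hu eps He. assert (Hg' := proj1 (continuity_pt_locally g l) Hg).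
  destruct (Hg' (mkposreal _ He)) as [d Hd].
  generalize (Hu d (cond_pos d)). apply filter_imp. intros x Hx.
  rewrite <- RtoC_minus, Cmod_R in *. now apply Hd.
Qed.

Lemma flim_parts (f : T -> C) l : flim F (fun x => RtoC (Re (f x))) (Re l) ->
  flim F (fun x => RtoC (Im (f x))) (Im l) -> flim F f l.
Proof.
  intros H1 H2.
  assert (E : forall c : C, c = (RtoC (Re c) + Ci * RtoC (Im c))%C).
  { intros c. apply Ceq_parts; simpl; ring. }
  rewrite (E l). apply flim_ext with (fun x => RtoC (Re (f x)) + Ci * RtoC (Im (f x)))%C.
  { intros x. now rewrite <- E. }
  apply flim_plus; [exact H1|]. apply flim_mult; [apply flim_const|exact H2].
Qed.

Lemma flim_Re (f : T -> C) l : flim F f l -> flim F (fun x => RtoC (Re (f x))) (Re l).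
Proof.
  intros H eps He. generalize (H eps He). apply filter_imp. intros x Hx.
  rewrite <- RtoC_minus, Cmod_R, <- re_minus. eapply Rle_lt_trans; [apply re_le_Cmod|exact Hx].
Qed.

Lemma flim_Im (f : T -> C) l : flim F f l -> flim F (fun x => RtoC (Im (f x))) (Im l).
Proof.
  intros H eps He. generalize (H eps He). apply filter_imp. intros x Hx.
  rewrite <- RtoC_minus, Cmod_R, <- im_minus. eapply Rle_lt_trans; [apply im_le_Cmod|exact Hx].
Qed.

Lemma flim_Cmod (f : T -> C) l : flim F f l -> flim F (fun x => RtoC (Cmod (f x))) (Cmod l).
Proof.
  intros H eps He. generalize (H eps He). apply filter_imp. intros x Hx.
  rewrite <- RtoC_minus, Cmod_R. apply Rabs_def1.
  - generalize (Cmod_sub_ge (f x) l). lra.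
  - generalize (Cmod_sub_ge l (f x)). rewrite (Cmod_sub_sym l). lra.
Qed.

End RealFlim.

Lemma cnbhs_Re_pos (w : C) : 0 < Re w -> cnbhs w (fun v => 0 < Re v).
Proof.
  intros H. exists (Re w). split; [exact H|]. intros v Hv.
  generalize (re_le_Cmod (v - w)). rewrite re_minus.
  generalize (Rabs_maj2 (Re v - Re w)). lra.
Qed.

Lemma ccont_Clog (w : C) : 0 < Re w -> ccont Clog w.
Proof.
  intros H. assert (Hm := Re_pos_Cmod w H). unfold ccont. apply flim_parts.
  - apply (flim_real_comp Cmod ln).
    + apply derivable_continuous_pt. exists (/ Cmod w). now apply derivable_pt_lim_ln.
    + apply (flim_Cmod (fun x => x)), flim_id.
  - change (Im (Clog w)) with (carg w). rewrite carg_right by exact H.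
    apply flim_ext_loc with (fun v => 2 * RtoC (atan (Im v / (Cmod v + Re v))))%C.
    + generalize (cnbhs_Re_pos w H). apply filter_imp. intros v Hv.
      change (Im (Clog v)) with (carg v). rewrite carg_right by exact Hv. now rewrite RtoC_mult.
    + rewrite RtoC_mult. apply flim_mult; [apply flim_const|].
      apply (flim_real_comp (fun v => Im v / (Cmod v + Re v)) atan).
      * apply derivable_continuous_pt, derivable_pt_atan.
      * apply flim_ext_loc with (fun v => RtoC (Im v) / (RtoC (Cmod v) + RtoC (Re v)))%C.
        -- generalize (cnbhs_Re_pos w H). apply filter_imp. intros v Hv.
           assert (Hv' := Re_pos_Cmod v Hv). rewrite RtoC_div, RtoC_plus; [reflexivity|lra].
        -- rewrite RtoC_div, RtoC_plus by lra. apply flim_div.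
           ++ rewrite <- RtoC_plus. apply Re_pos_neq_0. simpl. lra.
           ++ apply (flim_Im (fun x => x)), flim_id.
           ++ apply flim_plus; [apply (flim_Cmod (fun x => x)), flim_id|apply (flim_Re (fun x => x)), flim_id].
Qed.

(** The inverse function rule in Caratheodory's form: [v - w = phi (Clog v) (Clog v - Clog w)] with
    [phi (Clog v)] tending to [w]. *)
Lemma is_cderiv_Clog (w : C) : 0 < Re w -> is_cderiv Clog w (/ w)%C.
Proof.
  intros H. assert (Hw := Re_pos_neq_0 w H). assert (Hc := ccont_Clog w H).
  destruct (is_cderiv_cexp (Clog w)) as [phi [P1 [P2 P3]]].
  rewrite cexp_Clog in P1, P2 by exact H.
  assert (Q : flim (cnbhs w) (fun v => phi (Clog v)) w).
  { rewrite <- P2 at 2. apply (flim_comp (cnbhs w) Clog phi); assumption. }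
  apply is_cderiv_eps. intros eps He.
  generalize (filter_and _ _ (flim_inv _ _ Hw Q eps He)
    (filter_and _ _ (flim_away_from_0 _ _ Hw Q) (cnbhs_Re_pos w H))).
  apply filter_imp. intros v [V1 [V2 V3]].
  assert (N : phi (Clog v) <> 0).
  { apply Cmod_gt_0. generalize (Re_pos_Cmod w H). lra. }
  assert (E : (Clog v - Clog w)%C = (/ phi (Clog v) * (v - w))%C).
  { assert (V : (v - w)%C = (phi (Clog v) * (Clog v - Clog w))%C).
    { rewrite <- (cexp_Clog v V3) at 1. rewrite (P1 (Clog v)). ring. }
    rewrite V. field. exact N. }
  rewrite E. replace (/ phi (Clog v) * (v - w) - / w * (v - w))%C
    with ((/ phi (Clog v) - / w) * (v - w))%C by ring.
  rewrite Cmod_mult. apply Rmult_le_compat_r; [apply Cmod_ge_0|lra].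
Qed.

Lemma Clog_scale (r : R) (w : C) : 0 < r -> 0 < Re w -> Clog (r * w) = (ln r + Clog w)%C.
Proof.
  intros Hr Hw. assert (Hm := Re_pos_Cmod w Hw).
  assert (Hrw : 0 < Re (r * w)) by (rewrite re_scal_l; nra).
  unfold Clog. rewrite !carg_right by assumption.
  rewrite Cmod_mult, Cmod_R, (Rabs_pos_eq r), re_scal_l, im_scal_l by lra.
  rewrite ln_mult by assumption.
  replace (r * Im w / (r * Cmod w + r * Re w)) with (Im w / (Cmod w + Re w)) by (field; split; nra).
  apply Ceq_parts; simpl; ring.
Qed.

Lemma Clog_RtoC (r : R) : 0 < r -> Clog r = RtoC (ln r).
Proof.
  intros Hr. unfold Clog. rewrite Cmod_R, Rabs_pos_eq by lra. unfold carg.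
  destruct (Req_EM_T (Im r) 0) as [_|N]; [|now contradict N].
  destruct (Rlt_dec (Re r) 0) as [L|_]; [simpl in L; lra|reflexivity].
Qed.

Lemma cpow_RtoC (r : R) (s : C) : 0 < r -> cpow r s = cexp (s * ln r).
Proof. intros Hr. unfold cpow. now rewrite Clog_RtoC. Qed.

Lemma Im_Clog_bound (w : C) : 0 < Re w -> Rabs (Im (Clog w)) <= PI.
Proof.
  intros H. change (Im (Clog w)) with (carg w). rewrite carg_right by exact H.
  generalize (atan_bound (Im w / (Cmod w + Re w))). intros A. apply Rabs_le. lra.
Qed.

(** * Series *)

Fixpoint rsum (b : nat -> R) (n : nat) : R :=
  match n with O => 0 | S m => rsum b m + b m end.

Definition summable (b : nat -> R) : Prop :=
  (forall n, 0 <= b n) /\ exists B, forall n, rsum b n <= B.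

(** Total functions with an arbitrary value in case of divergence: limits and series can be named as
    functions of their parameters before convergence is proved. *)
Definition Clim (u : nat -> C) : C :=
  (real (Lim_seq (fun n => Re (u n))), real (Lim_seq (fun n => Im (u n)))).

Definition Csum (a : nat -> C) : C := Clim (csum a).

Lemma Clim_unique u l : flim eventually u l -> Clim u = l.
Proof.
  intros H. unfold Clim. apply Ceq_parts; simpl.
  - rewrite (is_lim_seq_unique _ (Finite (Re l))); [reflexivity|].
    apply is_lim_seq_spec. intros eps. destruct (H eps (cond_pos eps)) as [N HN].
    exists N. intros n Hn. rewrite <- re_minus. eapply Rle_lt_trans; [apply re_le_Cmod|now apply HN].
  - rewrite (is_lim_seq_unique _ (Finite (Im l))); [reflexivity|].
    apply is_lim_seq_spec. intros eps. destruct (H eps (cond_pos eps)) as [N HN].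
    exists N. intros n Hn. rewrite <- im_minus. eapply Rle_lt_trans; [apply im_le_Cmod|now apply HN].
Qed.

Lemma Csum_unique a l : series_converges_to a l -> Csum a = l.
Proof. apply Clim_unique. Qed.

Lemma scv_unique a l l' : series_converges_to a l -> series_converges_to a l' -> l = l'.
Proof. intros H H'. rewrite <- (Csum_unique a l H). now apply Csum_unique. Qed.

Lemma csum_ext a b n : (forall k, (k < n)%nat -> a k = b k) -> csum a n = csum b n.
Proof.
  induction n as [|n IH]; intros H; simpl; [reflexivity|].
  rewrite IH by (intros; apply H; lia). now rewrite H by lia.
Qed.

Lemma csum_plus a b n : csum (fun k => a k + b k)%C n = (csum a n + csum b n)%C.
Proof. induction n as [|n IH]; simpl; [ring|rewrite IH; ring]. Qed.

Lemma csum_scal c a n : csum (fun k => c * a k)%C n = (c * csum a n)%C.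
Proof. induction n as [|n IH]; simpl; [ring|rewrite IH; ring]. Qed.

Lemma scv_ext a b l : (forall k, a k = b k) -> series_converges_to a l -> series_converges_to b l.
Proof.
  intros H. apply (flim_ext (F := eventually)). intros n. apply csum_ext. auto.
Qed.

Lemma scv_plus a b l m : series_converges_to a l -> series_converges_to b m ->
  series_converges_to (fun k => a k + b k)%C (l + m)%C.
Proof.
  intros Ha Hb. apply (flim_ext (F := eventually) (fun n => csum a n + csum b n)%C).
  - intros n. symmetry. apply csum_plus.
  - now apply (flim_plus (F := eventually)).
Qed.

Lemma scv_scal c a l : series_converges_to a l -> series_converges_to (fun k => c * a k)%C (c * l)%C.
Proof.
  intros Ha. apply (flim_ext (F := eventually) (fun n => c * csum a n)%C).
  - intros n. symmetry. apply csum_scal.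
  - apply (flim_mult (F := eventually)); [apply flim_const|exact Ha].
Qed.

Lemma scv_minus a b l m : series_converges_to a l -> series_converges_to b m ->
  series_converges_to (fun k => a k - b k)%C (l - m)%C.
Proof.
  intros Ha Hb. replace (l - m)%C with (l + - (1) * m)%C by ring.
  apply scv_ext with (fun k => a k + - (1) * b k)%C; [intros; ring|].
  apply scv_plus; [exact Ha|now apply scv_scal].
Qed.

Lemma scv_csum (a : nat -> nat -> C) (l : nat -> C) n :
  (forall j, (j < n)%nat -> series_converges_to (a j) (l j)) ->
  series_converges_to (fun k => csum (fun j => a j k) n) (csum l n).
Proof.
  induction n as [|n IH]; intros H; simpl.
  - intros eps He. exists O. intros m _.
    replace (csum (fun _ => RtoC 0) m - 0)%C with (RtoC 0); [now rewrite Cmod_0|].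
    induction m as [|m IHm]; simpl; [ring|]. rewrite IHm at 1. ring.
  - apply scv_plus; [apply IH; intros; apply H; lia|apply H; lia].
Qed.

Lemma rsum_mono b n m : (forall k, 0 <= b k) -> (n <= m)%nat -> rsum b n <= rsum b m.
Proof.
  intros Hb H. induction H as [|m H IH]; [lra|]. simpl. specialize (Hb m). lra.
Qed.

Lemma rsum_scal c b n : rsum (fun k => c * b k) n = c * rsum b n.
Proof. induction n as [|n IH]; simpl; [ring|rewrite IH; ring]. Qed.

Lemma csum_RtoC b n : csum (fun k => RtoC (b k)) n = RtoC (rsum b n).
Proof. induction n as [|n IH]; simpl; [reflexivity|]. now rewrite IH, RtoC_plus. Qed.

Lemma Cmod_csum_sub_le a b n m : (forall k, Cmod (a k) <= b k) -> (n <= m)%nat ->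
  Cmod (csum a m - csum a n) <= rsum b m - rsum b n.
Proof.
  intros Hb H. induction H as [|m H IH].
  - rewrite Cmod_sub_self. lra.
  - simpl. replace (csum a m + a m - csum a n)%C with ((csum a m - csum a n) + a m)%C by ring.
    eapply Rle_trans; [apply Cmod_triangle|]. specialize (Hb m). lra.
Qed.

Lemma Cmod_csum_le a b n : (forall k, Cmod (a k) <= b k) -> Cmod (csum a n) <= rsum b n.
Proof.
  intros H. generalize (Cmod_csum_sub_le a b 0 n H ltac:(lia)). simpl.
  replace (csum a n - 0)%C with (csum a n) by ring. lra.
Qed.

Lemma summable_tail b : summable b -> forall eps, 0 < eps -> exists N, forall n m,
  (N <= n)%nat -> (n <= m)%nat -> rsum b m - rsum b n <= eps.
Proof.
  intros [Hp [B HB]] eps He.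
  destruct (completeness (fun x => exists n, x = rsum b n)) as [l [L1 L2]].
  - exists B. intros x [n ->]. apply HB.
  - exists 0. now exists O.
  - assert (HN : exists N, l - eps < rsum b N).
    { apply NNPP. intros Hn. assert (l <= l - eps); [|lra]. apply L2. intros x [n ->].
      apply Rnot_lt_le. intros Hlt. apply Hn. now exists n. }
    destruct HN as [N HN]. exists N. intros n m Hn Hm.
    assert (A := rsum_mono b N n Hp Hn). assert (rsum b m <= l) by (apply L1; now exists m). lra.
Qed.

Lemma dominated_series a b : (forall n, Cmod (a n) <= b n) -> summable b ->
  series_converges_to a (Csum a).
Proof.
  intros Hab Hb. destruct (Ccomplete (csum a)) as [l Hl].
  - intros eps He. destruct (summable_tail b Hb (eps/2) (half_pos _ He)) as [N HN].
    exists N. intros n m Hn Hm. destruct (Nat.le_ge_cases n m) as [L|L].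
    + rewrite Cmod_sub_sym. eapply Rle_lt_trans; [apply Cmod_csum_sub_le; eauto|].
      specialize (HN n m Hn L). lra.
    + eapply Rle_lt_trans; [apply Cmod_csum_sub_le; eauto|]. specialize (HN m n Hm L). lra.
  - now rewrite (Csum_unique a l Hl).
Qed.

Lemma Cmod_Csum_le a b B : (forall n, Cmod (a n) <= b n) -> summable b ->
  (forall n, rsum b n <= B) -> Cmod (Csum a) <= B.
Proof.
  intros Hab Hb HB. assert (H := dominated_series a b Hab Hb).
  replace (Csum a) with (Csum a - 0)%C by ring.
  apply (flim_Cmod_le (F := eventually) (csum a)); [exact H|].
  apply filter_forall. intros n. replace (csum a n - 0)%C with (csum a n) by ring.
  eapply Rle_trans; [apply Cmod_csum_le, Hab|apply HB].
Qed.

(** [N] is chosen before [a], from the majorant alone; this gives uniformity in all parameters of a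
    series at once. *)
Lemma dominated_series_uniform b : summable b -> forall eps, 0 < eps ->
  exists N, forall a n, (forall n, Cmod (a n) <= b n) -> (N <= n)%nat ->
    Cmod (csum a n - Csum a) <= eps.
Proof.
  intros Hb eps He. destruct (summable_tail b Hb eps He) as [N HN]. exists N.
  intros a n Hab Hn. rewrite Cmod_sub_sym.
  apply (flim_Cmod_le (F := eventually) (csum a)); [now apply (dominated_series a b)|].
  exists n. intros m Hm. eapply Rle_trans; [apply Cmod_csum_sub_le; eauto|]. now apply HN.
Qed.

Lemma cholo_Csum (a : nat -> C -> C) b p r : 0 < r -> summable b ->
  (forall n w, Cmod (w - p) <= 2 * r -> cholo (a n) w /\ Cmod (a n w) <= b n) ->
  cholo (fun w => Csum (fun n => a n w)) p.
Proof.
  intros Hr Hb Ha. apply (cholo_uniform_limit (fun n w => csum (fun k => a k w) n) _ p r Hr).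
  - intros n w Hw. apply cholo_csum. intros k _. now apply Ha.
  - intros eps He. destruct (dominated_series_uniform b Hb eps He) as [N HN].
    exists N. intros n w Hn Hw. apply HN; [|exact Hn]. intros k. now apply Ha.
Qed.

Lemma summable_scal c b : 0 <= c -> summable b -> summable (fun n => c * b n).
Proof.
  intros Hc [H [B HB]]. split; [intros n; now apply Rmult_le_pos|].
  exists (c * B). intros n. rewrite rsum_scal. now apply Rmult_le_compat_l.
Qed.

Lemma summable_ratio b q N : (forall n, 0 <= b n) -> 0 <= q < 1 ->
  (forall n, (N <= n)%nat -> b (S n) <= q * b n) -> summable b.
Proof.
  intros Hb Hq H. split; [exact Hb|]. exists (rsum b N + b N / (1 - q)).
  (* The partial sum plus the geometric bound for its tail does not increase from [N] on. *)
  assert (K : forall k, rsum b (N + k)%nat + b (N + k)%nat / (1 - q) <= rsum b N + b N / (1 - q)).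
  { induction k as [|k IH]; [rewrite Nat.add_0_r; lra|].
    rewrite Nat.add_succ_r. simpl. eapply Rle_trans; [|exact IH].
    specialize (H (N + k)%nat ltac:(lia)).
    apply Rmult_le_compat_r with (r := / (1 - q)) in H; [|apply Rlt_le, Rinv_0_lt_compat; lra].
    replace (b (N + k)%nat / (1 - q)) with (b (N + k)%nat + q * b (N + k)%nat * / (1 - q)) by (field; lra).
    unfold Rdiv. lra. }
  intros n. assert (P : forall m, 0 <= b m / (1 - q)) by (intros; apply Rdiv_le_0_compat; [auto|lra]).
  destruct (Nat.le_ge_cases N n) as [L|L].
  - specialize (K (n - N)%nat). replace (N + (n - N))%nat with n in K by lia. specialize (P n). lra.
  - assert (A := rsum_mono b n N Hb L). specialize (P N). lra.
Qed.

Lemma summable_geom q : 0 <= q < 1 -> summable (fun n => q ^ n).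
Proof.
  intros Hq. apply (summable_ratio _ q O); [|exact Hq|].
  - intros n. now apply pow_le.
  - intros n _. simpl. lra.
Qed.

Lemma summable_term_0 b : summable b -> forall eps, 0 < eps -> exists N, forall n, (N <= n)%nat -> b n <= eps.
Proof.
  intros Hb eps He. destruct (summable_tail b Hb eps He) as [N HN]. exists N. intros n Hn.
  specialize (HN n (S n) Hn ltac:(lia)). simpl in HN. lra.
Qed.

(** * The binomial series *)

(** [s (s + 1) ... (s + n - 1) / n!], the coefficient of [x ^ n] in [(1 - x)^(- s)]. *)
Fixpoint cbin (s : C) (n : nat) : C :=
  match n with O => 1%C | S m => (cbin s m * (s + INR m) / INR (S m))%C end.

Fixpoint rbin (a : R) (n : nat) : R :=
  match n with O => 1 | S m => rbin a m * (a + INR m) / INR (S m) end.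

Lemma cbin_S s n : cbin s (S n) = (cbin s n * (s + INR n) / INR (S n))%C.
Proof. reflexivity. Qed.

Lemma rbin_S a n : rbin a (S n) = rbin a n * (a + INR n) / INR (S n).
Proof. reflexivity. Qed.

Lemma INR_S_pos n : 0 < INR (S n).
Proof. apply lt_0_INR. lia. Qed.

Lemma RtoC_INR_S_neq_0 n : RtoC (INR (S n)) <> 0.
Proof. intros E. apply RtoC_inj in E. generalize (INR_S_pos n). lra. Qed.

Lemma rbin_nonneg a n : 0 <= a -> 0 <= rbin a n.
Proof.
  intros Ha. induction n as [|n IH]; [simpl; lra|]. rewrite rbin_S.
  apply Rdiv_le_0_compat; [|apply INR_S_pos]. apply Rmult_le_pos; [exact IH|].
  generalize (pos_INR n). lra.
Qed.

Lemma rbin_mono a b n : 0 <= a <= b -> rbin a n <= rbin b n.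
Proof.
  intros H. induction n as [|n IH]; [simpl; lra|]. rewrite !rbin_S.
  unfold Rdiv. apply Rmult_le_compat_r; [apply Rlt_le, Rinv_0_lt_compat, INR_S_pos|].
  apply Rmult_le_compat; [apply rbin_nonneg; lra| |exact IH|lra]. generalize (pos_INR n). lra.
Qed.

Lemma Cmod_cbin_le s n : Cmod (cbin s n) <= rbin (Cmod s) n.
Proof.
  induction n as [|n IH]; [simpl; rewrite Cmod_1; lra|]. rewrite cbin_S, rbin_S.
  rewrite Cmod_div by apply RtoC_INR_S_neq_0. rewrite Cmod_mult, Cmod_R, (Rabs_pos_eq (INR (S n))) by apply pos_INR.
  unfold Rdiv. apply Rmult_le_compat_r; [apply Rlt_le, Rinv_0_lt_compat, INR_S_pos|].
  apply Rmult_le_compat; try apply Cmod_ge_0; [exact IH|].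
  eapply Rle_trans; [apply Cmod_triangle|]. rewrite Cmod_R, Rabs_pos_eq by apply pos_INR. lra.
Qed.

Lemma cbin_RtoC a n : cbin (RtoC a) n = RtoC (rbin a n).
Proof.
  induction n as [|n IH]; [reflexivity|]. rewrite cbin_S, rbin_S.
  rewrite IH, RtoC_div, RtoC_mult, RtoC_plus; [reflexivity|]. generalize (INR_S_pos n). lra.
Qed.

Lemma summable_rbin a q : 0 <= a -> 0 <= q < 1 -> summable (fun n => rbin a n * q ^ n).
Proof.
  (* The ratio of consecutive terms tends to [q], so it ends up below the midpoint [p] of [q] and
     1. *)
  intros Ha Hq. set (p := (1 + q) / 2).
  destruct (INR_unbounded (a / (p - q))) as [N HN].
  apply (summable_ratio _ p N).
  - intros n. apply Rmult_le_pos; [now apply rbin_nonneg|now apply pow_le].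
  - unfold p; lra.
  - intros n Hn. rewrite rbin_S. simpl pow.
    assert (Hn' := le_INR _ _ Hn). assert (Hs := INR_S_pos n). assert (Hn0 := pos_INR n).
    replace (rbin a n * (a + INR n) / INR (S n) * (q * q ^ n))
      with ((a + INR n) * q / INR (S n) * (rbin a n * q ^ n)) by (field; lra).
    apply Rmult_le_compat_r.
    { apply Rmult_le_pos; [now apply rbin_nonneg|now apply pow_le]. }
    apply Rmult_le_reg_r with (INR (S n)); [exact Hs|].
    unfold Rdiv. rewrite Rmult_assoc, Rinv_l, Rmult_1_r by lra. rewrite S_INR.
    assert (Hpq : 0 < p - q) by (unfold p; lra).
    assert (K : a <= INR n * (p - q)).
    { apply Rlt_le, Rmult_lt_reg_r with (/ (p - q)); [now apply Rinv_0_lt_compat|].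
      rewrite Rmult_assoc, Rinv_r, Rmult_1_r by lra. unfold Rdiv in HN. lra. }
    assert (0 < p) by (unfold p; lra). nra.
Qed.

Lemma cbin_shift s n : (INR (S n) * cbin s (S n))%C = (s * cbin (s + 1) n)%C.
Proof.
  induction n as [|n IH].
  - simpl. field.
  - assert (N := RtoC_INR_S_neq_0 n). assert (N' := RtoC_INR_S_neq_0 (S n)).
    rewrite (cbin_S s (S n)), (cbin_S (s + 1) n).
    replace (s * (cbin (s + 1) n * (s + 1 + INR n) / INR (S n)))%C
      with (s * cbin (s + 1) n * ((s + 1 + INR n) / INR (S n)))%C by (field; exact N).
    rewrite <- IH. rewrite (S_INR n), RtoC_plus in *. field. split; assumption.
Qed.

Lemma exp_le_compat x y : x <= y -> exp x <= exp y.
Proof. intros [H| ->]; [now apply Rlt_le, exp_increasing|apply Rle_refl]. Qed.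

Lemma Cmod_cexp_le a : Cmod (cexp a) <= exp (Cmod a).
Proof.
  rewrite Cmod_cexp. apply exp_le_compat. generalize (re_le_Cmod a) (RRle_abs (Re a)). lra.
Qed.

Lemma is_cderiv_csum (f : nat -> C -> C) (d : nat -> C) n s :
  (forall k, (k < n)%nat -> is_cderiv (f k) s (d k)) ->
  is_cderiv (fun w => csum (fun k => f k w) n) s (csum d n).
Proof.
  induction n as [|n IH]; intros H; [apply (is_cderiv_const 0)|].
  apply (is_cderiv_plus (fun w => csum (fun k => f k w) n) (f n)); [apply IH; intros; apply H; lia|apply H; lia].
Qed.

Lemma is_cderiv_pow n s : is_cderiv (fun w => w ^ n)%C s (INR n * s ^ pred n)%C.
Proof.
  induction n as [|n IH].
  - apply is_cderiv_eq with (RtoC 0); [simpl; ring|apply (is_cderiv_const 1)].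
  - eapply is_cderiv_eq; [|apply (is_cderiv_mult (fun w => w) (fun w => w ^ n)%C); [apply is_cderiv_id|exact IH]].
    rewrite S_INR, RtoC_plus. destruct n as [|n]; simpl pred; simpl Cpow; [simpl; ring|].
    rewrite S_INR, RtoC_plus. ring.
Qed.

(** The real mean value theorem, applied to the real and the imaginary part; hence the factor 2. *)
Lemma cderiv_segment_bound f (a b : C) M : 0 <= M ->
  (forall t, 0 <= t <= 1 -> exists l, is_cderiv f (a + RtoC t * (b - a))%C l /\ Cmod l <= M) ->
  Cmod (f b - f a) <= 2 * (M * Cmod (b - a)).
Proof.
  intros HM H.
  assert (D : forall u : C -> R, (forall c, Rabs (u c) <= Cmod c) ->
     forall g : R -> R, (forall t l, is_cderiv f (a + RtoC t * (b - a))%C l -> is_derive g t (u (l * (b - a))%C)) ->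
     Rabs (g 1 - g 0) <= M * Cmod (b - a)).
  { intros u Hu g Hg.
    assert (E : forall t, 0 <= t <= 1 -> exists l, is_derive g t l /\ Rabs l <= M * Cmod (b - a)).
    { intros t Ht. destruct (H t Ht) as [l [L1 L2]]. exists (u (l * (b - a))%C). split; [now apply Hg|].
      eapply Rle_trans; [apply Hu|]. rewrite Cmod_mult. apply Rmult_le_compat_r; [apply Cmod_ge_0|exact L2]. }
    destruct (MVT_gen g 0 1 (Derive g)) as [c [Hc Ec]].
    - rewrite Rmin_left, Rmax_right by lra. intros x Hx. destruct (E x ltac:(lra)) as [l [L1 _]].
      apply Derive_correct. now exists l.
    - rewrite Rmin_left, Rmax_right by lra. intros x Hx. destruct (E x Hx) as [l [L1 _]].
      apply derivable_continuous_pt. exists l. now apply is_derive_Reals.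
    - rewrite Rmin_left, Rmax_right in Hc by lra. destruct (E c Hc) as [l [L1 L2]].
      rewrite (is_derive_unique _ _ _ L1) in Ec. rewrite Ec, Rminus_0_r, Rmult_1_r. exact L2. }
  assert (A := D Re re_le_Cmod (fun t => Re (f (a + RtoC t * (b - a))%C)) (fun t l h => proj1 (is_rderiv_affine f a (b - a) t l h))).
  assert (B := D Im im_le_Cmod (fun t => Im (f (a + RtoC t * (b - a))%C)) (fun t l h => proj2 (is_rderiv_affine f a (b - a) t l h))).
  cbv beta in A, B.
  replace (a + 1 * (b - a))%C with b in A, B by ring. replace (a + 0 * (b - a))%C with a in A, B by ring.
  eapply Rle_trans; [apply Cmod_le_parts|]. rewrite re_minus, im_minus. lra.
Qed.

(** The full series solves [(1 - u) y' = s y]; a partial sum misses this equation by one term in its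
    top power. The last factor only switches that term off for the empty sum. *)
Lemma binomial_poly_ode s n u :
  ((1 - u) * csum (fun k => cbin s k * (INR k * u ^ pred k)) n - s * csum (fun k => cbin s k * u ^ k) n
   = - (s * cbin (s + 1) (pred n) * u ^ pred n * (if Nat.eqb n 0 then 0 else 1)))%C.
Proof.
  destruct n as [|n]; [simpl; ring|]. simpl Nat.eqb. simpl pred. cbv iota.
  induction n as [|n IH]; [simpl; ring|].
  change (csum (fun k => cbin s k * (INR k * u ^ pred k)) (S (S n)))%C
    with (csum (fun k => cbin s k * (INR k * u ^ pred k)) (S n) + cbin s (S n) * (INR (S n) * u ^ n))%C.
  change (csum (fun k => cbin s k * u ^ k) (S (S n)))%C
    with (csum (fun k => cbin s k * u ^ k) (S n) + cbin s (S n) * u ^ S n)%C.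
  replace ((1 - u) * (csum (fun k => cbin s k * (INR k * u ^ pred k)) (S n) + cbin s (S n) * (INR (S n) * u ^ n))
    - s * (csum (fun k => cbin s k * u ^ k) (S n) + cbin s (S n) * u ^ S n))%C
    with (((1 - u) * csum (fun k => cbin s k * (INR k * u ^ pred k)) (S n) - s * csum (fun k => cbin s k * u ^ k) (S n))
     + ((1 - u) * u ^ n * (INR (S n) * cbin s (S n)) - s * cbin s (S n) * u ^ S n))%C by ring.
  rewrite IH.
  assert (E : (s * cbin (s + 1) (S n))%C = ((s + INR (S n)) * cbin s (S n))%C).
  { rewrite <- cbin_shift. rewrite (cbin_S s (S n)).
    field. apply RtoC_INR_S_neq_0. }
  rewrite E, <- cbin_shift. simpl Cpow. ring.
Qed.

Lemma Cmod_Clog_le (w : C) : 0 < Re w -> Cmod (Clog w) <= Rabs (ln (Cmod w)) + PI.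
Proof.
  intros H. eapply Rle_trans; [apply Cmod_le_parts|]. apply Rplus_le_compat; [apply Rle_refl|now apply Im_Clog_bound].
Qed.

Lemma one_sub_disc x : Cmod x < 1 -> 0 < Re (1 - x) /\ 1 - Cmod x <= Cmod (1 - x) <= 2.
Proof.
  intros H. split.
  - rewrite re_minus. generalize (re_le_Cmod x) (RRle_abs (Re x)). simpl. lra.
  - generalize (Cmod_sub_ge 1 x) (Cmod_sub_le 1 x). rewrite Cmod_1. lra.
Qed.

(** [(1 - w)^s] times a partial sum is 1 at the origin, and its derivative, the defect in the
    differential equation, tends to 0 uniformly on [|w| <= |x|]. *)
Lemma binomial_series s x : Cmod x < 1 ->
  series_converges_to (fun k => cbin s k * x ^ k)%C (cexp (- (s * Clog (1 - x)))).
Proof.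
  intros Hx. set (q := Cmod x). assert (Hq : 0 <= q < 1) by (split; [apply Cmod_ge_0|exact Hx]).
  set (f := fun n w => (cexp (s * Clog (1 - w)) * csum (fun k => cbin s k * w ^ k) n)%C).
  set (L := Rmax (ln 2) (- ln (1 - q)) + PI).
  set (K := exp (Cmod s * L) / (1 - q)).
  assert (HK : 0 <= K) by (apply Rdiv_le_0_compat; [apply Rlt_le, exp_pos|lra]).
  assert (Hd : forall n w, Cmod w <= q -> is_cderiv (f (S n)) w
      (cexp (s * Clog (1 - w)) / (1 - w) * - (s * cbin (s + 1) n * w ^ n))%C).
  { intros n w Hw. destruct (one_sub_disc w ltac:(lra)) as [W1 W2].
    assert (N := Re_pos_neq_0 _ W1).
    eapply is_cderiv_eq; [|apply is_cderiv_mult].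
    2: { apply is_cderiv_cexp_comp. apply is_cderiv_mult; [apply is_cderiv_const|].
      apply (is_cderiv_comp (fun v => 1 - v)%C Clog); [|now apply is_cderiv_Clog].
      apply is_cderiv_ext with (fun v => 1 + v * (- (1)))%C; [intros; ring|]. apply is_cderiv_affine. }
    2: { apply is_cderiv_csum with (d := fun k => (cbin s k * (INR k * w ^ pred k))%C). intros k _.
      eapply is_cderiv_eq; [|apply is_cderiv_mult; [apply is_cderiv_const|apply is_cderiv_pow]]. cbv beta. ring. }
    assert (O := binomial_poly_ode s (S n) w). simpl Nat.eqb in O. simpl pred in O. cbv iota in O.
    rewrite Cmult_1_r in O. rewrite <- O. cbv beta. field. exact N. }
  assert (HB : forall w, Cmod w <= q -> Cmod (cexp (s * Clog (1 - w)) / (1 - w)) <= K).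
  { intros w Hw. destruct (one_sub_disc w ltac:(lra)) as [W1 W2].
    rewrite Cmod_div by now apply Re_pos_neq_0. unfold K, Rdiv.
    apply Rmult_le_compat; [apply Cmod_ge_0| | |].
    - apply Rlt_le, Rinv_0_lt_compat. lra.
    - eapply Rle_trans; [apply Cmod_cexp_le|]. apply exp_le_compat. rewrite Cmod_mult.
      apply Rmult_le_compat_l; [apply Cmod_ge_0|]. eapply Rle_trans; [now apply Cmod_Clog_le|].
      unfold L. apply Rplus_le_compat_r. apply Rabs_le.
      assert (ln (1 - q) <= ln (Cmod (1 - w))) by (apply ln_le; lra).
      assert (ln (Cmod (1 - w)) <= ln 2) by (apply ln_le; lra).
      generalize (Rmax_l (ln 2) (- ln (1 - q))) (Rmax_r (ln 2) (- ln (1 - q))). lra.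
    - apply Rinv_le_contravar; lra. }
  (* The index [S n] guarantees that the constant term is present, so that the value at 0 is 1. *)
  assert (Q : flim eventually (fun n => f (S n) x) 1).
  { intros eps He. set (b := fun n => rbin (Cmod (s + 1)) n * q ^ n).
    assert (Sb : summable b) by (apply summable_rbin; [apply Cmod_ge_0|exact Hq]).
    set (A := 2 * (K * Cmod s) + 1).
    assert (HA : 0 < A) by (unfold A; generalize (Rmult_le_pos _ _ HK (Cmod_ge_0 s)); lra).
    destruct (summable_term_0 b Sb (eps / (2 * A))) as [N HN]; [apply Rdiv_lt_0_compat; lra|].
    exists N. intros n Hn. specialize (HN n Hn).
    assert (B0 : 0 <= b n) by (apply Sb).
    assert (F0 : f (S n) 0 = RtoC 1).
    { unfold f. replace (1 - 0)%C with (RtoC 1) by ring. rewrite Clog_RtoC, ln_1 by lra.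
      replace (s * 0)%C with (RtoC 0) by ring. rewrite cexp_0, Cmult_1_l. clear.
      induction n as [|n IH]; [simpl; ring|]. change (csum (fun k => cbin s k * 0 ^ k) (S (S n)))%C
        with (csum (fun k => cbin s k * 0 ^ k) (S n) + cbin s (S n) * 0 ^ S n)%C. rewrite IH. simpl Cpow. ring. }
    rewrite <- F0. eapply Rle_lt_trans.
    - apply cderiv_segment_bound with (M := K * (Cmod s * b n)).
      + apply Rmult_le_pos; [exact HK|]. apply Rmult_le_pos; [apply Cmod_ge_0|exact B0].
      + intros t Ht. assert (Ht' : Cmod (0 + RtoC t * (x - 0)) <= q).
        { replace (0 + RtoC t * (x - 0))%C with (RtoC t * x)%C by ring.
          rewrite Cmod_mult, Cmod_R, Rabs_pos_eq by lra. fold q. nra. }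
        eexists. split; [apply Hd, Ht'|]. rewrite Cmod_mult, Cmod_opp, !Cmod_mult, Cmod_pow.
        apply Rmult_le_compat; [apply Cmod_ge_0| |now apply HB|].
        * repeat apply Rmult_le_pos; try apply Cmod_ge_0. apply pow_le, Cmod_ge_0.
        * rewrite Rmult_assoc. apply Rmult_le_compat_l; [apply Cmod_ge_0|]. unfold b.
          apply Rmult_le_compat; [apply Cmod_ge_0|apply pow_le, Cmod_ge_0|apply Cmod_cbin_le|].
          apply pow_incr. split; [apply Cmod_ge_0|exact Ht'].
    - replace (x - 0)%C with x by ring. fold q.
      apply Rle_lt_trans with (A * b n).
      + unfold A. assert (P := Rmult_le_pos _ _ (Rmult_le_pos _ _ HK (Cmod_ge_0 s)) B0). nra.
      + apply Rmult_le_compat_l with (r := A) in HN; [|lra].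
        replace (A * (eps / (2 * A))) with (eps / 2) in HN by (field; lra). lra. }
  assert (Q2 : flim eventually (fun n => cexp (- (s * Clog (1 - x))) * f (S n) x)%C (cexp (- (s * Clog (1 - x))) * 1)%C).
  { apply flim_mult; [apply flim_const|exact Q]. }
  rewrite Cmult_1_r in Q2.
  intros eps He. destruct (Q2 eps He) as [N HN]. exists (S N). intros n Hn.
  destruct n as [|n]; [lia|]. specialize (HN n ltac:(lia)). unfold f in HN.
  rewrite Cmult_assoc, <- cexp_plus in HN.
  replace (- (s * Clog (1 - x)) + s * Clog (1 - x))%C with (RtoC 0) in HN by ring.
  now rewrite cexp_0, Cmult_1_l in HN.
Qed.

(** * The reflection integral *)

(** A branch of [log (exp l - 1)] on [Re l > 0], written so that the principal logarithm is taken
    only in the right half-plane. Thus [Psi s l] is [(exp l - 1)^(- s)]. *)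
Definition ell (l : C) : C := (l + Clog (1 - cexp (- l)))%C.

Definition Psi (s l : C) : C := cexp (- (s * ell l)).

Definition uterm (s : C) (r : nat) (l : C) : C := (cbin s r * cexp (- ((s + INR r) * l)))%C.

(** [U s l] and [V s (ell l)] are the integrals of [x^(- s) / (1 + x)] over [x > exp l - 1] and over
    [0 < x < exp l - 1], the latter continued to all [s] outside {1, 2, 3, ...}. *)
Definition U (s l : C) : C := Csum (fun r => uterm s r l / (s + INR r))%C.

Definition vterm (s : C) (n : nat) (v : C) : C :=
  ((- (1)) ^ n * cexp ((INR n + 1 - s) * v) / (INR n + 1 - s))%C.

Definition V (s v : C) : C := Csum (fun n => vterm s n v).

Lemma Cmod_cexp_opp_lt_1 l : 0 < Re l -> Cmod (cexp (- l)) < 1.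
Proof. intros H. rewrite Cmod_cexp, re_opp, <- exp_0. apply exp_increasing. lra. Qed.

Lemma one_sub_cexp_Re l : 0 < Re l -> 0 < Re (1 - cexp (- l)).
Proof. intros H. apply one_sub_disc. now apply Cmod_cexp_opp_lt_1. Qed.

Lemma cexp_ell l : 0 < Re l -> cexp (ell l) = (cexp l - 1)%C.
Proof.
  intros H. unfold ell. rewrite cexp_plus, cexp_Clog by now apply one_sub_cexp_Re.
  rewrite cexp_opp. field. apply cexp_neq_0.
Qed.

Lemma is_cderiv_ell l : 0 < Re l -> is_cderiv ell l (/ (1 - cexp (- l)))%C.
Proof.
  intros H. assert (N := Re_pos_neq_0 _ (one_sub_cexp_Re l H)). unfold ell.
  eapply is_cderiv_eq; [|apply is_cderiv_plus; [apply is_cderiv_id|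
    apply (is_cderiv_comp (fun w => 1 - cexp (- w))%C Clog); [|now apply is_cderiv_Clog, one_sub_cexp_Re]]].
  2: { apply is_cderiv_ext with (fun w => 1 + - (1) * cexp (0 + w * (- (1))))%C.
    - intros w. replace (0 + w * - (1))%C with (- w)%C by ring. ring.
    - apply is_cderiv_plus; [apply is_cderiv_const|]. apply is_cderiv_mult; [apply is_cderiv_const|].
      apply (is_cderiv_cexp_comp (fun w => 0 + w * - (1))%C). apply is_cderiv_affine. }
  cbv beta. replace (0 + l * - (1))%C with (- l)%C by ring. field. exact N.
Qed.

Lemma uterm_pow s r l : uterm s r l = (cexp (- (s * l)) * (cbin s r * cexp (- l) ^ r))%C.
Proof.
  unfold uterm. rewrite <- cexp_INR.
  replace (- ((s + INR r) * l))%C with (- (s * l) + INR r * - l)%C by ring.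
  rewrite cexp_plus. ring.
Qed.

Lemma Psi_series s l : 0 < Re l -> series_converges_to (fun r => uterm s r l) (Psi s l).
Proof.
  intros H. unfold Psi, ell.
  replace (- (s * (l + Clog (1 - cexp (- l)))))%C
    with (- (s * l) + - (s * Clog (1 - cexp (- l))))%C by ring.
  rewrite cexp_plus.
  apply scv_ext with (fun r => cexp (- (s * l)) * (cbin s r * cexp (- l) ^ r))%C.
  - intros r. symmetry. apply uterm_pow.
  - apply scv_scal, binomial_series. now apply Cmod_cexp_opp_lt_1.
Qed.

(** Majorant of [uterm s r l] for [|s| <= S], [|l| <= D] and [Re l >= d]. *)
Definition ubound (S D d : R) (r : nat) : R := exp (S * D) * (rbin S r * exp (- d) ^ r).

Lemma summable_ubound S D d : 0 <= S -> 0 < d -> summable (ubound S D d).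
Proof.
  intros HS Hd. apply summable_scal; [apply Rlt_le, exp_pos|]. apply summable_rbin; [exact HS|].
  split; [apply Rlt_le, exp_pos|]. rewrite <- exp_0. apply exp_increasing. lra.
Qed.

Lemma uterm_le s l S D d r : Cmod s <= S -> Cmod l <= D -> d <= Re l ->
  Cmod (uterm s r l) <= ubound S D d r.
Proof.
  intros Hs Hl Hd. rewrite uterm_pow, !Cmod_mult, Cmod_pow. unfold ubound.
  assert (S0 := Cmod_ge_0 s). assert (D0 := Cmod_ge_0 l).
  apply Rmult_le_compat; [apply Cmod_ge_0| | |].
  - apply Rmult_le_pos; [apply Cmod_ge_0|apply pow_le, Cmod_ge_0].
  - eapply Rle_trans; [apply Cmod_cexp_le|]. apply exp_le_compat.
    rewrite Cmod_opp, Cmod_mult. now apply Rmult_le_compat.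
  - apply Rmult_le_compat; [apply Cmod_ge_0|apply pow_le, Cmod_ge_0| |].
    + eapply Rle_trans; [apply Cmod_cbin_le|]. apply rbin_mono. lra.
    + apply pow_incr. split; [apply Cmod_ge_0|]. rewrite Cmod_cexp, re_opp. apply exp_le_compat. lra.
Qed.

Lemma Csum_uterm s l : 0 < Re l -> Csum (fun r => uterm s r l) = Psi s l.
Proof. intros H. apply Csum_unique. now apply Psi_series. Qed.

Lemma Cmod_s_plus_INR s r : 0 < Re s -> Re s <= Cmod (s + INR r).
Proof.
  intros H. eapply Rle_trans; [|apply re_le_Cmod]. rewrite re_plus, re_RtoC.
  assert (H' := pos_INR r). rewrite Rabs_pos_eq; lra.
Qed.

Lemma s_plus_INR_neq_0 s r : 0 < Re s -> (s + INR r)%C <> 0.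
Proof. intros H. apply Cmod_gt_0. generalize (Cmod_s_plus_INR s r H). lra. Qed.

Lemma uterm_div_le s l S D d r : 0 < Re s -> Cmod s <= S -> Cmod l <= D -> d <= Re l ->
  Cmod (uterm s r l / (s + INR r)) <= / Re s * ubound S D d r.
Proof.
  intros H0 Hs Hl Hd. rewrite Cmod_div by now apply s_plus_INR_neq_0.
  rewrite Rmult_comm. apply Rmult_le_compat; [apply Cmod_ge_0| |now apply uterm_le|].
  - apply Rlt_le, Rinv_0_lt_compat. generalize (Cmod_s_plus_INR s r H0). lra.
  - apply Rinv_le_contravar; [exact H0|now apply Cmod_s_plus_INR].
Qed.

Lemma U_series s l : 0 < Re s -> 0 < Re l ->
  series_converges_to (fun r => uterm s r l / (s + INR r))%C (U s l).
Proof.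
  intros Hs Hl. apply dominated_series with (fun r => / Re s * ubound (Cmod s) (Cmod l) (Re l) r).
  - intros r. apply uterm_div_le; auto with real.
  - apply summable_scal; [now apply Rlt_le, Rinv_0_lt_compat|]. apply summable_ubound; [apply Cmod_ge_0|exact Hl].
Qed.

Lemma INR_1_s_neq_0 s n : Re s < 1 -> (INR n + 1 - s)%C <> 0.
Proof.
  intros H. apply Re_pos_neq_0. rewrite re_minus, re_plus, !re_RtoC. generalize (pos_INR n). lra.
Qed.

Lemma vterm_le s n v : Re s < 1 ->
  Cmod (vterm s n v) <= Cmod (cexp ((1 - s) * v)) / (1 - Re s) * Cmod (cexp v) ^ n.
Proof.
  intros H. unfold vterm. rewrite Cmod_div by now apply INR_1_s_neq_0.
  replace ((INR n + 1 - s) * v)%C with ((1 - s) * v + INR n * v)%C by ring.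
  rewrite cexp_plus, cexp_INR, !Cmod_mult, !Cmod_pow, Cmod_opp, Cmod_1, pow1, Rmult_1_l.
  assert (K : / Cmod (INR n + 1 - s) <= / (1 - Re s)).
  { apply Rinv_le_contravar; [lra|]. eapply Rle_trans; [|apply re_le_Cmod].
    rewrite re_minus, re_plus, !re_RtoC. generalize (pos_INR n). intros P. rewrite Rabs_pos_eq; lra. }
  unfold Rdiv. rewrite Rmult_assoc, (Rmult_comm _ (/ _)), <- Rmult_assoc.
  apply Rmult_le_compat_r; [apply pow_le, Cmod_ge_0|].
  apply Rmult_le_compat_l; [apply Cmod_ge_0|exact K].
Qed.

Lemma summable_vbound K q : 0 <= K -> 0 <= q < 1 -> summable (fun n => K * q ^ n).
Proof. intros HK Hq. apply summable_scal; [exact HK|now apply summable_geom]. Qed.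

Lemma vbound_nonneg s v : Re s < 1 -> 0 <= Cmod (cexp ((1 - s) * v)) / (1 - Re s).
Proof. intros H. apply Rdiv_le_0_compat; [apply Cmod_ge_0|lra]. Qed.

Lemma V_series s v : Re s < 1 -> Cmod (cexp v) < 1 ->
  series_converges_to (fun n => vterm s n v) (V s v).
Proof.
  intros Hs Hv. eapply dominated_series.
  - intros n. now apply vterm_le.
  - apply summable_vbound; [now apply vbound_nonneg|]. split; [apply Cmod_ge_0|exact Hv].
Qed.

Lemma csum_geom (g : C) n : ((1 - g) * csum (fun k => g ^ k) n)%C = (1 - g ^ n)%C.
Proof.
  induction n as [|n IH]; [simpl; ring|].
  change (csum (fun k => g ^ k) (S n))%C with (csum (fun k => g ^ k) n + g ^ n)%C.
  rewrite Cmult_plus_distr_l, IH. simpl Cpow. ring.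
Qed.

(** The integrand [x^(- s) / (1 + x)] of the beta integral, after the substitution [x = exp v]. *)
Definition bkernel (s v : C) : C := (cexp ((1 - s) * v) / (1 + cexp v))%C.

Lemma is_cderiv_vsum s n v : Re s < 1 -> (1 + cexp v)%C <> 0 ->
  is_cderiv (fun w => csum (fun k => vterm s k w) n) v (bkernel s v * (1 - (- cexp v) ^ n))%C.
Proof.
  intros Hs Hv. eapply is_cderiv_eq.
  2: { apply is_cderiv_csum with (d := fun k => (cexp ((1 - s) * v) * (- cexp v) ^ k)%C).
    intros k _. assert (N := INR_1_s_neq_0 s k Hs).
    apply is_cderiv_ext with (fun w => (- (1)) ^ k / (INR k + 1 - s) * cexp (0 + w * (INR k + 1 - s)))%C.
    { intros w. unfold vterm. replace (0 + w * (INR k + 1 - s))%C with ((INR k + 1 - s) * w)%C by ring.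
      field. exact N. }
    eapply is_cderiv_eq; [|apply is_cderiv_mult; [apply is_cderiv_const|
      apply (is_cderiv_cexp_comp (fun w => 0 + w * (INR k + 1 - s))%C), is_cderiv_affine]].
    cbv beta. replace (- cexp v)%C with (- (1) * cexp v)%C by ring. rewrite Cpow_mult_l, <- cexp_INR.
    replace (0 + v * (INR k + 1 - s))%C with ((1 - s) * v + INR k * v)%C by ring.
    rewrite cexp_plus. field. exact N. }
  rewrite csum_scal, <- csum_geom. unfold bkernel.
  replace (1 - - cexp v)%C with (1 + cexp v)%C by ring. 
  change (csum (Cpow (- cexp v)) n) with (csum (fun k => (- cexp v) ^ k)%C n). field. exact Hv.
Qed.

Lemma is_cderiv_usum s n l : 0 < Re s ->
  is_cderiv (fun w => csum (fun r => uterm s r w / (s + INR r)) n)%C l (- csum (fun r => uterm s r l) n)%C.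
Proof.
  intros Hs. apply is_cderiv_eq with (csum (fun r => - (1) * uterm s r l) n)%C.
  { rewrite csum_scal. ring. }
  apply is_cderiv_csum with (d := fun r => (- (1) * uterm s r l)%C).
  intros r _. assert (N := s_plus_INR_neq_0 s r Hs).
  apply is_cderiv_ext with (fun w => cbin s r / (s + INR r) * cexp (0 + w * - (s + INR r)))%C.
  { intros w. unfold uterm. replace (0 + w * - (s + INR r))%C with (- ((s + INR r) * w))%C by ring.
    field. exact N. }
  eapply is_cderiv_eq; [|apply is_cderiv_mult; [apply is_cderiv_const|
    apply (is_cderiv_cexp_comp (fun w => 0 + w * - (s + INR r))%C), is_cderiv_affine]].
  cbv beta. unfold uterm. replace (0 + l * - (s + INR r))%C with (- ((s + INR r) * l))%C by ring.
  field. exact N.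
Qed.

Lemma cexp_sub_1_le l : Cmod l <= 1 / 4 -> Cmod (cexp l - 1) <= 3 * Cmod l.
Proof.
  intros H. rewrite <- cexp_0. eapply Rle_trans.
  - apply cderiv_segment_bound with (M := 4 / 3); [lra|]. intros t Ht. eexists.
    split; [apply is_cderiv_cexp|]. eapply Rle_trans; [apply Cmod_cexp_le|].
    replace (0 + t * (l - 0))%C with (t * l)%C by ring.
    rewrite Cmod_mult, Cmod_R, Rabs_pos_eq by lra.
    apply Rle_trans with (exp (1 / 4)); [apply exp_le_compat; generalize (Cmod_ge_0 l); nra|].
    assert (E := exp_ineq1_le (- (1 / 4))). rewrite exp_Ropp in E. assert (P := exp_pos (1 / 4)).
    apply Rmult_le_compat_l with (r := exp (1 / 4)) in E; [|lra]. rewrite Rinv_r in E by lra. lra.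
  - replace (l - 0)%C with l by ring. generalize (Cmod_ge_0 l). lra.
Qed.

Lemma segment_Re (a b : C) d t : d <= Re a -> d <= Re b -> 0 <= t <= 1 ->
  d <= Re (a + RtoC t * (b - a)).
Proof. intros. rewrite re_plus, re_scal_l, re_minus. nra. Qed.

Lemma segment_Cmod (a b : C) D t : Cmod a <= D -> Cmod b <= D -> 0 <= t <= 1 ->
  Cmod (a + RtoC t * (b - a)) <= D.
Proof.
  intros Ha Hb Ht. replace (a + t * (b - a))%C with (RtoC (1 - t) * a + RtoC t * b)%C
    by (rewrite RtoC_minus; ring).
  eapply Rle_trans; [apply Cmod_triangle|]. rewrite !Cmod_mult, !Cmod_R, !Rabs_pos_eq by lra. nra.
Qed.

(** The derivative of [U + V o ell] vanishes; its partial sums have a uniformly small derivative. *)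
Lemma U_V_const s a b : 0 < Re s < 1 -> 0 < Re a -> 0 < Re b ->
  Cmod a <= 1 / 4 -> Cmod b <= 1 / 4 -> (U s a + V s (ell a) = U s b + V s (ell b))%C.
Proof.
  intros Hs Ha Hb Ha4 Hb4.
  set (d := Rmin (Re a) (Re b)). assert (Hd : 0 < d) by now apply Rmin_glb_lt.
  set (S0 := Cmod s). set (bd := ubound S0 (1 / 4) d).
  assert (HS0 : 0 <= S0) by apply Cmod_ge_0.
  assert (Sb : summable bd) by now apply summable_ubound.
  assert (Hub : forall w, d <= Re w -> Cmod w <= 1 / 4 -> forall r, Cmod (uterm s r w) <= bd r).
  { intros w W1 W2 r. apply uterm_le; auto. apply Rle_refl. }
  destruct Sb as [Sb1 [B SB]]. assert (Sb : summable bd) by (split; [exact Sb1|now exists B]).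
  (* The bound 1/4 keeps [exp w - 1] inside the unit disc, where the series [V] converges. *)
  assert (HX : forall w, 0 < Re w -> Cmod w <= 1 / 4 -> Cmod (cexp (ell w)) <= 3 / 4).
  { intros w W1 W2. rewrite cexp_ell by exact W1. eapply Rle_trans; [now apply cexp_sub_1_le|]. lra. }
  set (f := fun n w => (csum (fun r => uterm s r w / (s + INR r)) n + csum (fun k => vterm s k (ell w)) n)%C).
  assert (Hf : forall n w, d <= Re w -> Cmod w <= 1 / 4 ->
     is_cderiv (f n) w (- csum (fun r => uterm s r w) n + Psi s w * (1 - (- cexp (ell w)) ^ n))%C).
  { intros n w W1 W2. assert (W0 : 0 < Re w) by lra. apply is_cderiv_plus; [now apply is_cderiv_usum|].
    assert (N1 := cexp_neq_0 w). assert (N2 := cexp_neq_0 (ell w)).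
    assert (E1 : (1 + cexp (ell w))%C = cexp w) by (rewrite cexp_ell by exact W0; ring).
    eapply is_cderiv_eq; [|apply (is_cderiv_comp ell (fun v => csum (fun k => vterm s k v) n));
      [now apply is_cderiv_ell|apply is_cderiv_vsum; [lra|rewrite E1; exact N1]]].
    unfold bkernel, Psi. rewrite E1.
    assert (E2 : (1 - cexp (- w))%C = (cexp (ell w) / cexp w)%C).
    { rewrite cexp_ell, cexp_opp by exact W0. field. exact N1. }
    rewrite E2. replace (cexp ((1 - s) * ell w)) with (cexp (ell w) * cexp (- (s * ell w)))%C
      by (rewrite <- cexp_plus; f_equal; ring).
    field. split; assumption. }
  assert (Lim : forall w, 0 < Re w -> Cmod w <= 1 / 4 ->
     flim eventually (fun n => f n w) (U s w + V s (ell w))%C).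
  { intros w W1 W2. apply (flim_plus (F := eventually)).
    - apply U_series; lra.
    - apply V_series; [lra|]. generalize (HX w W1 W2). lra. }
  apply eq_of_Cmod_small. intros eps He.
  apply (flim_Cmod_le (F := eventually) (fun n => f n a - f n b + (U s b + V s (ell b)))%C).
  { apply flim_eq with ((U s a + V s (ell a)) - (U s b + V s (ell b)) + (U s b + V s (ell b)))%C; [ring|].
    apply flim_plus; [|apply flim_const]. apply flim_minus; now apply Lim. }
  assert (B0 : 0 <= B) by (apply (SB O)).
  destruct (dominated_series_uniform bd Sb (eps / 2) (half_pos _ He)) as [N1 HN1].
  assert (Hk : 0 < eps / 2 / (B + 1)) by (apply Rdiv_lt_0_compat; lra).
  assert (H34 : Rabs (3 / 4) < 1) by (rewrite Rabs_pos_eq; lra).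
  destruct (pow_lt_1_zero (3 / 4) H34 _ Hk) as [N2 HN2].
  exists (Nat.max N1 N2). intros n Hn.
  replace (f n a - f n b + (U s b + V s (ell b)) - (U s b + V s (ell b)))%C with (f n a - f n b)%C by ring.
  assert (Q : Cmod (f n a - f n b) <= 2 * (eps * Cmod (a - b))).
  { apply cderiv_segment_bound; [lra|]. intros t Ht.
    set (w := (b + RtoC t * (a - b))%C).
    assert (W1 : d <= Re w) by (apply segment_Re; [apply Rmin_r|apply Rmin_l|exact Ht]).
    assert (W2 : Cmod w <= 1 / 4) by now apply segment_Cmod.
    assert (W0 : 0 < Re w) by lra.
    eexists. split; [now apply Hf|].
    replace (- csum (fun r => uterm s r w) n + Psi s w * (1 - (- cexp (ell w)) ^ n))%C
      with (- (csum (fun r => uterm s r w) n - Psi s w) - Psi s w * (- cexp (ell w)) ^ n)%C by ring.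
    eapply Rle_trans; [apply Cmod_sub_le|]. rewrite Cmod_opp, Cmod_mult, Cmod_pow, Cmod_opp.
    assert (T1 : Cmod (csum (fun r => uterm s r w) n - Psi s w) <= eps / 2).
    { rewrite <- Csum_uterm by exact W0. apply HN1; [now apply Hub|lia]. }
    assert (T2 : Cmod (Psi s w) <= B).
    { rewrite <- Csum_uterm by exact W0. apply Cmod_Csum_le with bd; auto. }
    assert (T3 : Cmod (cexp (ell w)) ^ n <= (3 / 4) ^ n).
    { apply pow_incr. split; [apply Cmod_ge_0|now apply HX]. }
    specialize (HN2 n ltac:(lia)). rewrite Rabs_pos_eq in HN2 by (apply pow_le; lra).
    assert (T4 : Cmod (Psi s w) * Cmod (cexp (ell w)) ^ n <= B * (eps / 2 / (B + 1))).
    { apply Rmult_le_compat; [apply Cmod_ge_0|apply pow_le, Cmod_ge_0|exact T2|lra]. }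
    assert (T5 : B * (eps / 2 / (B + 1)) <= eps / 2).
    { apply Rle_trans with ((B + 1) * (eps / 2 / (B + 1))); [apply Rmult_le_compat_r; lra|].
      right. field. lra. }
    lra. }
  eapply Rle_trans; [exact Q|]. generalize (Cmod_sub_le a b). nra.
Qed.

Lemma rcont_RtoC (f : C -> C) t : ccont f (RtoC t) -> rcont (fun u => f (RtoC u)) t.
Proof. apply (rcont_horizontal f 0 t). Qed.

(** Termwise integration: [g n] are partial sums of a series for [F] and [G n] those of its termwise
    primitive. It is applied once to [V] and once to [U]. *)
Lemma cint_uniform_primitive (G g : nat -> C -> C) (F : C -> C) a b ga gb : a <= b ->
  (forall n v, a <= v <= b -> is_cderiv (G n) (RtoC v) (g n (RtoC v)) /\ ccont (g n) (RtoC v)) ->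
  (forall v, a <= v <= b -> ccont F (RtoC v)) ->
  (forall eps, 0 < eps -> exists N, forall n v, (N <= n)%nat -> a <= v <= b ->
     Cmod (F (RtoC v) - g n (RtoC v)) <= eps) ->
  flim eventually (fun n => G n (RtoC a)) ga -> flim eventually (fun n => G n (RtoC b)) gb ->
  cint (fun v => F (RtoC v)) a b = (gb - ga)%C.
Proof.
  intros Hab HG HF Hu Ha Hb.
  apply (flim_unique (F := eventually) (fun n => G n (RtoC b) - G n (RtoC a))%C); [|now apply flim_minus].
  assert (EF : ex_cint (fun v => F (RtoC v)) a b).
  { apply ex_cint_cont; [exact Hab|]. intros t Ht. apply rcont_RtoC. auto. }
  assert (EG : forall n, ex_cint (fun v => g n (RtoC v)) a b).
  { intros n. apply ex_cint_cont; [exact Hab|]. intros t Ht. apply rcont_RtoC. now apply HG. }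
  intros eps He. set (e := eps / (4 * (b - a + 1))).
  assert (He' : 0 < e) by (apply Rdiv_lt_0_compat; lra).
  destruct (Hu e He') as [N HN]. exists N. intros n Hn.
  rewrite <- (cint_derive (fun v => G n (RtoC v)) (fun v => g n (RtoC v)) a b Hab).
  2: { intros t Ht. apply (is_rderiv_horizontal (G n) 0 t). now apply HG. }
  2: { intros t Ht. apply rcont_RtoC. now apply HG. }
  assert (Em : ex_cint (fun v => - (1) * g n (RtoC v))%C a b).
  { apply ex_cint_cont; [exact Hab|]. intros t Ht. apply (rcont_RtoC (fun w => - (1) * g n w)%C).
    apply ccont_mult; [apply ccont_const|now apply HG]. }
  replace (cint (fun v => g n (RtoC v)) a b - cint (fun v => F (RtoC v)) a b)%C
    with (- (cint (fun v => F (RtoC v)) a b + - (1) * cint (fun v => g n (RtoC v)) a b))%C by ring.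
  rewrite <- cint_scal by auto. rewrite <- cint_plus by auto. rewrite Cmod_opp.
  eapply Rle_lt_trans; [apply cint_norm_le with (M := e)|].
  - exact Hab.
  - apply ex_cint_cont; [exact Hab|]. intros t Ht. apply (rcont_RtoC (fun w => F w + - (1) * g n w)%C).
    apply ccont_plus; [auto|]. apply ccont_mult; [apply ccont_const|now apply HG].
  - intros t Ht. replace (F (RtoC t) + - (1) * g n (RtoC t))%C with (F (RtoC t) - g n (RtoC t))%C by ring.
    now apply HN.
  - assert (E : e * (4 * (b - a + 1)) = eps) by (unfold e; field; lra). nra.
Qed.

Lemma one_plus_cexp_real_neq_0 (v : R) : (1 + cexp v)%C <> 0.
Proof. apply Re_pos_neq_0. rewrite cexp_RtoC, re_plus, !re_RtoC. generalize (exp_pos v). lra. Qed.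

Lemma cholo_bkernel s v : (1 + cexp v)%C <> 0 -> cholo (bkernel s) v.
Proof.
  intros N. apply cholo_div; [exact N| |].
  - apply cholo_cexp. apply cholo_mult; [apply cholo_const|apply cholo_id].
  - apply cholo_plus; [apply cholo_const|]. apply cholo_cexp, cholo_id.
Qed.

Lemma ccont_bkernel_real s (v : R) : ccont (bkernel s) v.
Proof. apply cholo_cont, cholo_bkernel, one_plus_cexp_real_neq_0. Qed.

Lemma Cmod_bkernel_le s (v : R) D : Rabs v <= D -> Cmod (bkernel s v) <= exp (Cmod (1 - s) * D).
Proof.
  intros H. unfold bkernel. rewrite Cmod_div by apply one_plus_cexp_real_neq_0.
  assert (A : 1 <= Cmod (1 + cexp v)).
  { eapply Rle_trans; [|apply re_le_Cmod]. rewrite cexp_RtoC, re_plus, !re_RtoC.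
    assert (P := exp_pos v). rewrite Rabs_pos_eq; lra. }
  apply Rle_trans with (Cmod (cexp ((1 - s) * v)) * 1).
  - apply Rmult_le_compat_l; [apply Cmod_ge_0|]. apply Rle_trans with (/ 1); [apply Rinv_le_contravar; lra|lra].
  - rewrite Rmult_1_r. eapply Rle_trans; [apply Cmod_cexp_le|]. apply exp_le_compat.
    rewrite Cmod_mult, Cmod_R. apply Rmult_le_compat_l; [apply Cmod_ge_0|exact H].
Qed.

Lemma cint_bkernel_left s a b : Re s < 1 -> a <= b -> b < 0 ->
  cint (fun v => bkernel s (RtoC v)) a b = (V s b - V s a)%C.
Proof.
  intros Hs Hab Hb. set (q := exp b).
  assert (Hq : 0 <= q < 1).
  { split; [apply Rlt_le, exp_pos|]. unfold q. rewrite <- exp_0. now apply exp_increasing. }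
  assert (Hexp : forall v, v <= b -> Cmod (cexp (RtoC v)) <= q).
  { intros v Hv. rewrite Cmod_cexp, re_RtoC. now apply exp_le_compat. }
  apply (cint_uniform_primitive (fun n v => csum (fun k => vterm s k v) n)
     (fun n v => bkernel s v * (1 - (- cexp v) ^ n))%C).
  - exact Hab.
  - intros n v Hv. split; [apply is_cderiv_vsum; [exact Hs|apply one_plus_cexp_real_neq_0]|].
    apply ccont_mult; [apply ccont_bkernel_real|]. apply cholo_cont, cholo_minus; [apply cholo_const|].
    apply (cholo_pow (fun v => - cexp v)%C), cholo_opp, cholo_cexp, cholo_id.
  - intros v _. apply ccont_bkernel_real.
  - intros eps He. set (K := exp (Cmod (1 - s) * Rabs a)).
    assert (HK : 0 < K) by apply exp_pos.
    assert (Hq' : Rabs q < 1) by (rewrite Rabs_pos_eq; lra).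
    assert (Hk : 0 < eps / K) by (apply Rdiv_lt_0_compat; lra).
    destruct (pow_lt_1_zero q Hq' _ Hk) as [N HN]. exists N. intros n v Hn Hv.
    replace (bkernel s v - bkernel s v * (1 - (- cexp v) ^ n))%C with (bkernel s v * (- cexp v) ^ n)%C by ring.
    rewrite Cmod_mult, Cmod_pow, Cmod_opp.
    specialize (HN n ltac:(lia)). rewrite Rabs_pos_eq in HN by (apply pow_le; lra).
    apply Rle_trans with (K * q ^ n).
    + apply Rmult_le_compat; [apply Cmod_ge_0|apply pow_le, Cmod_ge_0| |].
      * apply Cmod_bkernel_le. rewrite !Rabs_left1; lra.
      * apply pow_incr. split; [apply Cmod_ge_0|]. apply Hexp. lra.
    + apply Rmult_lt_compat_l with (r := K) in HN; [|exact HK].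
      replace (K * (eps / K)) with eps in HN by (field; lra). lra.
  - apply V_series; [exact Hs|]. generalize (Hexp a Hab). lra.
  - apply V_series; [exact Hs|]. generalize (Hexp b (Rle_refl b)). lra.
Qed.

(** The substitution [x = exp v], [l = log (1 + x)] from [U] to the kernel. *)
Definition softplus (v : C) : C := Clog (1 + cexp v).

Lemma softplus_real (v : R) : softplus v = RtoC (ln (1 + exp v)).
Proof. unfold softplus. rewrite cexp_RtoC, <- RtoC_plus. apply Clog_RtoC. generalize (exp_pos v). lra. Qed.

Lemma softplus_ge v : 0 < ln (1 + exp v) /\ v <= ln (1 + exp v).
Proof.
  assert (P := exp_pos v). split.
  - rewrite <- ln_1. apply ln_increasing; lra.
  - rewrite <- (ln_exp v) at 1. apply ln_le; lra.
Qed.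

Lemma ell_softplus (v : R) : ell (softplus v) = RtoC v.
Proof.
  assert (P := exp_pos v). rewrite softplus_real. unfold ell.
  replace (1 - cexp (- ln (1 + exp v)))%C with (RtoC (exp v / (1 + exp v))).
  - rewrite Clog_RtoC by (apply Rdiv_lt_0_compat; lra). rewrite ln_div by lra.
    rewrite ln_exp, <- RtoC_plus. f_equal. ring.
  - rewrite cexp_opp, cexp_RtoC, exp_ln, <- RtoC_inv, <- RtoC_minus by lra. f_equal. field. lra.
Qed.

Lemma is_cderiv_softplus (v : R) : is_cderiv softplus v (cexp v / (1 + cexp v))%C.
Proof.
  assert (Q : 0 < Re (1 + cexp v)).
  { rewrite cexp_RtoC, re_plus, !re_RtoC. generalize (exp_pos v). lra. }
  eapply is_cderiv_eq; [|apply (is_cderiv_comp (fun w => 1 + cexp w)%C Clog); [|now apply is_cderiv_Clog]].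
  2: { apply is_cderiv_plus; [apply is_cderiv_const|apply is_cderiv_cexp]. }
  cbv beta. field. apply one_plus_cexp_real_neq_0.
Qed.

Lemma cint_bkernel_right s a b : 0 < Re s -> a <= b ->
  cint (fun v => bkernel s (RtoC v)) a b = (U s (softplus a) - U s (softplus b))%C.
Proof.
  intros Hs Hab. set (d := ln (1 + exp a)). set (D := ln (1 + exp b)).
  assert (Hd : 0 < d) by apply softplus_ge.
  assert (Hl : forall v, a <= v <= b -> d <= Re (softplus v) /\ Cmod (softplus v) <= D).
  { intros v Hv. rewrite softplus_real, Cmod_R, re_RtoC, Rabs_pos_eq by (apply Rlt_le, softplus_ge).
    assert (P := exp_pos a). assert (P' := exp_pos v).
    assert (exp a <= exp v) by (apply exp_le_compat; lra). assert (exp v <= exp b) by (apply exp_le_compat; lra).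
    unfold d, D. split; apply ln_le; lra. }
  assert (Hpos : forall v : R, 0 < Re (softplus v)).
  { intros v. rewrite softplus_real, re_RtoC. apply softplus_ge. }
  assert (Sb : summable (ubound (Cmod s) D d)) by (apply summable_ubound; [apply Cmod_ge_0|exact Hd]).
  replace (U s (softplus a) - U s (softplus b))%C with (- U s (softplus b) - - U s (softplus a))%C by ring.
  apply (cint_uniform_primitive
     (fun n v => - (1) * csum (fun r => uterm s r (softplus v) / (s + INR r)) n)%C
     (fun n v => csum (fun r => uterm s r (softplus v)) n * (cexp v / (1 + cexp v)))%C).
  - exact Hab.
  - intros n v Hv. split.
    + eapply is_cderiv_eq; [|apply is_cderiv_mult; [apply is_cderiv_const|
        apply (is_cderiv_comp softplus (fun l => csum (fun r => uterm s r l / (s + INR r)) n)%C);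
        [apply is_cderiv_softplus|now apply is_cderiv_usum]]]. cbv beta. ring.
    + apply cholo_cont. apply cholo_mult.
      * apply cholo_csum. intros k _. unfold uterm. apply cholo_mult; [apply cholo_const|].
        apply cholo_cexp, cholo_opp, cholo_mult; [apply cholo_const|]. eexists. apply is_cderiv_softplus.
      * apply cholo_div; [apply one_plus_cexp_real_neq_0|apply cholo_cexp, cholo_id|].
        apply cholo_plus; [apply cholo_const|apply cholo_cexp, cholo_id].
  - intros v _. apply ccont_bkernel_real.
  - intros eps He. destruct (dominated_series_uniform _ Sb eps He) as [N HN].
    exists N. intros n v Hn Hv. destruct (Hl v Hv) as [L1 L2].
    assert (E : bkernel s v = (Psi s (softplus v) * (cexp v / (1 + cexp v)))%C).
    { unfold bkernel, Psi. rewrite ell_softplus.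
      replace ((1 - s) * v)%C with (- (s * v) + v)%C by ring. rewrite cexp_plus.
      field. apply one_plus_cexp_real_neq_0. }
    rewrite E, <- Csum_uterm by apply Hpos.
    match goal with |- Cmod (?x * ?y - ?z * ?y) <= _ => replace (x * y - z * y)%C with ((x - z) * y)%C by ring end.
    rewrite Cmod_mult, Cmod_sub_sym.
    assert (Hle : Cmod (cexp v / (1 + cexp v)) <= 1).
    { rewrite cexp_RtoC, <- RtoC_plus, <- RtoC_div, Cmod_R by (generalize (exp_pos v); lra).
      assert (P := exp_pos v). rewrite Rabs_pos_eq by (apply Rdiv_le_0_compat; lra).
      apply Rmult_le_reg_r with (1 + exp v); [lra|]. unfold Rdiv. rewrite Rmult_assoc, Rinv_l; lra. }
    assert (K : Cmod (csum (fun r => uterm s r (softplus v)) n - Csum (fun r => uterm s r (softplus v))) <= eps).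
    { apply HN; [|exact Hn]. intros r. apply uterm_le; auto. apply Rle_refl. }
    generalize (Cmod_ge_0 (csum (fun r => uterm s r (softplus v)) n - Csum (fun r => uterm s r (softplus v))))
      (Cmod_ge_0 (cexp v / (1 + cexp v))). nra.
  - apply flim_eq with (- (1) * U s (softplus a))%C; [ring|].
    apply flim_mult; [apply flim_const|]. now apply U_series.
  - apply flim_eq with (- (1) * U s (softplus b))%C; [ring|].
    apply flim_mult; [apply flim_const|]. now apply U_series.
Qed.

(** * The contour integral over [-r, r] x [0, 2 PI] *)

Lemma cexp_pi_i : cexp (PI * Ci) = (- (1))%C.
Proof.
  unfold cexp. replace (Re (PI * Ci)) with 0 by (simpl; ring). replace (Im (PI * Ci)) with PI by (simpl; ring).
  rewrite exp_0, cos_PI, sin_PI. apply Ceq_parts; simpl; ring.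
Qed.

Lemma cexp_2_pi_i : cexp (2 * PI * Ci) = 1.
Proof.
  replace (2 * PI * Ci)%C with (PI * Ci + PI * Ci)%C by ring.
  rewrite cexp_plus, cexp_pi_i. ring.
Qed.

Lemma cexp_eq_m1 (v : C) : 0 <= Im v <= 2 * PI -> (1 + cexp v)%C = 0 -> v = (PI * Ci)%C.
Proof.
  intros Hi E. assert (Ip : Im (PI * Ci) = PI) by (simpl; ring). assert (P := PI_RGT_0).
  assert (E1 : cexp v = (- (1))%C).
  { replace (cexp v) with ((1 + cexp v) - 1)%C by ring. rewrite E. ring. }
  assert (Hr : forall y, Im v = y -> cos y = 1 -> False).
  { intros y Hy Hc. apply (f_equal Re) in E1. unfold cexp in E1. rewrite Hy, Hc in E1. simpl in E1.
    generalize (exp_pos (Re v)). unfold Re in *. lra. }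
  destruct (Req_EM_T (Im v) 0) as [H0|H0]; [exfalso; apply (Hr 0 H0), cos_0|].
  destruct (Req_EM_T (Im v) (2 * PI)) as [H2|H2]; [exfalso; apply (Hr _ H2), cos_2PI|].
  replace v with ((v - PI * Ci) + PI * Ci)%C by ring. rewrite (cexp_eq_1 (v - PI * Ci)); [ring| |].
  - rewrite im_minus, Ip. apply Rabs_def1; lra.
  - rewrite cexp_minus, E1, cexp_pi_i. field.
Qed.

(** The only pole inside is [PI * Ci]. Writing [1 + cexp v = (v - PI * Ci) * e v], with [e] free of
    zeros and equal to - 1 at the pole, reduces the residue to Cauchy's formula. *)
Lemma rint_bkernel s r : 0 < r ->
  rint (bkernel s) (- r) r 0 (2 * PI) = (2 * PI * Ci * cexp (- (PI * s * Ci)))%C.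
Proof.
  intros Hr. assert (P := PI_RGT_0). set (p := (PI * Ci)%C).
  assert (Rp : Re p = 0) by (simpl; ring). assert (Ip : Im p = PI) by (simpl; ring).
  set (f := fun v => (1 + cexp v)%C).
  assert (Hf : forall v, cholo f v).
  { intros v. apply cholo_plus; [apply cholo_const|apply cholo_cexp, cholo_id]. }
  assert (Hfp : f p = 0) by (unfold f, p; rewrite cexp_pi_i; ring).
  destruct (cholo_divide f p (4 * (r + 2 * PI))) as [e [E1 [E2 E3]]]; [lra|auto|].
  rewrite Hfp in E1.
  assert (Ep : e p = (- (1))%C).
  { apply (is_cderiv_unique f p _ _ E3). apply is_cderiv_eq with (0 + cexp p)%C.
    - unfold p. rewrite cexp_pi_i. ring.
    - apply is_cderiv_plus; [apply is_cderiv_const|apply is_cderiv_cexp]. }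
  assert (Nz : forall v, rect (- r) r 0 (2 * PI) v -> e v <> 0).
  { intros v [_ V2] Ev. destruct (C_eq_dec v p) as [->|Hv].
    - rewrite Ep in Ev. apply (f_equal Re) in Ev. simpl in Ev. lra.
    - apply Hv. apply cexp_eq_m1; [exact V2|]. fold (f v). rewrite E1, Ev. ring. }
  assert (Hin : forall v, rect (- r) r 0 (2 * PI) v -> cholo e v).
  { intros v [V1 V2]. apply E2. eapply Rle_lt_trans; [apply Cmod_le_parts|].
    rewrite re_minus, im_minus, Rp, Ip.
    assert (Rabs (Re v - 0) <= r) by (apply Rabs_le; lra).
    assert (Rabs (Im v - PI) <= PI) by (apply Rabs_le; lra). lra. }
  assert (Hlr : - r <= r) by lra. assert (Hud : 0 <= 2 * PI) by lra.
  rewrite (rint_ext _ _ _ _ Hlr Hud _ (fun v => cexp ((1 - s) * v) / e v / (v - p))%C).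
  - rewrite (cauchy_formula (fun v => cexp ((1 - s) * v) / e v)%C p); [|lra|lra|].
    + rewrite Ep. unfold p. replace ((1 - s) * (PI * Ci))%C with (PI * Ci + - (PI * s * Ci))%C by ring.
      rewrite cexp_plus, cexp_pi_i. field.
    + intros v Hv. apply cholo_div; [now apply Nz| |now apply Hin].
      apply cholo_cexp, cholo_mult; [apply cholo_const|apply cholo_id].
  - intros v [Hv Hb]. unfold bkernel. fold (f v). rewrite E1.
    assert (Hvp : v <> p) by (intros ->; lra).
    field. split; [now apply Nz|now apply Cminus_eq_contra].
Qed.

Lemma cint_bkernel_top s r : 0 < r ->
  cint (fun t => bkernel s (t, 2 * PI)) (- r) r
  = (cexp (- (2 * PI * s * Ci)) * cint (fun t => bkernel s (t, 0)) (- r) r)%C.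
Proof.
  intros Hr. rewrite <- cint_scal.
  - apply cint_ext; [lra|]. intros t _.
    replace ((t, 2 * PI) : C) with (RtoC t + 2 * PI * Ci)%C by (apply Ceq_parts; simpl; ring).
    change ((t, 0) : C) with (RtoC t). unfold bkernel.
    rewrite (cexp_plus t), cexp_2_pi_i, Cmult_1_r.
    replace ((1 - s) * (t + 2 * PI * Ci))%C with ((1 - s) * t + (2 * PI * Ci + - (2 * PI * s * Ci)))%C by ring.
    rewrite !cexp_plus, cexp_2_pi_i. field. apply one_plus_cexp_real_neq_0.
  - apply ex_cint_cont; [lra|]. intros t _. apply (rcont_RtoC (bkernel s)), ccont_bkernel_real.
Qed.

(** The strip [0 < Re s < 1] is what gives decay at both ends: like [exp (- Re s x)] on the right
    and like [exp (- (1 - Re s) |x|)] on the left. *)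
Lemma Cmod_bkernel_side s (x y : R) : 0 < Re s < 1 -> 1 <= Rabs x -> 0 <= y <= 2 * PI ->
  Cmod (bkernel s (x, y)) <= 2 * exp (2 * PI * Cmod s) * exp (- (Rmin (Re s) (1 - Re s) * Rabs x)).
Proof.
  intros Hs Hx Hy. set (m := Rmin (Re s) (1 - Re s)).
  assert (M1 : m <= Re s) by apply Rmin_l. assert (M2 : m <= 1 - Re s) by apply Rmin_r.
  assert (Den : exp (Rmax x 0) / 2 <= Cmod (1 + cexp (x, y))).
  { assert (E1 := exp_ineq1_le 1).
    destruct (Rle_lt_dec 0 x) as [L|L].
    - rewrite Rmax_left by exact L. rewrite Rabs_pos_eq in Hx by exact L.
      assert (A := Cmod_add_ge (cexp (x, y)) 1). rewrite Cplus_comm in A.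
      rewrite Cmod_cexp, Cmod_1 in A. simpl Re in A.
      assert (exp 1 <= exp x) by now apply exp_le_compat. lra.
    - rewrite Rmax_right, exp_0 by lra. rewrite Rabs_left in Hx by exact L.
      assert (A := Cmod_add_ge 1 (cexp (x, y))). rewrite Cmod_cexp, Cmod_1 in A. simpl Re in A.
      assert (B : exp x <= exp (- (1))) by (apply exp_le_compat; lra).
      rewrite exp_Ropp in B. assert (/ exp 1 <= / 2) by (apply Rinv_le_contravar; lra). lra. }
  assert (Pd := exp_pos (Rmax x 0)).
  unfold bkernel. rewrite Cmod_div by (apply Cmod_gt_0; lra). rewrite Cmod_cexp.
  replace (Re ((1 - s) * (x, y))) with ((1 - Re s) * x + Im s * y) by (simpl; unfold Re, Im; ring).
  apply Rle_trans with (exp ((1 - Re s) * x + Im s * y) * (2 * exp (- Rmax x 0))).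
  - apply Rmult_le_compat_l; [apply Rlt_le, exp_pos|].
    rewrite exp_Ropp. replace (2 * / exp (Rmax x 0)) with (/ (exp (Rmax x 0) / 2)) by (field; lra).
    apply Rinv_le_contravar; lra.
  - replace (exp ((1 - Re s) * x + Im s * y) * (2 * exp (- Rmax x 0)))
      with (2 * (exp ((1 - Re s) * x + Im s * y) * exp (- Rmax x 0))) by ring.
    rewrite Rmult_assoc. apply Rmult_le_compat_l; [lra|]. rewrite <- !exp_plus. apply exp_le_compat.
    assert (I : Im s * y <= 2 * PI * Cmod s).
    { generalize (im_le_Cmod s) (RRle_abs (Im s)) (Cmod_ge_0 s). nra. }
    destruct (Rle_lt_dec 0 x) as [L|L].
    + rewrite Rmax_left, Rabs_pos_eq in * by lra. nra.
    + rewrite Rmax_right, Rabs_left in * by lra. nra.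
Qed.

Lemma exp_neg_lt_1 x : x < 0 -> exp x < 1.
Proof. intros H. generalize (exp_increasing x 0 H). now rewrite exp_0. Qed.

Lemma exp_decay K m eps : 0 <= K -> 0 < m -> 0 < eps ->
  exists N, forall n, (N <= n)%nat -> K * exp (- (m * INR n)) <= eps.
Proof.
  intros HK Hm He. destruct (INR_unbounded (K / (m * eps))) as [N HN]. exists N. intros n Hn.
  assert (Hn' := le_INR _ _ Hn). rewrite exp_Ropp.
  assert (P := exp_pos (m * INR n)). assert (Q := exp_ineq1_le (m * INR n)).
  apply Rmult_le_reg_r with (exp (m * INR n)); [exact P|].
  rewrite Rmult_assoc, Rinv_l, Rmult_1_r by lra.
  assert (B : K <= eps * (m * INR n)).
  { apply Rmult_le_reg_r with (/ (m * eps)); [apply Rinv_0_lt_compat; nra|].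
    replace (eps * (m * INR n) * / (m * eps)) with (INR n) by (field; split; lra). unfold Rdiv in HN. lra. }
  nra.
Qed.

Lemma V_decay s : Re s < 1 -> exists K, 0 <= K /\ forall n, (1 <= n)%nat ->
  Cmod (V s (RtoC (- INR n))) <= K * exp (- ((1 - Re s) * INR n)).
Proof.
  intros Hs. set (q := exp (- (1))).
  assert (Hq : 0 <= q < 1).
  { split; [apply Rlt_le, exp_pos|]. apply exp_neg_lt_1. lra. }
  destruct (summable_geom q Hq) as [_ [B HB]].
  assert (B0 : 0 <= B) by apply (HB O).
  exists (B / (1 - Re s)). split; [apply Rdiv_le_0_compat; lra|]. intros n Hn.
  assert (Hn' : 1 <= INR n) by (apply (le_INR 1); exact Hn).
  set (c := exp (- ((1 - Re s) * INR n)) / (1 - Re s)).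
  assert (Hc : 0 <= c) by (apply Rdiv_le_0_compat; [apply Rlt_le, exp_pos|lra]).
  replace (B / (1 - Re s) * exp (- ((1 - Re s) * INR n))) with (c * B) by (unfold c; field; lra).
  apply Cmod_Csum_le with (fun k => c * q ^ k).
  - intros k. eapply Rle_trans; [now apply vterm_le|]. rewrite !Cmod_cexp.
    replace (Re ((1 - s) * RtoC (- INR n))) with (- ((1 - Re s) * INR n)) by (simpl; unfold Re; ring).
    rewrite re_RtoC. fold c. apply Rmult_le_compat_l; [exact Hc|]. apply pow_incr.
    split; [apply Rlt_le, exp_pos|]. apply exp_le_compat. lra.
  - now apply summable_vbound.
  - intros k. rewrite rsum_scal. now apply Rmult_le_compat_l.
Qed.

Lemma U_decay s : 0 < Re s -> exists K, 0 <= K /\ forall n, (1 <= n)%nat ->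
  Cmod (U s (softplus (INR n))) <= K * exp (- (Re s * INR n)).
Proof.
  intros Hs. set (q := exp (- (1))).
  assert (Hq : 0 <= q < 1).
  { split; [apply Rlt_le, exp_pos|]. apply exp_neg_lt_1. lra. }
  assert (Sb := summable_rbin (Cmod s) q (Cmod_ge_0 s) Hq).
  destruct Sb as [Sb0 [B HB]]. assert (B0 : 0 <= B) by apply (HB O).
  exists (B / Re s). split; [apply Rdiv_le_0_compat; lra|]. intros n Hn.
  assert (Hn' : 1 <= INR n) by (apply (le_INR 1); exact Hn).
  set (c := exp (- (Re s * INR n)) / Re s).
  assert (Hc : 0 <= c) by (apply Rdiv_le_0_compat; [apply Rlt_le, exp_pos|lra]).
  replace (B / Re s * exp (- (Re s * INR n))) with (c * B) by (unfold c; field; lra).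
  destruct (softplus_ge (INR n)) as [_ L].
  apply Cmod_Csum_le with (fun k => c * (rbin (Cmod s) k * q ^ k)).
  - intros k. rewrite Cmod_div by now apply s_plus_INR_neq_0.
    rewrite uterm_pow, !Cmod_mult, Cmod_pow, !Cmod_cexp, softplus_real.
    set (l := ln (1 + exp (INR n))) in *.
    replace (Re (- (s * l))) with (- (Re s * l)) by (simpl; unfold Re; ring).
    replace (Re (- l)) with (- l) by reflexivity.
    unfold c. unfold Rdiv. rewrite Rmult_assoc, (Rmult_comm _ (/ Cmod _)), <- Rmult_assoc.
    apply Rmult_le_compat.
    + apply Rmult_le_pos; [apply Rlt_le, exp_pos|].
      apply Rlt_le, Rinv_0_lt_compat. generalize (Cmod_s_plus_INR s k Hs). lra.
    + apply Rmult_le_pos; [apply Cmod_ge_0|apply pow_le, Rlt_le, exp_pos].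
    + apply Rmult_le_compat; [apply Rlt_le, exp_pos| | |].
      * apply Rlt_le, Rinv_0_lt_compat. generalize (Cmod_s_plus_INR s k Hs). lra.
      * apply exp_le_compat. nra.
      * apply Rinv_le_contravar; [exact Hs|now apply Cmod_s_plus_INR].
    + apply Rmult_le_compat; [apply Cmod_ge_0|apply pow_le, Rlt_le, exp_pos|apply Cmod_cbin_le|].
      apply pow_incr. split; [apply Rlt_le, exp_pos|]. apply exp_le_compat. lra.
  - apply summable_scal; [exact Hc|]. split; [exact Sb0|now exists B].
  - intros k. rewrite rsum_scal. now apply Rmult_le_compat_l.
Qed.

(** The horizontal sides give the factor [1 - exp (- 2 PI s Ci)] times the integral over the real
    line. That line is cut at - 2, with primitive [V] on the left and [- U] composed with [softplus]
    on the right. The vertical sides and the values at the far ends decay exponentially. *)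
Lemma bkernel_contour s : 0 < Re s < 1 ->
  ((1 - cexp (- (2 * PI * s * Ci))) * (U s (softplus (RtoC (- (2)))) + V s (RtoC (- (2))))
   = 2 * PI * Ci * cexp (- (PI * s * Ci)))%C.
Proof.
  intros Hs. assert (P := PI_RGT_0).
  destruct (V_decay s ltac:(lra)) as [K1 [HK1 D1]]. destruct (U_decay s ltac:(lra)) as [K2 [HK2 D2]].
  set (E2 := cexp (- (2 * PI * s * Ci))). set (A := (U s (softplus (RtoC (- (2)))) + V s (RtoC (- (2))))%C).
  set (m := Rmin (Re s) (1 - Re s)). assert (Hm : 0 < m) by (apply Rmin_glb_lt; lra).
  set (K3 := 2 * exp (2 * PI * Cmod s)). assert (HK3 : 0 < K3) by (unfold K3; generalize (exp_pos (2 * PI * Cmod s)); lra).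
  set (K := Cmod (1 - E2) * (K1 + K2) + 8 * PI * K3).
  assert (HK : 0 <= K).
  { unfold K. apply Rplus_le_le_0_compat; [apply Rmult_le_pos; [apply Cmod_ge_0|lra]|nra]. }
  symmetry. apply eq_of_Cmod_small. intros eps He.
  destruct (exp_decay K m eps HK Hm He) as [N HN].
  set (n := Nat.max N 3). specialize (HN n ltac:(lia)).
  assert (Hn : 3 <= INR n) by (replace 3 with (INR 3) by (simpl; ring); apply le_INR; lia).
  eapply Rle_trans; [|exact HN].
  assert (Hr : 0 < INR n) by lra.
  assert (C1 := rint_bkernel s (INR n) Hr). unfold rint in C1.
  rewrite cint_bkernel_top in C1 by exact Hr. fold E2 in C1.
  assert (C2 : cint (fun t => bkernel s (t, 0)) (- INR n) (INR n)
     = (A - V s (RtoC (- INR n)) - U s (softplus (INR n)))%C).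
  { change (fun t : R => bkernel s (t, 0)) with (fun t : R => bkernel s (RtoC t)).
    rewrite (cint_Chasles _ _ (- (2)) _); [|lra|].
    - rewrite cint_bkernel_left, cint_bkernel_right by lra. unfold A. ring.
    - apply ex_cint_cont; [lra|]. intros t _. apply rcont_RtoC, ccont_bkernel_real. }
  rewrite C2 in C1. rewrite <- C1.
  assert (Sd : forall x, x = INR n \/ x = - INR n ->
    Cmod (cint (fun t => bkernel s (x, t)) 0 (2 * PI)) <= 2 * (K3 * exp (- (m * INR n))) * (2 * PI - 0)).
  { intros x Hx. assert (Hax : Rabs x = INR n).
    { destruct Hx as [->| ->]; [|rewrite Rabs_Ropp]; apply Rabs_pos_eq; lra. }
    apply cint_norm_le; [lra| |].
    - apply ex_cint_cont; [lra|]. intros t Ht. apply rcont_vertical, cholo_cont, cholo_bkernel.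
      intros Z. apply cexp_eq_m1 in Z; [|exact Ht]. apply (f_equal Re) in Z.
      replace (Re (PI * Ci)) with 0 in Z by (simpl; ring). simpl in Z. subst x.
      rewrite Rabs_R0 in Hax. lra.
    - intros t Ht. rewrite <- Hax. apply Cmod_bkernel_side; [exact Hs|lra|exact Ht]. }
  assert (S1 := Sd (INR n) (or_introl eq_refl)). assert (S2 := Sd (- INR n) (or_intror eq_refl)).
  set (J1 := cint (fun t => bkernel s (INR n, t)) 0 (2 * PI)) in *.
  set (J2 := cint (fun t => bkernel s (- INR n, t)) 0 (2 * PI)) in *.
  replace (A - V s (RtoC (- INR n)) - U s (softplus (INR n))
      - E2 * (A - V s (RtoC (- INR n)) - U s (softplus (INR n))) + Ci * (J1 - J2) - (1 - E2) * A)%C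
    with (- ((1 - E2) * (V s (RtoC (- INR n)) + U s (softplus (INR n)))) + Ci * (J1 - J2))%C by ring.
  eapply Rle_trans; [apply Cmod_triangle|]. rewrite Cmod_opp, !Cmod_mult, Cmod_Ci, Rmult_1_l.
  assert (T1 := Cmod_triangle (V s (RtoC (- INR n))) (U s (softplus (INR n)))).
  assert (T2 := Cmod_sub_le J1 J2).
  specialize (D1 n ltac:(lia)). specialize (D2 n ltac:(lia)).
  assert (X1 : exp (- ((1 - Re s) * INR n)) <= exp (- (m * INR n))).
  { apply exp_le_compat. generalize (Rmin_r (Re s) (1 - Re s)). fold m. nra. }
  assert (X2 : exp (- (Re s * INR n)) <= exp (- (m * INR n))).
  { apply exp_le_compat. generalize (Rmin_l (Re s) (1 - Re s)). fold m. nra. }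
  set (X := exp (- (m * INR n))) in *.
  assert (X3 : Cmod (V s (RtoC (- INR n)) + U s (softplus (INR n))) <= (K1 + K2) * X) by nra.
  assert (X4 : Cmod (1 - E2) * Cmod (V s (RtoC (- INR n)) + U s (softplus (INR n))) <= Cmod (1 - E2) * ((K1 + K2) * X)).
  { apply Rmult_le_compat_l; [apply Cmod_ge_0|exact X3]. }
  unfold K. nra.
Qed.

(** Euler's reflection formula, in the form [B(s, 1 - s) = PI / sin (PI s)] with the
    beta integral cut at [exp (ell l)]. *)
Lemma reflection s l : 0 < Re s < 1 -> 0 < Re l -> Cmod l <= 1 / 4 ->
  (U s l + V s (ell l) = PI / csin (PI * s))%C.
Proof.
  intros Hs Hl Hl4. assert (H := bkernel_contour s Hs).
  (* The cut - 2 was chosen for [ln (1 + exp (- 2)) <= exp (- 2) <= 1 / 4], which is within the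
     range of [U_V_const]. *)
  assert (Hsp : 0 < Re (softplus (RtoC (- (2)))) /\ Cmod (softplus (RtoC (- (2)))) <= 1 / 4).
  { rewrite softplus_real, re_RtoC, Cmod_R. destruct (softplus_ge (- (2))) as [S1 _].
    rewrite Rabs_pos_eq by lra. split; [exact S1|].
    assert (L : ln (1 + exp (- (2))) <= exp (- (2))).
    { rewrite <- (ln_exp (exp (- (2)))) at 2. apply ln_le; [generalize (exp_pos (- (2))); lra|apply exp_ineq1_le]. }
    assert (E1 := exp_ineq1_le 1). assert (E2 : exp 2 = exp 1 * exp 1) by (rewrite <- exp_plus; f_equal; ring).
    rewrite exp_Ropp in L at 2. assert (/ exp 2 <= / 4) by (apply Rinv_le_contravar; nra). lra. }
  rewrite (U_V_const s l (softplus (RtoC (- (2))))) by tauto.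
  rewrite ell_softplus. set (A := (U s (softplus (RtoC (- (2)))) + V s (RtoC (- (2))))%C) in *.
  unfold csin. change Defs.Ci with Ci.
  set (E := cexp (- (PI * s * Ci))) in *.
  assert (HE : E <> 0) by apply cexp_neq_0.
  replace (cexp (- (2 * PI * s * Ci))) with (E * E)%C in H
    by (unfold E; rewrite <- cexp_plus; f_equal; ring).
  replace (cexp (- (Ci * (PI * s)))) with E by (unfold E; f_equal; ring).
  replace (cexp (Ci * (PI * s))) with (/ E)%C by (unfold E; rewrite <- cexp_opp; f_equal; ring).
  (* Otherwise the contour identity would read [0 = 2 PI Ci E]; so the sine needs no separate study
     of its zeros. *)
  assert (N : (1 - E * E)%C <> 0).
  { intros Z. rewrite Z, Cmult_0_l in H. symmetry in H. revert H.
    apply Cmult_neq_0; [apply two_pi_i_neq_0|exact HE]. }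
  assert (A1 : A = (2 * PI * Ci * E / (1 - E * E))%C) by (rewrite <- H; field; exact N).
  rewrite A1. field. repeat split; try exact N; try exact HE; try apply Ci_nz.
Qed.

(** * Gregory's expansion of [1 / (1 - exp (- u)) - 1 / u] in powers of [1 - exp (- u)] *)

Definition vdiff (u : C) : C := (1 - cexp (- u))%C.

Lemma is_cderiv_vdiff u : is_cderiv vdiff u (cexp (- u)).
Proof.
  apply is_cderiv_ext with (fun w => 1 + - (1) * cexp (0 + w * - (1)))%C.
  { intros w. unfold vdiff. replace (0 + w * - (1))%C with (- w)%C by ring. ring. }
  eapply is_cderiv_eq; [|apply is_cderiv_plus; [apply is_cderiv_const|apply is_cderiv_mult;
    [apply is_cderiv_const|apply (is_cderiv_cexp_comp (fun w => 0 + w * - (1))%C), is_cderiv_affine]]].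
  cbv beta. replace (0 + u * - (1))%C with (- u)%C by ring. ring.
Qed.

Lemma vdiff_neq_0 u : Rabs (Im u) < PI -> u <> 0 -> vdiff u <> 0.
Proof.
  intros Hi Hu E. apply Hu. replace u with (- - u)%C by ring. rewrite (cexp_eq_1 (- u)).
  - ring.
  - now rewrite im_opp, Rabs_Ropp.
  - replace (cexp (- u)) with (1 - vdiff u)%C by (unfold vdiff; ring). rewrite E. ring.
Qed.

Lemma Im_small_lt_PI u : Cmod u < 1 -> Rabs (Im u) < PI.
Proof. intros H. generalize (im_le_Cmod u) PI2_1. lra. Qed.

Lemma vdiff_0 : vdiff 0 = 0.
Proof. unfold vdiff. replace (- 0)%C with (RtoC 0) by ring. rewrite cexp_0. ring. Qed.

Lemma gregory_local m : exists (a : nat -> C) (g : C -> C),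
  (forall u, Cmod u < 1 -> cholo g u) /\
  forall u : C, u <> 0 -> Cmod u < 1 ->
    (/ vdiff u - / u = csum (fun j => a j * vdiff u ^ j) m + vdiff u ^ m * g u)%C.
Proof.
  assert (S0 : forall w, (w - 0)%C = w) by (intros; ring).
  destruct (cholo_divide vdiff 0 1 Rlt_0_1) as [e [E1 [E2 E3]]].
  { intros w _. eexists. apply is_cderiv_vdiff. }
  rewrite vdiff_0 in E1.
  assert (E : forall w, vdiff w = (w * e w)%C) by (intros w; rewrite E1, S0; ring).
  assert (Ee0 : e 0 = 1).
  { apply (is_cderiv_unique vdiff 0 _ _ E3). apply is_cderiv_eq with (cexp (- 0)); [|apply is_cderiv_vdiff].
    replace (- 0)%C with (RtoC 0) by ring. apply cexp_0. }
  assert (Nz : forall w, Cmod w < 1 -> e w <> 0).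
  { intros w Hw Ew. destruct (C_eq_dec w 0) as [->|Hne].
    - rewrite Ee0 in Ew. apply RtoC_inj in Ew. lra.
    - apply (vdiff_neq_0 w); [now apply Im_small_lt_PI|exact Hne|]. rewrite E, Ew. ring. }
  assert (He : forall w, Cmod w < 1 -> cholo e w) by (intros w Hw; apply E2; now rewrite S0).
  induction m as [|m IH].
  - destruct (cholo_divide (fun w => / e w)%C 0 1 Rlt_0_1) as [g [G1 [G2 _]]].
    { intros w Hw. rewrite S0 in Hw. apply cholo_inv; auto. }
    exists (fun _ => 0), g. split; [intros u Hu; apply G2; now rewrite S0|].
    intros u Hu0 Hu. simpl. rewrite Cmult_1_l, Cplus_0_l, E.
    assert (N := Nz u Hu). specialize (G1 u). rewrite Ee0, S0 in G1.
    replace (/ (u * e u) - / u)%C with ((/ e u - 1) / u)%C by (field; auto).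
    rewrite G1. field. exact Hu0.
  - destruct IH as [a [g [G1 G2]]].
    destruct (cholo_divide g 0 1 Rlt_0_1) as [k [K1 [K2 _]]].
    { intros w Hw. rewrite S0 in Hw. auto. }
    exists (fun j => if Nat.eqb j m then g 0 else a j), (fun w => k w / e w)%C. split.
    { intros u Hu. apply cholo_div; auto. apply K2. now rewrite S0. }
    intros u Hu0 Hu. rewrite (G2 u Hu0 Hu). cbn [csum]. rewrite Nat.eqb_refl.
    rewrite (csum_ext (fun j => (if Nat.eqb j m then g 0 else a j) * vdiff u ^ j)%C (fun j => a j * vdiff u ^ j)%C).
    2: { intros j Hj. replace (Nat.eqb j m) with false; [reflexivity|].
      symmetry. apply Nat.eqb_neq. lia. }
    rewrite (K1 u), S0. generalize (csum (fun j => a j * vdiff u ^ j)%C m). intros c.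
    change (vdiff u ^ S m)%C with (vdiff u * vdiff u ^ m)%C.
    generalize (vdiff u ^ m)%C. intros b. rewrite E.
    assert (N := Nz u Hu). field. exact N.
Qed.

Definition gregory_rem (a : nat -> C) (m : nat) (u : C) : C :=
  (/ vdiff u - / u - csum (fun j => a j * vdiff u ^ j) m)%C.

(** The local expansion covers [|u| < 4 d]. In the rest of the half-strip [Re u >= 3 d], where every
    term is bounded and [|u|^m] is bounded below. All frequencies [(s + r) L] lie in this half-strip
    once [L |s| <= d]. *)
Lemma gregory m : exists (a : nat -> C) (K d : R), 0 <= K /\ 0 < d <= 1 / 16 /\
  forall u : C, u <> 0 -> Rabs (Im u) <= d -> - d <= Re u ->
    Cmod (gregory_rem a m u) <= K * Cmod u ^ m.
Proof.
  destruct (gregory_local m) as [a [g [G1 G2]]].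
  assert (Hg0 : ccont g 0) by (apply cholo_cont, G1; rewrite Cmod_0; lra).
  destruct (ccont_bounded g 0 Hg0) as [d0 [Hd0 Bg]].
  set (Kg := Cmod (g 0) + 1) in *. assert (HKg : 0 < Kg) by (unfold Kg; generalize (Cmod_ge_0 (g 0)); lra).
  set (d := Rmin d0 (1/4) / 4).
  assert (Hd : 0 < d) by (unfold d; generalize (Rmin_glb_lt d0 (1/4) 0 Hd0 ltac:(lra)); lra).
  assert (Hd1 : 4 * d <= d0) by (unfold d; generalize (Rmin_l d0 (1/4)); lra).
  assert (Hd2 : 4 * d <= 1 / 4) by (unfold d; generalize (Rmin_r d0 (1/4)); lra).
  set (k := 1 - exp (- (3 * d))).
  assert (Hk : 0 < k) by (unfold k; generalize (exp_neg_lt_1 (- (3 * d))); lra).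
  set (A := rsum (fun j => Cmod (a j) * 2 ^ j) m).
  assert (HA : 0 <= A).
  { unfold A. apply (rsum_mono _ 0 m); [|lia]. intros j. apply Rmult_le_pos; [apply Cmod_ge_0|apply pow_le; lra]. }
  set (D := (/ k + / (4 * d) + A) / (4 * d) ^ m).
  assert (Hdm : 0 < (4 * d) ^ m) by (apply pow_lt; lra).
  assert (Hs : 0 <= / k + / (4 * d) + A).
  { assert (0 < / k) by now apply Rinv_0_lt_compat. assert (0 < / (4 * d)) by (apply Rinv_0_lt_compat; lra). lra. }
  assert (HD : 0 <= D) by (apply Rdiv_le_0_compat; assumption).
  assert (H3 : 0 < 3 ^ m) by (apply pow_lt; lra).
  exists a, (3 ^ m * Kg + D), d. split; [nra|]. split; [lra|].
  intros u Hu0 Hi Hr. assert (Hum : 0 <= Cmod u ^ m) by apply pow_le, Cmod_ge_0.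
  unfold gregory_rem. destruct (Rlt_le_dec (Cmod u) (4 * d)) as [L|L].
  - rewrite (G2 u Hu0) by lra.
    match goal with |- Cmod (?x + ?y - ?x) <= _ => replace (x + y - x)%C with y by ring end.
    rewrite Cmod_mult, Cmod_pow.
    assert (V : Cmod (vdiff u) <= 3 * Cmod u).
    { unfold vdiff. rewrite Cmod_sub_sym, <- (Cmod_opp u). apply cexp_sub_1_le. rewrite Cmod_opp. lra. }
    assert (V' : Cmod (vdiff u) ^ m <= 3 ^ m * Cmod u ^ m).
    { rewrite <- Rpow_mult_distr. apply pow_incr. split; [apply Cmod_ge_0|exact V]. }
    assert (B : Cmod (g u) <= Kg) by (apply Bg; replace (u - 0)%C with u by ring; lra).
    apply Rle_trans with (3 ^ m * Cmod u ^ m * Kg).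
    + apply Rmult_le_compat; auto using Cmod_ge_0. apply pow_le, Cmod_ge_0.
    + nra.
  - assert (Hre : 3 * d <= Re u).
    { assert (P := Cmod_le_parts u). unfold Rabs in P at 1. destruct (Rcase_abs (Re u)); lra. }
    assert (Ce : Cmod (cexp (- u)) <= exp (- (3 * d))).
    { rewrite Cmod_cexp, re_opp. apply exp_le_compat. lra. }
    assert (V1 : k <= Cmod (vdiff u)).
    { unfold vdiff, k. generalize (Cmod_sub_ge 1 (cexp (- u))). rewrite Cmod_1. lra. }
    assert (V2 : Cmod (vdiff u) <= 2).
    { unfold vdiff. generalize (Cmod_sub_le 1 (cexp (- u))). rewrite Cmod_1.
      generalize (exp_neg_lt_1 (- (3 * d))). lra. }
    apply Rle_trans with (/ k + / (4 * d) + A).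
    + eapply Rle_trans; [apply Cmod_sub_le|]. apply Rplus_le_compat.
      * eapply Rle_trans; [apply Cmod_sub_le|]. rewrite !Cmod_inv.
        -- apply Rplus_le_compat; apply Rinv_le_contravar; lra.
        -- exact Hu0.
        -- apply Cmod_gt_0. lra.
      * unfold A. clear - V2. induction m as [|m IH]; simpl; [rewrite Cmod_0; lra|].
        eapply Rle_trans; [apply Cmod_triangle|]. apply Rplus_le_compat; [exact IH|].
        rewrite Cmod_mult, Cmod_pow. apply Rmult_le_compat_l; [apply Cmod_ge_0|].
        apply pow_incr. split; [apply Cmod_ge_0|exact V2].
    + assert (E : / k + / (4 * d) + A = D * (4 * d) ^ m) by (unfold D; field; lra).
      rewrite E. apply Rle_trans with (D * Cmod u ^ m).
      * apply Rmult_le_compat_l; [exact HD|]. apply pow_incr. lra.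
      * apply Rmult_le_compat_r; [exact Hum|]. generalize (Rmult_lt_0_compat _ _ H3 HKg). lra.
Qed.

(** * Bounds for binomial coefficients *)

Lemma cbin_shift' s n : (cbin s n * (s + INR n))%C = (s * cbin (s + 1) n)%C.
Proof.
  rewrite <- cbin_shift, cbin_S. field. apply RtoC_INR_S_neq_0.
Qed.

(** Each factor [s + n] raises the parameter by one, through [cbin_shift']; the sign condition
    ensures [|s + n| <= |s + 1 + n|]. *)
Lemma cbin_shift_le s n m : 0 <= Re s + INR n ->
  Cmod (cbin s n) * Cmod (s + INR n) ^ m <= (Cmod s + INR m) ^ m * Cmod (cbin (s + INR m) n).
Proof.
  revert s. induction m as [|m IH]; intros s Hs.
  - simpl. replace (s + 0)%C with s by ring. lra.
  - replace (Cmod (cbin s n) * Cmod (s + INR n) ^ S m)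
      with (Cmod (cbin s n * (s + INR n)) * Cmod (s + INR n) ^ m) by (rewrite Cmod_mult; simpl; ring).
    rewrite cbin_shift', Cmod_mult.
    assert (Hs1 : 0 <= Re (s + 1) + INR n) by (rewrite re_plus, re_RtoC; lra).
    assert (A : Cmod (s + INR n) <= Cmod (s + 1 + INR n)).
    { unfold Cmod. apply sqrt_le_1_alt. destruct s as [x y]. simpl in *. nra. }
    assert (B := Cmod_triangle s 1). rewrite Cmod_1 in B.
    assert (Sm : INR (S m) = INR m + 1) by apply S_INR. assert (M0 := pos_INR m).
    specialize (IH (s + 1)%C Hs1).
    replace (s + 1 + INR m)%C with (s + INR (S m))%C in IH by (rewrite Sm, RtoC_plus; ring).
    apply Rle_trans with (Cmod s * ((Cmod (s + 1) + INR m) ^ m * Cmod (cbin (s + INR (S m)) n))).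
    + rewrite Rmult_assoc. apply Rmult_le_compat_l; [apply Cmod_ge_0|]. eapply Rle_trans; [|exact IH].
      apply Rmult_le_compat_l; [apply Cmod_ge_0|]. apply pow_incr. split; [apply Cmod_ge_0|exact A].
    + rewrite <- Rmult_assoc. apply Rmult_le_compat_r; [apply Cmod_ge_0|].
      change ((Cmod s + INR (S m)) ^ S m) with ((Cmod s + INR (S m)) * (Cmod s + INR (S m)) ^ m).
      apply Rmult_le_compat; [apply Cmod_ge_0| | |].
      * apply pow_le. generalize (Cmod_ge_0 (s + 1)). lra.
      * rewrite Sm. generalize (Cmod_ge_0 s). lra.
      * apply pow_incr. generalize (Cmod_ge_0 (s + 1)). lra.
Qed.

Lemma Cmod_le_Re_correction (s : C) : 0 < Re s -> Cmod s <= Re s * exp (Im s * Im s / (2 * (Re s * Re s))).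
Proof.
  intros H. set (t := Im s * Im s / (2 * (Re s * Re s))).
  assert (T : Re s * Re s * (2 * t) = Im s * Im s) by (unfold t; field; lra).
  assert (T0 : 0 <= t) by (apply Rdiv_le_0_compat; nra).
  apply Rle_trans with (Re s * (1 + t)); [|apply Rmult_le_compat_l; [lra|apply exp_ineq1_le]].
  assert (Hm := Cmod2_alt s). assert (0 <= Cmod s) by apply Cmod_ge_0.
  apply Rsqr_incr_0_var; [unfold Rsqr; nra|nra].
Qed.

(** The cruder [Cmod_cbin_le] has [Cmod s] in place of [Re s], which would leave a negative power of
    [L] in the remainder. Replacing [|s + k|] by [Re s + k] costs a factor
    [exp (O(1 / (Re s + k)^2))], and the product of these stays bounded. *)
Lemma Cmod_cbin_Re_le s n : 1 <= Re s -> Cmod (cbin s n) <= exp (Im s * Im s) * rbin (Re s) n.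
Proof.
  intros Hs. set (t := Im s * Im s). assert (T0 : 0 <= t) by (unfold t; nra).
  (* [1 - 1 / (n + 1)] sums the telescoping terms [1 / ((k + 1) (k + 2))], each of which dominates
     [1 / (2 (Re s + k)^2)] since [Re s >= 1]. *)
  assert (K : Cmod (cbin s n) <= exp (t * (1 - / INR (S n))) * rbin (Re s) n).
  { induction n as [|n IH].
    - simpl. rewrite Cmod_1, Rinv_1. replace (t * (1 - 1)) with 0 by ring. rewrite exp_0. lra.
    - rewrite cbin_S, rbin_S. rewrite Cmod_div by apply RtoC_INR_S_neq_0.
      rewrite Cmod_mult, Cmod_R, (Rabs_pos_eq (INR (S n))) by apply pos_INR.
      assert (N0 := pos_INR n). assert (N1 := INR_S_pos n). assert (N2 := INR_S_pos (S n)).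
      assert (A : Cmod (s + INR n) <= (Re s + INR n) * exp (t * (/ INR (S n) - / INR (S (S n))))).
      { assert (Rp : Re (s + INR n) = Re s + INR n) by (rewrite re_plus, re_RtoC; reflexivity).
        assert (Ip : Im (s + INR n) = Im s) by (rewrite im_plus, im_RtoC; ring).
        eapply Rle_trans; [apply Cmod_le_Re_correction; rewrite Rp; lra|]. rewrite Rp, Ip.
        apply Rmult_le_compat_l; [lra|]. apply exp_le_compat. fold t. unfold Rdiv.
        apply Rmult_le_compat_l; [exact T0|]. rewrite !S_INR in *.
        replace (/ (INR n + 1) - / (INR n + 1 + 1)) with (/ ((INR n + 1) * (INR n + 1 + 1))) by (field; lra).
        apply Rinv_le_contravar; nra. }
      apply Rle_trans with ((exp (t * (1 - / INR (S n))) * rbin (Re s) n)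
         * ((Re s + INR n) * exp (t * (/ INR (S n) - / INR (S (S n))))) / INR (S n)).
      + apply Rmult_le_compat_r; [apply Rlt_le, Rinv_0_lt_compat, N1|].
        apply Rmult_le_compat; try apply Cmod_ge_0; assumption.
      + right. replace (t * (1 - / INR (S (S n)))) with (t * (1 - / INR (S n)) + t * (/ INR (S n) - / INR (S (S n)))) by ring.
        rewrite exp_plus. field. lra. }
  eapply Rle_trans; [exact K|]. apply Rmult_le_compat_r; [apply rbin_nonneg; lra|]. apply exp_le_compat.
  assert (0 < / INR (S n)) by apply Rinv_0_lt_compat, INR_S_pos. nra.
Qed.

Lemma rbin_ge_1 a n : 1 <= a -> 1 <= rbin a n.
Proof.
  intros Ha. induction n as [|n IH]; [simpl; lra|]. rewrite rbin_S.
  assert (N0 := pos_INR n). assert (N1 := INR_S_pos n).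
  apply Rmult_le_reg_r with (INR (S n)); [exact N1|].
  unfold Rdiv. rewrite Rmult_assoc, Rinv_l, Rmult_1_r by lra. rewrite S_INR. nra.
Qed.

(** For [n >= m] the weight is absorbed by shifting the parameter to [s + m], whose real part is at
    least 1. The finitely many smaller [n] are covered by [K2], because [rbin (Re s + m) n >= 1]. *)
Lemma cbin_weight (S0 : R) (m : nat) : 0 <= S0 -> exists K, 0 <= K /\ forall s n,
  Cmod s <= S0 -> 1 <= Re s + INR m ->
  Cmod (cbin s n) * Cmod (s + INR n) ^ m <= K * rbin (Re s + INR m) n.
Proof.
  intros HS. set (K2 := rsum (fun n => rbin S0 n * (S0 + INR n) ^ m) m).
  assert (P2 : forall n, 0 <= rbin S0 n * (S0 + INR n) ^ m).
  { intros n. apply Rmult_le_pos; [now apply rbin_nonneg|]. apply pow_le. generalize (pos_INR n). lra. }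
  assert (HK2 : 0 <= K2) by (apply (rsum_mono _ 0 m P2); lia).
  set (K1 := (S0 + INR m) ^ m * exp (S0 * S0)).
  assert (HK1 : 0 <= K1).
  { apply Rmult_le_pos; [apply pow_le; generalize (pos_INR m); lra|apply Rlt_le, exp_pos]. }
  exists (K1 + K2). split; [lra|]. intros s n Hs Ha.
  assert (R1 := rbin_ge_1 _ n Ha).
  destruct (Nat.le_gt_cases m n) as [L|L].
  - assert (L' := le_INR _ _ L).
    eapply Rle_trans; [apply cbin_shift_le; lra|].
    assert (Rp : Re (s + INR m) = Re s + INR m) by (rewrite re_plus, re_RtoC; reflexivity).
    assert (Ip : Im (s + INR m) = Im s) by (rewrite im_plus, im_RtoC; ring).
    assert (B := Cmod_cbin_Re_le (s + INR m) n). rewrite Rp, Ip in B. specialize (B Ha).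
    apply Rle_trans with (K1 * rbin (Re s + INR m) n); [|nra].
    unfold K1. rewrite Rmult_assoc. apply Rmult_le_compat; [| apply Cmod_ge_0| |].
    + apply pow_le. generalize (pos_INR m) (Cmod_ge_0 s). lra.
    + apply pow_incr. generalize (pos_INR m) (Cmod_ge_0 s). lra.
    + eapply Rle_trans; [exact B|]. apply Rmult_le_compat_r; [lra|]. apply exp_le_compat.
      assert (I := im_le_Cmod s).
      assert (Q : Im s * Im s = Rabs (Im s) * Rabs (Im s)) by (rewrite <- Rabs_mult; symmetry; apply Rabs_pos_eq; nra).
      rewrite Q. generalize (Rabs_pos (Im s)). nra.
  - apply Rle_trans with (rbin S0 n * (S0 + INR n) ^ m).
    + apply Rmult_le_compat; [apply Cmod_ge_0|apply pow_le, Cmod_ge_0| |].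
      * eapply Rle_trans; [apply Cmod_cbin_le|]. apply rbin_mono. generalize (Cmod_ge_0 s). lra.
      * apply pow_incr. split; [apply Cmod_ge_0|]. eapply Rle_trans; [apply Cmod_triangle|].
        rewrite Cmod_R, Rabs_pos_eq by apply pos_INR. lra.
    + assert (Q : rbin S0 n * (S0 + INR n) ^ m <= K2).
      { assert (A := rsum_mono (fun n => rbin S0 n * (S0 + INR n) ^ m) (S n) m P2 ltac:(lia)).
        assert (B := rsum_mono (fun n => rbin S0 n * (S0 + INR n) ^ m) 0 n P2 ltac:(lia)).
        simpl in A, B. unfold K2. lra. }
      nra.
Qed.

Lemma rsum_rbin_le a q n : 0 <= a -> 0 <= q < 1 ->
  rsum (fun k => rbin a k * q ^ k) n <= exp (- (a * ln (1 - q))).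
Proof.
  intros Ha Hq. apply le_epsilon. intros eps He.
  assert (Hc : Cmod (RtoC q) < 1) by (rewrite Cmod_R, Rabs_pos_eq; lra).
  destruct (binomial_series (RtoC a) (RtoC q) Hc eps He) as [N HN].
  specialize (HN (Nat.max N n) ltac:(lia)).
  rewrite (csum_ext _ (fun k => RtoC (rbin a k * q ^ k))) in HN.
  2: { intros k _. now rewrite cbin_RtoC, RtoC_mult, RtoC_pow. }
  rewrite csum_RtoC, <- RtoC_minus, Clog_RtoC, <- RtoC_mult, <- RtoC_opp, cexp_RtoC, <- RtoC_minus, Cmod_R in HN by lra.
  apply Rabs_def2 in HN.
  assert (M := rsum_mono (fun k => rbin a k * q ^ k) n (Nat.max N n)).
  assert (P : forall k, 0 <= rbin a k * q ^ k).
  { intros k. apply Rmult_le_pos; [now apply rbin_nonneg|apply pow_le; lra]. }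
  specialize (M P ltac:(lia)). lra.
Qed.

(** * The remainder of Gregory's formula *)

(** When [s] is a nonpositive integer, some [(s + r) L] is 0 and [gregory_rem] divides by zero; the
    value 0 is the limit there, by the bound [K |u|^m]. *)
Definition brem (a : nat -> C) (m : nat) (u : C) : C :=
  if C_eq_dec u 0 then 0 else gregory_rem a m u.

Definition rterm (a : nat -> C) (m : nat) (L : R) (y s : C) (r : nat) : C :=
  (uterm s r (L * y) * brem a m ((s + INR r) * L))%C.

Definition rem (a : nat -> C) (m : nat) (L : R) (y s : C) : C := Csum (rterm a m L y s).

Definition prefactor (q : R) (z s : C) : C := cexp (s * (ln (1 - q) + (1 - z) * ln q)).

Section Remainder.
Variables (a : nat -> C) (m : nat) (K d : R).
Hypothesis HK : 0 <= K.
Hypothesis Hd : 0 < d <= 1 / 16.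
Hypothesis Hm : (2 <= m)%nat.
Hypothesis Hg : forall u : C, u <> 0 -> Rabs (Im u) <= d -> - d <= Re u ->
  Cmod (gregory_rem a m u) <= K * Cmod u ^ m.

Lemma brem_le u : Rabs (Im u) <= d -> - d <= Re u -> Cmod (brem a m u) <= K * Cmod u ^ m.
Proof.
  intros H1 H2. unfold brem. destruct (C_eq_dec u 0) as [->|N]; [|now apply Hg].
  rewrite Cmod_0. apply Rmult_le_pos; [exact HK|]. apply pow_le. lra.
Qed.

Lemma cholo_brem u : Rabs (Im u) <= d -> cholo (brem a m) u.
Proof.
  intros Hi. destruct (C_eq_dec u 0) as [->|N].
  (* Since [m >= 2] the bound is quadratic, which gives differentiability at the filled-in point. *)
  - exists 0. apply (cholo_of_quadratic _ 0 K).
    + unfold brem. destruct (C_eq_dec 0 0); [reflexivity|congruence].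
    + exists d. split; [lra|]. intros w Hw. replace (w - 0)%C with w in * by ring.
      assert (I := im_le_Cmod w). assert (R := re_le_Cmod w). apply Rabs_le_between in R.
      eapply Rle_trans; [apply brem_le; lra|]. apply Rmult_le_compat_l; [exact HK|].
      replace m with (2 + (m - 2))%nat by lia. rewrite pow_add.
      assert (P : Cmod w ^ (m - 2) <= 1).
      { rewrite <- (pow1 (m - 2)). apply pow_incr. generalize (Cmod_ge_0 w). lra. }
      assert (P0 : 0 <= Cmod w ^ (m - 2)) by apply pow_le, Cmod_ge_0.
      generalize (Cmod_ge_0 w). simpl. nra.
  - assert (V : vdiff u <> 0) by (apply vdiff_neq_0; [generalize PI2_1; lra|exact N]).
    assert (Hv : forall w, cholo vdiff w) by (intros w; eexists; apply is_cderiv_vdiff).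
    apply cholo_ext_loc with (gregory_rem a m).
    + exists (Cmod u). split; [now apply Cmod_gt_0|]. intros w Hw. unfold brem.
      destruct (C_eq_dec w 0) as [->|]; [|reflexivity].
      replace (0 - u)%C with (- u)%C in Hw by ring. rewrite Cmod_opp in Hw. lra.
    + unfold gregory_rem. apply cholo_minus; [apply cholo_minus|].
      * now apply cholo_inv.
      * apply cholo_inv; [exact N|apply cholo_id].
      * apply (cholo_csum (fun j u => a j * vdiff u ^ j)%C). intros k _. apply cholo_mult; [apply cholo_const|].
        now apply cholo_pow.
Qed.

Lemma cholo_cbin n s : cholo (fun s => cbin s n) s.
Proof.
  induction n as [|n IH]; [apply (cholo_const 1)|].
  apply (cholo_div (fun s => cbin s n * (s + INR n))%C (fun _ => RtoC (INR (S n)))).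
  - apply RtoC_INR_S_neq_0.
  - apply cholo_mult; [exact IH|]. apply cholo_plus; [apply cholo_id|apply cholo_const].
  - apply cholo_const.
Qed.

(** [L * S0 <= d] puts every [(s + r) L] in the half-strip of Gregory's bound; the weight
    [|s + r|^m] arising there is traded for a larger binomial parameter. *)
Lemma rterm_le S0 K1 L y s r : 0 < L -> L * S0 <= d -> L * Cmod y <= 1 / 4 -> 0 <= Re y ->
  0 <= S0 -> Cmod s <= S0 ->
  Cmod (cbin s r) * Cmod (s + INR r) ^ m <= K1 * rbin (Re s + INR m) r ->
  Cmod (rterm a m L y s r)
    <= K * exp S0 * K1 * L ^ m * (rbin (Re s + INR m) r * exp (- (L * Re y)) ^ r).
Proof.
  intros HL HLS HLy Hy HS Hs Hb. unfold rterm. rewrite uterm_pow.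
  assert (Rn := pos_INR r).
  assert (Iu : Rabs (Im ((s + INR r) * L)) <= d).
  { rewrite im_scal_r, im_plus, im_RtoC, Rplus_0_r, Rabs_mult, (Rabs_pos_eq L) by lra.
    generalize (im_le_Cmod s) (Rabs_pos (Im s)). nra. }
  assert (Ru : - d <= Re ((s + INR r) * L)).
  { rewrite re_scal_r, re_plus, re_RtoC.
    assert (R := re_le_Cmod s). apply Rabs_le_between in R. nra. }
  assert (B := brem_le _ Iu Ru). rewrite Cmod_mult, Cmod_R, (Rabs_pos_eq L), Rpow_mult_distr in B by lra.
  rewrite !Cmod_mult, Cmod_pow.
  assert (E1 : Cmod (cexp (- (s * (L * y)))) <= exp S0).
  { eapply Rle_trans; [apply Cmod_cexp_le|]. apply exp_le_compat.
    rewrite Cmod_opp, !Cmod_mult, Cmod_R, (Rabs_pos_eq L) by lra.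
    generalize (Cmod_ge_0 s) (Rmult_le_pos _ _ (Rlt_le _ _ HL) (Cmod_ge_0 y)). nra. }
  assert (E2 : Cmod (cexp (- (L * y))) = exp (- (L * Re y))).
  { rewrite Cmod_cexp, re_opp, re_scal_l. reflexivity. }
  rewrite E2. set (t := exp (- (L * Re y)) ^ r). assert (T0 : 0 <= t) by (apply pow_le, Rlt_le, exp_pos).
  assert (P1 := Cmod_ge_0 (cbin s r)). assert (P2 := Cmod_ge_0 (brem a m ((s + INR r) * L))).
  assert (P3 : 0 <= Cmod (s + INR r) ^ m) by apply pow_le, Cmod_ge_0.
  assert (P4 : 0 < L ^ m) by now apply pow_lt.
  assert (P5 := exp_pos S0). assert (P6 := Cmod_ge_0 (cexp (- (s * (L * y))))).
  apply Rle_trans with (exp S0 * (Cmod (cbin s r) * t) * (K * (Cmod (s + INR r) ^ m * L ^ m))).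
  - apply Rmult_le_compat; [repeat apply Rmult_le_pos; assumption|exact P2| |exact B].
    apply Rmult_le_compat_r; [now apply Rmult_le_pos|exact E1].
  - replace (exp S0 * (Cmod (cbin s r) * t) * (K * (Cmod (s + INR r) ^ m * L ^ m)))
      with ((K * exp S0 * L ^ m * t) * (Cmod (cbin s r) * Cmod (s + INR r) ^ m)) by ring.
    replace (K * exp S0 * K1 * L ^ m * (rbin (Re s + INR m) r * t))
      with ((K * exp S0 * L ^ m * t) * (K1 * rbin (Re s + INR m) r)) by ring.
    apply Rmult_le_compat_l; [|exact Hb]. repeat apply Rmult_le_pos; lra.
Qed.

Lemma rem_series S0 L y s : 0 < L -> L * S0 <= d -> L * Cmod y <= 1 / 4 -> 0 < Re y ->
  0 <= S0 -> Cmod s <= S0 -> 1 <= Re s + INR m ->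
  series_converges_to (rterm a m L y s) (rem a m L y s).
Proof.
  intros HL HLS HLy Hy HS Hs Ha. destruct (cbin_weight S0 m HS) as [K1 [HK1 W]].
  eapply dominated_series.
  - intros r. apply (rterm_le S0 K1); auto; lra.
  - apply summable_scal.
    + assert (0 < L ^ m) by now apply pow_lt. assert (P := exp_pos S0).
      repeat apply Rmult_le_pos; lra.
    + apply summable_rbin; [lra|]. split; [apply Rlt_le, exp_pos|]. apply exp_neg_lt_1. nra.
Qed.

Lemma cholo_rem S0 L y s : 0 < L -> L * S0 <= d -> L * Cmod y <= 1 / 4 -> 0 < Re y ->
  Cmod s < S0 -> 1 < Re s + INR m -> cholo (rem a m L y) s.
Proof.
  intros HL HLS HLy Hy Hs Ha. assert (HS : 0 <= S0) by (generalize (Cmod_ge_0 s); lra).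
  destruct (cbin_weight S0 m HS) as [K1 [HK1 W]].
  set (r := Rmin (S0 - Cmod s) (Re s + INR m - 1) / 2).
  assert (Hr : 0 < r).
  { unfold r. generalize (Rmin_glb_lt (S0 - Cmod s) (Re s + INR m - 1) 0). lra. }
  assert (Hr1 : 2 * r <= S0 - Cmod s) by (unfold r; generalize (Rmin_l (S0 - Cmod s) (Re s + INR m - 1)); lra).
  assert (Hr2 : 2 * r <= Re s + INR m - 1) by (unfold r; generalize (Rmin_r (S0 - Cmod s) (Re s + INR m - 1)); lra).
  assert (Hb : 0 <= K * exp S0 * K1 * L ^ m).
  { assert (0 < L ^ m) by now apply pow_lt. assert (P := exp_pos S0). repeat apply Rmult_le_pos; lra. }
  assert (Hq : 0 <= exp (- (L * Re y)) < 1).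
  { split; [apply Rlt_le, exp_pos|]. apply exp_neg_lt_1. nra. }
  assert (M0 := pos_INR m).
  apply (cholo_Csum (fun n w => rterm a m L y w n)
    (fun n => K * exp S0 * K1 * L ^ m * (rbin (S0 + INR m) n * exp (- (L * Re y)) ^ n)) s r Hr).
  - apply summable_scal; [exact Hb|]. apply summable_rbin; [lra|exact Hq].
  - intros n w Hw.
    assert (Hws : Cmod w <= S0).
    { generalize (Cmod_triangle (w - s) s). replace (w - s + s)%C with w by ring. lra. }
    assert (Hwr : 1 <= Re w + INR m <= S0 + INR m).
    { assert (R1 := re_le_Cmod (w - s)). rewrite re_minus in R1. apply Rabs_le_between in R1.
      assert (R2 := re_le_Cmod w). apply Rabs_le_between in R2. lra. }
    split.
    + unfold rterm, uterm. apply cholo_mult; [apply cholo_mult; [apply cholo_cbin|]|].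
      * apply cholo_cexp, cholo_opp, cholo_mult; [|apply cholo_const].
        apply cholo_plus; [apply cholo_id|apply cholo_const].
      * apply (cholo_comp (fun w => (w + INR n) * L)%C (brem a m)).
        -- apply cholo_mult; [|apply cholo_const]. apply cholo_plus; [apply cholo_id|apply cholo_const].
        -- apply cholo_brem. rewrite im_scal_r, im_plus, im_RtoC, Rplus_0_r, Rabs_mult, (Rabs_pos_eq L) by lra.
           generalize (im_le_Cmod w) (Rabs_pos (Im w)). nra.
    + eapply Rle_trans; [apply (rterm_le S0 K1); auto; [lra|apply W; [exact Hws|lra]]|].
      apply Rmult_le_compat_l; [exact Hb|]. apply Rmult_le_compat_r; [apply pow_le; lra|].
      apply rbin_mono. lra.
Qed.

Lemma one_sub_exp_bounds t : 0 < t <= 1 -> t / 2 <= 1 - exp (- t) <= t.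
Proof.
  intros Ht. assert (A := exp_ineq1_le (- t)). assert (B := exp_ineq1_le t).
  split; [|lra]. rewrite exp_Ropp.
  assert (/ exp t <= / (1 + t)) by (apply Rinv_le_contravar; lra).
  assert (C : / (1 + t) <= 1 - t / 2); [|lra].
  apply Rmult_le_reg_r with (1 + t); [lra|]. rewrite Rinv_l by lra. nra.
Qed.

(** With [sigma = Re s], the remainder is at most a constant times
    [(1 - q)^sigma * L^m * (1 - exp (- L Re y))^(- sigma - m)], which is of order [(Re y)^(- sigma - m)]. *)
Lemma rem_estimate S0 z : 0 <= S0 -> exists K', 0 <= K' /\ forall q y s, 0 < q < 1 ->
  - ln q <= 1 -> - ln q * S0 <= d -> - ln q * Cmod y <= 1 / 4 -> 2 <= Re y ->
  Cmod s <= S0 -> 1 <= Re s + INR m ->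
  Cmod (prefactor q z s * rem a m (- ln q) y s) <= K' / Re y.
Proof.
  intros HS. destruct (cbin_weight S0 m HS) as [K1 [HK1 W]].
  set (K' := exp (S0 * (1 + Cmod z)) * (K * exp S0 * K1) * (exp (S0 * ln 2) * 2)).
  assert (HK' : 0 <= K').
  { unfold K'. assert (P1 := exp_pos (S0 * (1 + Cmod z))). assert (P2 := exp_pos S0).
    assert (P3 := exp_pos (S0 * ln 2)). repeat apply Rmult_le_pos; lra. }
  exists K'. split; [exact HK'|]. intros q y s Hq HL1 HLS HLy Hy Hs Ha.
  set (L := - ln q) in *.
  assert (HL : 0 < L) by (unfold L; generalize (ln_increasing q 1); rewrite ln_1; lra).
  assert (Eq : 1 - q = 1 - exp (- L)) by (unfold L; rewrite Ropp_involutive, exp_ln; lra).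
  set (x := Re y) in *.
  assert (Hx : x <= Cmod y) by (generalize (re_le_Cmod y) (RRle_abs (Re y)); fold x; lra).
  assert (HLx : 0 < L * x <= 1) by (split; nra).
  set (p := exp (- (L * x))).
  assert (Hp : 0 <= p < 1) by (split; [apply Rlt_le, exp_pos|apply exp_neg_lt_1; lra]).
  assert (B1 : Cmod (rem a m L y s) <= K * exp S0 * K1 * L ^ m * exp (- ((Re s + INR m) * ln (1 - p)))).
  { assert (Hb : 0 <= K * exp S0 * K1 * L ^ m).
    { assert (0 < L ^ m) by now apply pow_lt. assert (P := exp_pos S0). repeat apply Rmult_le_pos; lra. }
    apply Cmod_Csum_le with (fun r => K * exp S0 * K1 * L ^ m * (rbin (Re s + INR m) r * p ^ r)).
    - intros r. apply (rterm_le S0 K1); auto; fold x; lra.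
    - apply summable_scal; [exact Hb|]. apply summable_rbin; [lra|exact Hp].
    - intros n. rewrite rsum_scal. apply Rmult_le_compat_l; [exact Hb|]. apply rsum_rbin_le; [lra|exact Hp]. }
  assert (B2 : Cmod (prefactor q z s) <= exp (S0 * (1 + Cmod z)) * exp (Re s * ln (1 - q))).
  { unfold prefactor. rewrite Cmod_cexp, <- exp_plus. apply exp_le_compat.
    replace (s * (ln (1 - q) + (1 - z) * ln q))%C with (RtoC (ln (1 - q)) * s + RtoC (ln q) * (s * (1 - z)))%C by ring.
    rewrite re_plus, !re_scal_l. replace (ln q) with (- L) by (unfold L; ring).
    assert (R1 := re_le_Cmod (s * (1 - z))). rewrite Cmod_mult in R1. apply Rabs_le_between in R1.
    assert (R2 := Cmod_sub_le 1 z). rewrite Cmod_1 in R2.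
    assert (R3 : Cmod s * Cmod (1 - z) <= S0 * (1 + Cmod z)) by (apply Rmult_le_compat; auto using Cmod_ge_0).
    assert (R4 : 0 <= Cmod s * Cmod (1 - z)) by (apply Rmult_le_pos; apply Cmod_ge_0).
    nra. }
  rewrite Cmod_mult.
  assert (Lm : L ^ m = exp (INR m * ln L)).
  { rewrite <- Rpower_pow by exact HL. reflexivity. }
  destruct (one_sub_exp_bounds L (conj HL HL1)) as [O1 O2].
  destruct (one_sub_exp_bounds (L * x) HLx) as [O3 _]. fold p in O3.
  assert (L1 : ln L - ln 2 <= ln (1 - q)).
  { rewrite <- ln_div by lra. rewrite Eq. apply ln_le; lra. }
  assert (L2 : ln (1 - q) <= ln L) by (rewrite Eq; apply ln_le; lra).
  assert (L3 : ln L + ln (x / 2) <= ln (1 - p)).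
  { rewrite <- ln_mult by lra. apply ln_le; [nra|]. replace (L * (x / 2)) with (L * x / 2) by field. exact O3. }
  assert (L4 : 0 <= ln (x / 2)) by (rewrite <- ln_1; apply ln_le; lra).
  assert (L5 : 0 < ln 2) by (rewrite <- ln_1; apply ln_increasing; lra).
  assert (Hsig := re_le_Cmod s). apply Rabs_le_between in Hsig.
  (* In logarithms [1 - q] and [1 - p] are compared with [L] and [L x / 2], after which the powers
     of [L] cancel. The term [S0 * ln 2] pays for [1 - q >= L / 2], and [(x / 2)^(- Re s - m)] is at
     most [2 / x] because [Re s + m >= 1] and [x >= 2]. *)
  assert (Key : Re s * ln (1 - q) + (INR m * ln L + - ((Re s + INR m) * ln (1 - p))) <= S0 * ln 2 + - ln (x / 2)).
  { assert (Q1 : Re s * ln (1 - q) <= Re s * ln L + S0 * ln 2).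
    { destruct (Rle_lt_dec 0 (Re s)); nra. }
    assert (Q2 : (Re s + INR m) * (ln L + ln (x / 2)) <= (Re s + INR m) * ln (1 - p)) by (apply Rmult_le_compat_l; lra).
    nra. }
  apply exp_le_compat in Key. rewrite !exp_plus, <- Lm, (exp_Ropp (ln (x / 2))), exp_ln in Key by lra.
  eapply Rle_trans; [apply Rmult_le_compat; [apply Cmod_ge_0|apply Cmod_ge_0|exact B2|exact B1]|].
  set (X1 := exp (Re s * ln (1 - q))) in *. set (X2 := exp (- ((Re s + INR m) * ln (1 - p)))) in *.
  replace (exp (S0 * (1 + Cmod z)) * X1 * (K * exp S0 * K1 * L ^ m * X2))
    with (exp (S0 * (1 + Cmod z)) * (K * exp S0 * K1) * (X1 * (L ^ m * X2))) by ring.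
  replace (K' / x) with (exp (S0 * (1 + Cmod z)) * (K * exp S0 * K1) * (exp (S0 * ln 2) * / (x / 2)))
    by (unfold K'; field; lra).
  apply Rmult_le_compat_l; [|exact Key].
  assert (P1 := exp_pos (S0 * (1 + Cmod z))). assert (P2 := exp_pos S0). repeat apply Rmult_le_pos; lra.
Qed.

End Remainder.

(** * Summation of the q-series by Gregory's formula *)

(** The general term of the q-series with [z + k] freed to a variable [y], so that differences and
    limits in [y] make sense. *)
Definition theta (q : R) (z y s : C) : C := (prefactor q z s * Psi s (RtoC (- ln q) * y))%C.

(** The sign makes one difference multiply [exp (- u y)] by [vdiff u]. *)
Fixpoint fdiff (f : C -> C) (j : nat) (y : C) : C :=
  match j with O => f y | S i => (fdiff f i y - fdiff f i (y + 1))%C end.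

Lemma fdiff_scal c f j y : fdiff (fun y => c * f y)%C j y = (c * fdiff f j y)%C.
Proof. revert y. induction j as [|j IH]; intros y; simpl; [reflexivity|]. rewrite !IH. ring. Qed.

(** Gregory's formula without remainder for q-zeta plus correction: the [V] term is minus the
    continued integral of [theta] over (0, z + N). *)
Definition approx (a : nat -> C) (m : nat) (q : R) (z : C) (N : nat) (s : C) : C :=
  (csum (fun k => theta q z (z + INR k) s) N
   - prefactor q z s / RtoC (- ln q) * V s (ell (RtoC (- ln q) * (z + INR N)))
   + csum (fun j => a j * fdiff (fun y => theta q z y s) j (z + INR N)) m)%C.

Lemma ln_neg q : 0 < q < 1 -> 0 < - ln q.
Proof. intros H. generalize (ln_increasing q 1). rewrite ln_1. lra. Qed.

Lemma qzeta_term_theta q z k s : 0 < q < 1 -> 0 < Re z ->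
  qzeta_term q z k s = theta q z (z + INR k) s.
Proof.
  intros Hq Hz. assert (HL := ln_neg q Hq).
  set (x := (z + INR k)%C).
  assert (Hx : 0 < Re x) by (unfold x; rewrite re_plus, re_RtoC; generalize (pos_INR k); lra).
  unfold qzeta_term, qnum. replace (INR k + z)%C with x by (unfold x; ring).
  rewrite !cpow_RtoC by lra.
  assert (E1 : (x * ln q)%C = (- (RtoC (- ln q) * x))%C) by (rewrite RtoC_opp; ring).
  rewrite E1. unfold theta, Psi, prefactor, ell.
  assert (Hl : 0 < Re (RtoC (- ln q) * x)) by (rewrite re_scal_l; nra).
  set (l := (RtoC (- ln q) * x)%C) in *.
  assert (Q0 : RtoC (1 - q) <> 0) by (intros Z; apply RtoC_inj in Z; lra).
  replace ((1 - cexp (- l)) / (1 - q))%C with (RtoC (/ (1 - q)) * (1 - cexp (- l)))%C.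
  2: { rewrite RtoC_inv by lra. rewrite RtoC_minus in *. field. exact Q0. }
  unfold cpow. rewrite Clog_scale; [|apply Rinv_0_lt_compat; lra|now apply one_sub_cexp_Re].
  rewrite ln_Rinv by lra. unfold Cdiv. rewrite <- cexp_opp, <- !cexp_plus. f_equal.
  unfold l, x. rewrite !RtoC_opp, S_INR, RtoC_plus. ring.
Qed.

Section Strip.
Variables (a : nat -> C) (m : nat) (K d : R).
Hypothesis HK : 0 <= K.
Hypothesis Hd : 0 < d <= 1 / 16.
Hypothesis Hm : (2 <= m)%nat.
Hypothesis Hg : forall u : C, u <> 0 -> Rabs (Im u) <= d -> - d <= Re u ->
  Cmod (gregory_rem a m u) <= K * Cmod u ^ m.

Variables (L : R).
Hypothesis HL : 0 < L.

Lemma Re_shift_freq s r : Re ((s + INR r) * L) = (Re s + INR r) * L.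
Proof. rewrite re_scal_r, re_plus, re_RtoC. reflexivity. Qed.

(** The bound does not depend on [r], so dividing by [vdiff] keeps the series dominated. *)
Lemma vdiff_freq_ge s r : 0 < Re s ->
  1 - exp (- (Re s * L)) <= Cmod (vdiff ((s + INR r) * L)).
Proof.
  intros Hs. unfold vdiff. eapply Rle_trans; [|apply Cmod_sub_ge].
  rewrite Cmod_1, Cmod_cexp, re_opp, Re_shift_freq.
  assert (exp (- ((Re s + INR r) * L)) <= exp (- (Re s * L))); [|lra].
  apply exp_le_compat. generalize (pos_INR r). nra.
Qed.

Lemma vdiff_gap_pos s : 0 < Re s -> 0 < 1 - exp (- (Re s * L)).
Proof. intros Hs. generalize (exp_neg_lt_1 (- (Re s * L))). nra. Qed.

Lemma vdiff_freq_neq_0 s r : 0 < Re s -> vdiff ((s + INR r) * L) <> 0.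
Proof.
  intros Hs. apply Cmod_gt_0. generalize (vdiff_freq_ge s r Hs) (vdiff_gap_pos s Hs). lra.
Qed.

(** The sum of [Psi s (L * (y + k))] over all [k], with the geometric series in [k] summed for each
    [r]. No exchange of double sums is needed: [St_step] and [St_tail_0] identify it by
    telescoping. *)
Definition St (s y : C) : C := Csum (fun r => uterm s r (L * y) / vdiff ((s + INR r) * L))%C.

Lemma St_term_le s y r D e : 0 < Re s -> Cmod (L * y) <= D -> e <= Re (L * y) ->
  Cmod (uterm s r (L * y) / vdiff ((s + INR r) * L))
    <= / (1 - exp (- (Re s * L))) * ubound (Cmod s) D e r.
Proof.
  intros Hs HD He. rewrite Cmod_div by now apply vdiff_freq_neq_0.
  rewrite Rmult_comm. assert (G := vdiff_gap_pos s Hs). assert (G2 := vdiff_freq_ge s r Hs).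
  apply Rmult_le_compat; [apply Cmod_ge_0| |apply uterm_le; auto; apply Rle_refl|].
  - apply Rlt_le, Rinv_0_lt_compat. lra.
  - apply Rinv_le_contravar; lra.
Qed.

Lemma Re_scaled_pos y : 0 < Re y -> 0 < Re (L * y).
Proof. intros H. rewrite re_scal_l. nra. Qed.

Lemma St_series s y : 0 < Re s -> 0 < Re y ->
  series_converges_to (fun r => uterm s r (L * y) / vdiff ((s + INR r) * L))%C (St s y).
Proof.
  intros Hs Hy. eapply dominated_series.
  - intros r. apply St_term_le; [exact Hs|apply Rle_refl|apply Rle_refl].
  - apply summable_scal; [apply Rlt_le, Rinv_0_lt_compat, vdiff_gap_pos, Hs|].
    apply summable_ubound; [apply Cmod_ge_0|now apply Re_scaled_pos].
Qed.

Lemma uterm_shift s r y k : uterm s r (L * (y + k)) = (uterm s r (L * y) * cexp (- ((s + INR r) * L * k)))%C.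
Proof. unfold uterm. rewrite <- Cmult_assoc, <- cexp_plus. f_equal. f_equal. ring. Qed.

Lemma St_step s y : 0 < Re s -> 0 < Re y -> Psi s (L * y) = (St s y - St s (y + 1))%C.
Proof.
  intros Hs Hy. apply (scv_unique (fun r => uterm s r (L * y))).
  - apply Psi_series. now apply Re_scaled_pos.
  - assert (Hy1 : 0 < Re (y + 1)) by (rewrite re_plus, re_RtoC; lra).
    generalize (scv_minus _ _ _ _ (St_series s y Hs Hy) (St_series s (y + 1)%C Hs Hy1)).
    apply scv_ext. intros r. rewrite uterm_shift. assert (N := vdiff_freq_neq_0 s r Hs).
    replace (cexp (- ((s + INR r) * L * 1))) with (1 - vdiff ((s + INR r) * L))%C.
    + field. exact N.
    + unfold vdiff. replace ((s + INR r) * L * 1)%C with ((s + INR r) * L)%C by ring. ring.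
Qed.

Lemma Psi_telescope s z N : 0 < Re s -> 0 < Re z ->
  csum (fun k => Psi s (L * (z + INR k))) N = (St s z - St s (z + INR N))%C.
Proof.
  intros Hs Hz. induction N as [|N IH].
  - simpl. replace (z + 0)%C with z by ring. ring.
  - change (csum (fun k => Psi s (L * (z + INR k))) (S N))%C
      with (csum (fun k => Psi s (L * (z + INR k))) N + Psi s (L * (z + INR N)))%C.
    assert (Hy : 0 < Re (z + INR N)) by (rewrite re_plus, re_RtoC; generalize (pos_INR N); lra).
    rewrite IH, (St_step s (z + INR N)%C Hs Hy), S_INR, RtoC_plus.
    replace (z + (INR N + 1))%C with (z + INR N + 1)%C by ring. ring.
Qed.

Lemma St_tail_0 s z : 0 < Re s -> 0 < Re z -> flim eventually (fun N => St s (z + INR N)%C) 0.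
Proof.
  intros Hs Hz eps He.
  assert (Sb := summable_ubound (Cmod s) (Cmod (L * z)) (Re (L * z)) (Cmod_ge_0 s) (Re_scaled_pos z Hz)).
  assert (G := vdiff_gap_pos s Hs).
  assert (Sb2 := summable_scal _ _ (Rlt_le _ _ (Rinv_0_lt_compat _ G)) Sb).
  destruct Sb2 as [P [B HB]]. assert (B0 : 0 <= B) by apply (HB O).
  destruct (exp_decay B (Re s * L) (eps / 2) B0 ltac:(nra) ltac:(lra)) as [N HN].
  exists N. intros n Hn. replace (St s (z + INR n) - 0)%C with (St s (z + INR n)) by ring.
  apply Rle_lt_trans with (eps / 2); [|lra].
  eapply Rle_trans; [|apply (HN n Hn)]. rewrite Rmult_comm. set (c := exp (- (Re s * L * INR n))).
  assert (C0 : 0 < c) by apply exp_pos.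
  eapply Cmod_Csum_le.
  - intros r. rewrite uterm_shift.
    replace (uterm s r (L * z) * cexp (- ((s + INR r) * L * INR n)) / vdiff ((s + INR r) * L))%C
      with (cexp (- ((s + INR r) * L * INR n)) * (uterm s r (L * z) / vdiff ((s + INR r) * L)))%C
      by (unfold Cdiv; ring).
    rewrite Cmod_mult. apply Rmult_le_compat with (r2 := c); [apply Cmod_ge_0|apply Cmod_ge_0| |].
    + rewrite Cmod_cexp, re_opp, re_scal_r, Re_shift_freq. apply exp_le_compat.
      assert (0 <= INR r * L * INR n) by (repeat apply Rmult_le_pos; try apply pos_INR; lra). lra.
    + apply (St_term_le s z r (Cmod (L * z)) (Re (L * z))); auto; apply Rle_refl.
  - apply summable_scal; [lra|]. split; [exact P|]. now exists B.
  - intros n0. rewrite rsum_scal. apply Rmult_le_compat_l; [lra|apply HB].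
Qed.

Lemma fdiff_series s j y : 0 < Re y ->
  series_converges_to (fun r => uterm s r (L * y) * vdiff ((s + INR r) * L) ^ j)%C
    (fdiff (fun y => Psi s (L * y)) j y).
Proof.
  revert y. induction j as [|j IH]; intros y Hy.
  - simpl. apply scv_ext with (fun r => uterm s r (L * y)); [intros; ring|].
    apply Psi_series. now apply Re_scaled_pos.
  - assert (Hy1 : 0 < Re (y + 1)) by (rewrite re_plus, re_RtoC; lra).
    generalize (scv_minus _ _ _ _ (IH y Hy) (IH (y + 1)%C Hy1)). apply scv_ext. intros r.
    rewrite uterm_shift. simpl Cpow. unfold vdiff at 3.
    replace ((s + INR r) * L * 1)%C with ((s + INR r) * L)%C by ring. ring.
Qed.

(** Gregory's expansion of [1 / vdiff u] is inserted in every term: [1 / u] yields [U / L], each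
    power of [vdiff u] a finite difference, and the rest is [rem]. *)
Lemma St_gregory s y S0 : 0 < Re s -> 0 < Re y -> L * S0 <= d -> L * Cmod y <= 1 / 4 ->
  0 <= S0 -> Cmod s <= S0 -> 1 <= Re s + INR m ->
  St s y = (U s (L * y) / L + csum (fun j => a j * fdiff (fun y => Psi s (L * y)) j y) m + rem a m L y s)%C.
Proof.
  intros Hs Hy HLS HLy HS Hss Ha.
  apply (scv_unique (fun r => uterm s r (L * y) / vdiff ((s + INR r) * L))%C); [now apply St_series|].
  assert (L0 : RtoC L <> 0) by (intros Z; apply RtoC_inj in Z; lra).
  assert (R1 := scv_scal (/ L)%C _ _ (U_series s (L * y) Hs (Re_scaled_pos y Hy))).
  assert (R2 : series_converges_to (fun r => csum (fun j => a j * (uterm s r (L * y) * vdiff ((s + INR r) * L) ^ j))%C m)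
    (csum (fun j => a j * fdiff (fun y => Psi s (L * y)) j y)%C m)).
  { apply (scv_csum (fun j r => a j * (uterm s r (L * y) * vdiff ((s + INR r) * L) ^ j))%C).
    intros j _. now apply scv_scal, fdiff_series. }
  assert (R3 := rem_series a m K d HK Hd Hg S0 L y s HL HLS HLy Hy HS Hss Ha).
  replace (U s (L * y) / L)%C with (/ L * U s (L * y))%C by (unfold Cdiv; ring).
  generalize (scv_plus _ _ _ _ (scv_plus _ _ _ _ R1 R2) R3). apply scv_ext. intros r.
  assert (N1 := s_plus_INR_neq_0 s r Hs). assert (N2 := vdiff_freq_neq_0 s r Hs).
  unfold rterm, brem. destruct (C_eq_dec ((s + INR r) * L) 0) as [E|_].
  { exfalso. revert E. now apply Cmult_neq_0. }
  unfold gregory_rem.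
  rewrite (csum_ext _ (fun j => uterm s r (L * y) * (a j * vdiff ((s + INR r) * L) ^ j))%C) by (intros; ring).
  rewrite csum_scal. generalize (csum (fun j => a j * vdiff ((s + INR r) * L) ^ j)%C m). intros c.
  field. auto.
Qed.

End Strip.

Lemma qcorr_prefactor q z s : 0 < q < 1 ->
  qcorr q z s = (- (prefactor q z s / RtoC (- ln q) * (PI / csin (PI * s))))%C.
Proof.
  intros Hq. assert (HL := ln_neg q Hq). unfold qcorr.
  replace (q - q ^ 2)%C with (RtoC (q * (1 - q))) by (rewrite RtoC_mult, RtoC_minus; simpl; ring).
  rewrite !cpow_RtoC by nra. rewrite <- cexp_plus. unfold prefactor.
  replace (s * ln (q * (1 - q)) + - (z * s) * ln q)%C with (s * (ln (1 - q) + (1 - z) * ln q))%C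
    by (rewrite ln_mult, RtoC_plus by lra; ring).
  rewrite RtoC_opp. unfold Cdiv at 1 3. generalize (PI / csin (PI * s))%C. intros w.
  assert (N : RtoC (ln q) <> 0) by (intros Z; apply RtoC_inj in Z; lra).
  field. exact N.
Qed.

(** In this strip [U] and [V] both converge, and reflection trades [prefactor * U / L] for [- qcorr]
    plus the [V] term of [approx]. What results makes sense beyond the strip. *)
Lemma qzeta_strip (a : nat -> C) (m : nat) (K d S0 : R) (z s : C) (q : R) (N : nat) :
  0 <= K -> 0 < d <= 1 / 16 -> (2 <= m)%nat ->
  (forall u : C, u <> 0 -> Rabs (Im u) <= d -> - d <= Re u ->
    Cmod (gregory_rem a m u) <= K * Cmod u ^ m) ->
  0 < q < 1 -> - ln q * S0 <= d -> - ln q * Cmod (z + INR N) <= 1 / 4 ->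
  0 < Re z -> 0 < Re s < 1 -> Cmod s <= S0 ->
  series_converges_to (fun k => qzeta_term q z k s)
    (approx a m q z N s + prefactor q z s * rem a m (- ln q) (z + INR N) s - qcorr q z s)%C.
Proof.
  intros HK Hd Hm Hg Hq HLS HLy Hz Hs HsS.
  assert (HL := ln_neg q Hq). set (L := - ln q) in *. set (y := (z + INR N)%C) in *.
  assert (Hy : 0 < Re y) by (unfold y; rewrite re_plus, re_RtoC; generalize (pos_INR N); lra).
  assert (HS : 0 <= S0) by (generalize (Cmod_ge_0 s); lra).
  assert (M2 : 2 <= INR m) by (replace 2 with (INR 2) by (simpl; lra); now apply le_INR).
  assert (L0 : RtoC L <> 0) by (intros Z; apply RtoC_inj in Z; lra).
  replace (approx a m q z N s + prefactor q z s * rem a m L y s - qcorr q z s)%C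
    with (prefactor q z s * St L s z)%C.
  - apply scv_ext with (fun k => prefactor q z s * Psi s (L * (z + INR k)))%C.
    { intros k. now rewrite qzeta_term_theta. }
    apply scv_scal.
    apply (flim_ext (F := eventually) (fun n => St L s z - St L s (z + INR n))%C).
    { intros n. symmetry. apply Psi_telescope; auto; lra. }
    apply (flim_eq (F := eventually)) with (St L s z - 0)%C; [ring|].
    apply flim_minus; [apply flim_const|]. apply St_tail_0; auto; lra.
  - assert (Hl : Cmod (L * y) <= 1 / 4) by (rewrite Cmod_mult, Cmod_R, Rabs_pos_eq; lra).
    assert (Rf := reflection s (L * y) Hs (Re_scaled_pos L HL y Hy) Hl).
    assert (Gr := St_gregory a m K d HK Hd Hg L HL s y S0 (proj1 Hs) Hy HLS HLy HS HsS ltac:(lra)).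
    assert (Te := Psi_telescope L HL s z N (proj1 Hs) Hz). fold y in Te.
    rewrite qcorr_prefactor by exact Hq. fold L. rewrite <- Rf.
    unfold approx. fold L. fold y.
    unfold theta. fold L. rewrite csum_scal, Te, Gr.
    rewrite (csum_ext (fun j => a j * fdiff (fun y => prefactor q z s * Psi s (L * y)) j y)%C
      (fun j => prefactor q z s * (a j * fdiff (fun y => Psi s (L * y)) j y))%C).
    2: { intros j _. rewrite fdiff_scal. ring. }
    rewrite csum_scal. field. exact L0.
Qed.

(** * Dependence on s *)

Definition not_pos_int (s : C) : Prop := forall n : nat, s <> RtoC (INR (S n)).

(** Finitely many integers are treated one by one; those beyond [|s|] by 1 are at distance at least
    1. *)
Lemma pos_int_gap s : not_pos_int s -> exists g, 0 < g <= 1 /\ forall n, g <= Cmod (INR n + 1 - s).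
Proof.
  intros Hs. destruct (INR_unbounded (Cmod s)) as [N HN].
  assert (F : forall M, exists g, 0 < g <= 1 /\ forall n, (n < M)%nat -> g <= Cmod (INR n + 1 - s)).
  { induction M as [|M [g [Hg IH]]]; [exists 1; split; [lra|intros n Hn; lia]|].
    assert (P : 0 < Cmod (INR M + 1 - s)).
    { apply Cmod_sub_pos. intros E. apply (Hs M). now rewrite S_INR, RtoC_plus, E. }
    exists (Rmin g (Cmod (INR M + 1 - s))). split.
    - split; [now apply Rmin_glb_lt|]. eapply Rle_trans; [apply Rmin_l|lra].
    - intros n Hn. destruct (Nat.eq_dec n M) as [->|Hne]; [apply Rmin_r|].
      eapply Rle_trans; [apply Rmin_l|]. apply IH. lia. }
  destruct (F N) as [g [Hg HF]]. exists g. split; [exact Hg|]. intros n.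
  destruct (Nat.lt_ge_cases n N) as [L|L]; [now apply HF|].
  assert (L' := le_INR _ _ L). assert (A := Cmod_sub_ge (INR n + 1) s).
  rewrite <- RtoC_plus, Cmod_R, Rabs_pos_eq in A by (generalize (pos_INR n); lra).
  rewrite RtoC_plus in A. lra.
Qed.

Lemma pos_int_gap_near s : not_pos_int s -> exists g, 0 < g <= 1 /\
  forall w n, Cmod (w - s) <= g -> g <= Cmod (INR n + 1 - w).
Proof.
  intros Hs. destruct (pos_int_gap s Hs) as [g [Hg H]]. exists (g / 2). split; [lra|].
  intros w n Hw. specialize (H n).
  generalize (Cmod_triangle_sub (INR n + 1) w s). lra.
Qed.

Lemma not_pos_int_of_gap w g : 0 < g -> (forall n, g <= Cmod (INR n + 1 - w)) -> not_pos_int w.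
Proof.
  intros Hg H n ->. specialize (H n). rewrite S_INR, RtoC_plus, Cmod_sub_self in H. lra.
Qed.

Lemma not_pos_int_open s : not_pos_int s -> cnbhs s not_pos_int.
Proof.
  intros Hs. destruct (pos_int_gap_near s Hs) as [g [Hg H]]. exists g. split; [lra|].
  intros w Hw. apply (not_pos_int_of_gap w g); [lra|]. intros n. apply H. lra.
Qed.

Lemma vterm_gap_le s n v g : 0 < g -> g <= Cmod (INR n + 1 - s) ->
  Cmod (vterm s n v) <= Cmod (cexp ((1 - s) * v)) / g * Cmod (cexp v) ^ n.
Proof.
  intros Hg H. unfold vterm. rewrite Cmod_div by (apply Cmod_gt_0; lra).
  replace ((INR n + 1 - s) * v)%C with ((1 - s) * v + INR n * v)%C by ring.
  rewrite cexp_plus, cexp_INR, !Cmod_mult, !Cmod_pow, Cmod_opp, Cmod_1, pow1, Rmult_1_l.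
  assert (K : / Cmod (INR n + 1 - s) <= / g) by (apply Rinv_le_contravar; lra).
  unfold Rdiv. rewrite Rmult_assoc, (Rmult_comm _ (/ _)), <- Rmult_assoc.
  apply Rmult_le_compat_r; [apply pow_le, Cmod_ge_0|].
  apply Rmult_le_compat_l; [apply Cmod_ge_0|exact K].
Qed.

Lemma cholo_V v s : Cmod (cexp v) < 1 -> not_pos_int s -> cholo (fun s => V s v) s.
Proof.
  intros Hv Hs. destruct (pos_int_gap_near s Hs) as [g [Hg H]].
  set (A := exp ((2 + Cmod s) * Cmod v) / g).
  assert (HA : 0 <= A) by (apply Rdiv_le_0_compat; [apply Rlt_le, exp_pos|lra]).
  apply (cholo_Csum (fun n w => vterm w n v) (fun n => A * Cmod (cexp v) ^ n) s (g / 2)); [lra| |].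
  - apply summable_vbound; [exact HA|]. split; [apply Cmod_ge_0|exact Hv].
  - intros n w Hw. assert (G : g <= Cmod (INR n + 1 - w)) by (apply H; lra). split.
    + unfold vterm. apply cholo_div.
      * apply Cmod_gt_0. lra.
      * apply cholo_mult; [apply cholo_const|]. apply cholo_cexp, cholo_mult; [|apply cholo_const].
        apply cholo_minus; [apply cholo_const|apply cholo_id].
      * apply cholo_minus; [apply cholo_const|apply cholo_id].
    + eapply Rle_trans; [apply (vterm_gap_le w n v g); [lra|exact G]|].
      apply Rmult_le_compat_r; [apply pow_le, Cmod_ge_0|]. unfold A, Rdiv.
      apply Rmult_le_compat_r; [apply Rlt_le, Rinv_0_lt_compat; lra|].
      eapply Rle_trans; [apply Cmod_cexp_le|]. apply exp_le_compat. rewrite Cmod_mult.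
      apply Rmult_le_compat_r; [apply Cmod_ge_0|].
      generalize (Cmod_sub_le 1 w) (Cmod_triangle (w - s) s). rewrite Cmod_1.
      replace (w - s + s)%C with w by ring. lra.
Qed.

Lemma cholo_prefactor q z s : cholo (prefactor q z) s.
Proof. apply cholo_cexp, cholo_mult; [apply cholo_id|apply cholo_const]. Qed.

Lemma cholo_theta q z y s : cholo (theta q z y) s.
Proof.
  apply cholo_mult; [apply cholo_prefactor|]. apply cholo_cexp, cholo_opp, cholo_mult; [apply cholo_id|apply cholo_const].
Qed.

Lemma cholo_fdiff (f : C -> C -> C) j y s : (forall y, cholo (f y) s) ->
  cholo (fun s => fdiff (fun y => f y s) j y) s.
Proof.
  intros H. revert y. induction j as [|j IH]; intros y; [apply H|].
  apply (cholo_minus (fun s => fdiff (fun y => f y s) j y) (fun s => fdiff (fun y => f y s) j (y + 1)%C)); apply IH.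
Qed.

(** This keeps [V] within its disc of convergence, and sends its argument to minus infinity as
    [L -> 0]. *)
Lemma scaled_ell_small (L : R) y : 0 < L -> 0 < Re y -> L * Cmod y <= 1 / 4 ->
  Cmod (cexp (ell (L * y))) <= 3 * (L * Cmod y).
Proof.
  intros HL Hy H. assert (E : Cmod (L * y) = L * Cmod y) by (rewrite Cmod_mult, Cmod_R, Rabs_pos_eq; lra).
  rewrite cexp_ell by (rewrite re_scal_l; nra). rewrite <- E. apply cexp_sub_1_le. lra.
Qed.

Lemma cholo_approx a m q z N s : 0 < q < 1 -> 0 < Re z -> - ln q * Cmod (z + INR N) <= 1 / 4 ->
  not_pos_int s -> cholo (approx a m q z N) s.
Proof.
  intros Hq Hz HL Hs. assert (L0 := ln_neg q Hq).
  assert (Hy : 0 < Re (z + INR N)) by (rewrite re_plus, re_RtoC; generalize (pos_INR N); lra).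
  unfold approx. apply cholo_plus; [apply cholo_minus|].
  - apply (cholo_csum (fun k s => theta q z (z + INR k) s)). intros k _. apply cholo_theta.
  - apply cholo_mult.
    + apply cholo_mult; [apply cholo_prefactor|apply cholo_const].
    + apply cholo_V; [|exact Hs]. generalize (scaled_ell_small (- ln q) (z + INR N) L0 Hy HL). lra.
  - apply (cholo_csum (fun j s => a j * fdiff (fun y => theta q z y s) j (z + INR N))%C). intros j _.
    apply cholo_mult; [apply cholo_const|]. apply cholo_fdiff. intros y. apply cholo_theta.
Qed.

(** * The limit q -> 1 *)

Definition near1 (P : R -> Prop) : Prop :=
  exists del, 0 < del /\ forall q, 0 < q -> 1 - del < q < 1 -> P q.

Global Instance near1_proper : ProperFilter near1.
Proof.
  split.
  - intros P [d [Hd H]]. exists (1 - Rmin d 1 / 2).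
    assert (0 < Rmin d 1) by (apply Rmin_glb_lt; lra).
    apply H; generalize (Rmin_l d 1) (Rmin_r d 1); lra.
  - split.
    + exists 1. split; [lra|auto].
    + intros P Q [d1 [H1 K1]] [d2 [H2 K2]]. exists (Rmin d1 d2). split; [now apply Rmin_glb_lt|].
      intros q Hq Hq1. generalize (Rmin_l d1 d2) (Rmin_r d1 d2). intros A B.
      split; [apply K1|apply K2]; lra.
    + intros P Q HPQ [d [Hd H]]. exists d. split; auto.
Qed.

Lemma near1_range : near1 (fun q => 0 < q < 1).
Proof. exists 1. split; [lra|]. intros; lra. Qed.

Lemma near1_ln : flim near1 (fun q => RtoC (- ln q)) 0.
Proof.
  replace (RtoC 0) with (RtoC (- ln 1)) by (now rewrite ln_1, Ropp_0).
  apply (flim_real_comp (fun q => q) (fun x => - ln x)).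
  - apply continuity_pt_opp, derivable_continuous_pt. exists (/ 1). apply derivable_pt_lim_ln. lra.
  - intros eps He. exists eps. split; [exact He|]. intros q Hq Hq1.
    rewrite <- RtoC_minus, Cmod_R. apply Rabs_def1; lra.
Qed.

Lemma near1_ln_le c e : 0 <= c -> 0 < e -> near1 (fun q => - ln q * c <= e).
Proof.
  intros Hc He. assert (P : 0 < e / (c + 1)) by (apply Rdiv_lt_0_compat; lra).
  generalize (filter_and _ _ (near1_ln _ P) near1_range). apply filter_imp. intros q [H Hq].
  replace (RtoC (- ln q) - 0)%C with (RtoC (- ln q)) in H by ring.
  rewrite Cmod_R, Rabs_pos_eq in H by (apply Rlt_le, ln_neg, Hq).
  assert (L := ln_neg q Hq).
  apply Rle_trans with (- ln q * (c + 1)); [nra|].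
  apply Rmult_lt_compat_r with (r := c + 1) in H; [|lra].
  replace (e / (c + 1) * (c + 1)) with e in H by (field; lra). lra.
Qed.

Definition hpow (y s : C) : C := cexp (- (s * Clog y)).

(** Gregory's summation formula for [y^(- s)] without its remainder; [hpow y s * y / (1 - s)] stands
    for [y^(1 - s) / (1 - s)]. *)
Definition approx0 (a : nat -> C) (m : nat) (z : C) (N : nat) (s : C) : C :=
  (csum (fun k => hpow (z + INR k) s) N - hpow (z + INR N) s * (z + INR N) / (1 - s)
   + csum (fun j => a j * fdiff (fun y => hpow y s) j (z + INR N)) m)%C.

Lemma vdiff_ln q : 0 < q -> vdiff (RtoC (- ln q)) = RtoC (1 - q).
Proof.
  intros Hq. unfold vdiff. rewrite RtoC_opp.
  replace (- - ln q)%C with (RtoC (ln q)) by ring. rewrite cexp_RtoC, exp_ln by exact Hq.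
  now rewrite RtoC_minus.
Qed.

(** This is [(1 - q^y) / (1 - q) -> y]. As [1 - q = vdiff (- ln q)], it is a quotient of two
    difference quotients of [vdiff] at 0. *)
Lemma vdiff_ratio_limit y : flim near1 (fun q => / RtoC (1 - q) * vdiff (RtoC (- ln q) * y))%C y.
Proof.
  destruct (is_cderiv_vdiff 0) as [phi [P1 [P2 P3]]].
  rewrite vdiff_0 in P1. replace (- 0)%C with (RtoC 0) in P2 by ring. rewrite cexp_0 in P2.
  assert (A : flim near1 (fun q => phi (RtoC (- ln q))) (phi 0)) by (apply flim_comp; [apply near1_proper|apply near1_ln|exact P3]).
  assert (B : flim near1 (fun q => phi (RtoC (- ln q) * y)%C) (phi 0)).
  { apply (flim_comp near1 (fun q => RtoC (- ln q) * y)%C phi); [|exact P3].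
    apply flim_eq with (0 * y)%C; [ring|]. apply flim_mult; [apply near1_ln|apply flim_const]. }
  rewrite P2 in A, B.
  assert (N1 : RtoC 1 <> 0) by (intros Z; apply RtoC_inj in Z; lra).
  apply flim_ext_loc with (fun q => y * (phi (RtoC (- ln q) * y) / phi (RtoC (- ln q))))%C.
  - generalize near1_range. apply filter_imp. intros q Hq.
    rewrite <- vdiff_ln by lra. rewrite (P1 (RtoC (- ln q) * y)%C).
    assert (V := vdiff_ln q (proj1 Hq)). rewrite (P1 (RtoC (- ln q))) in V |- *.
    assert (L := ln_neg q Hq).
    assert (L0 : RtoC (- ln q) <> 0) by (intros Z; apply RtoC_inj in Z; lra).
    assert (N : phi (RtoC (- ln q)) <> 0).
    { intros Z. rewrite Z in V. replace (0 + 0 * (RtoC (- ln q) - 0))%C with (RtoC 0) in V by ring.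
      apply RtoC_inj in V. lra. }
    field. split; assumption.
  - apply flim_eq with (y * (1 / 1))%C; [field|]. apply flim_mult; [apply flim_const|]. now apply flim_div.
Qed.

(** The positive factor [1 / (1 - q)] can be moved inside the principal logarithm without a branch
    error; the argument then tends to [y], where [Clog] is continuous. *)
Lemma theta_limit z y s : 0 < Re y -> flim near1 (fun q => theta q z y s) (hpow y s).
Proof.
  intros Hy. set (R := fun q => (/ RtoC (1 - q) * vdiff (RtoC (- ln q) * y))%C).
  apply flim_ext_loc with (fun q => cexp (- (s * (Clog (R q) + RtoC (- ln q) * (y + (1 - z))))))%C.
  - generalize near1_range. apply filter_imp. intros q Hq. assert (L := ln_neg q Hq).
    unfold theta, prefactor, Psi, ell, R. rewrite <- cexp_plus. f_equal.
    rewrite <- RtoC_inv, Clog_scale by (lra || apply Rinv_0_lt_compat || apply one_sub_cexp_Re; try lra; rewrite re_scal_l; nra).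
    rewrite ln_Rinv by lra. rewrite !RtoC_opp. unfold vdiff. ring.
  - unfold hpow. apply (flim_comp near1 _ cexp); [|apply ccont_cexp]. apply flim_opp.
    apply flim_mult; [apply flim_const|].
    apply flim_eq with (Clog y + 0 * (y + (1 - z)))%C; [ring|]. apply flim_plus.
    + apply (flim_comp near1 R Clog); [apply vdiff_ratio_limit|now apply ccont_Clog].
    + apply flim_mult; [apply near1_ln|apply flim_const].
Qed.

Lemma fdiff_limit {T} (F : (T -> Prop) -> Prop) {FF : Filter F} (f : T -> C -> C) (g : C -> C) j y :
  0 < Re y -> (forall y, 0 < Re y -> flim F (fun x => f x y) (g y)) ->
  flim F (fun x => fdiff (f x) j y) (fdiff g j y).
Proof.
  intros Hy H. revert y Hy. induction j as [|j IH]; intros y Hy; [now apply H|].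
  apply (flim_minus (fun x => fdiff (f x) j y) (fun x => fdiff (f x) j (y + 1)%C)); apply IH; [exact Hy|].
  rewrite re_plus, re_RtoC. lra.
Qed.

Lemma csum_limit {T} (F : (T -> Prop) -> Prop) {FF : Filter F} (f : T -> nat -> C) (g : nat -> C) n :
  (forall k, flim F (fun x => f x k) (g k)) -> flim F (fun x => csum (f x) n) (csum g n).
Proof.
  intros H. induction n as [|n IH]; [apply (flim_const (RtoC 0))|].
  apply (flim_plus (fun x => csum (f x) n) (fun x => f x n)); auto.
Qed.

Lemma rsum_geom_le x n : 0 <= x < 1 -> rsum (fun k => x ^ k) n <= / (1 - x).
Proof.
  intros Hx. assert (E : (1 - x) * rsum (fun k => x ^ k) n = 1 - x ^ n).
  { induction n as [|n IH]; simpl; [ring|]. rewrite Rmult_plus_distr_l, IH. ring. }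
  apply Rmult_le_reg_l with (1 - x); [lra|]. rewrite E, Rinv_r by lra.
  assert (0 <= x ^ n) by (apply pow_le; lra). lra.
Qed.

(** As [q -> 1] only the first term of [V] counts: relative to [cexp ((1 - s) * v)] the others are
    of order [|cexp v|]. *)
Lemma V_first_term s v g : 0 < g -> (forall n, g <= Cmod (INR n + 1 - s)) -> Cmod (cexp v) <= 1 / 2 ->
  Cmod (cexp (- ((1 - s) * v)) * V s v - / (1 - s)) <= 2 / g * Cmod (cexp v).
Proof.
  intros Hg G Hv. set (x := Cmod (cexp v)) in *. assert (Hx : 0 <= x < 1) by (split; [apply Cmod_ge_0|lra]).
  set (b := fun n : nat => Cmod (cexp ((1 - s) * v)) / g * x ^ n).
  assert (Hb : forall n, Cmod (vterm s n v) <= b n) by (intros n; apply vterm_gap_le; auto).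
  assert (C0 : 0 < Cmod (cexp ((1 - s) * v))) by (rewrite Cmod_cexp; apply exp_pos).
  assert (Sb : summable b) by (apply summable_vbound; [apply Rdiv_le_0_compat; lra|exact Hx]).
  assert (D := dominated_series _ _ Hb Sb). change (Csum (fun n => vterm s n v)) with (V s v) in D.
  assert (K : Cmod (V s v - csum (fun n => vterm s n v) 1) <= Cmod (cexp ((1 - s) * v)) / g * (2 * x)).
  { apply (flim_Cmod_le (F := eventually) _ _ _ _ D). exists 1%nat. intros n Hn.
    eapply Rle_trans; [apply (Cmod_csum_sub_le _ b 1 n Hb Hn)|].
    assert (E : rsum b n - rsum b 1 = Cmod (cexp ((1 - s) * v)) / g * (rsum (fun k => x ^ k) n - 1)).
    { unfold b. rewrite !(rsum_scal _ (fun k => x ^ k)). simpl. ring. }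
    rewrite E. apply Rmult_le_compat_l; [apply Rdiv_le_0_compat; lra|].
    generalize (rsum_geom_le x n Hx). intros Q.
    assert (I : / (1 - x) <= 1 + 2 * x).
    { apply Rmult_le_reg_r with (1 - x); [lra|]. rewrite Rinv_l by lra. nra. }
    lra. }
  assert (N : (1 - s)%C <> 0).
  { apply Cmod_gt_0. specialize (G O). simpl in G. replace (0 + 1 - s)%C with (1 - s)%C in G by ring. lra. }
  assert (E1 : csum (fun n => vterm s n v) 1 = (cexp ((1 - s) * v) * / (1 - s))%C).
  { simpl. unfold vterm. simpl. replace (0 + 1 - s)%C with (1 - s)%C by ring. field. exact N. }
  rewrite E1 in K. rewrite cexp_opp.
  replace (/ cexp ((1 - s) * v) * V s v - / (1 - s))%C
    with ((V s v - cexp ((1 - s) * v) * / (1 - s)) / cexp ((1 - s) * v))%C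
    by (field; split; [exact N|apply cexp_neq_0]).
  rewrite Cmod_div by apply cexp_neq_0.
  apply Rmult_le_reg_r with (Cmod (cexp ((1 - s) * v))); [exact C0|].
  unfold Rdiv at 1. rewrite Rmult_assoc, Rinv_l, Rmult_1_r by lra.
  eapply Rle_trans; [exact K|]. right. field. lra.
Qed.

Lemma V_part_limit z y s : 0 < Re y -> not_pos_int s ->
  flim near1 (fun q => prefactor q z s / RtoC (- ln q) * V s (ell (RtoC (- ln q) * y)))%C
    (hpow y s * y / (1 - s))%C.
Proof.
  intros Hy Hs. destruct (pos_int_gap s Hs) as [g [Hg G]].
  assert (Y0 := Re_pos_Cmod y Hy).
  assert (N : (1 - s)%C <> 0).
  { apply Cmod_gt_0. specialize (G O). simpl in G. replace (0 + 1 - s)%C with (1 - s)%C in G by ring. lra. }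
  set (l := fun q => (RtoC (- ln q) * y)%C).
  assert (Rng : near1 (fun q => 0 < q < 1 /\ - ln q * Cmod y <= 1 / 8)).
  { apply filter_and; [apply near1_range|]. apply near1_ln_le; lra. }
  assert (A : flim near1 (fun q => (cexp (l q) - 1) / RtoC (- ln q))%C y).
  { destruct (is_cderiv_cexp 0) as [phi [P1 [P2 P3]]]. rewrite cexp_0 in P1, P2.
    apply flim_ext_loc with (fun q => phi (l q) * y)%C.
    - generalize near1_range. apply filter_imp. intros q Hq. assert (L := ln_neg q Hq).
      assert (L0 : RtoC (- ln q) <> 0) by (intros Z; apply RtoC_inj in Z; lra).
      rewrite (P1 (l q)). unfold l. field. exact L0.
    - apply flim_eq with (1 * y)%C; [ring|]. apply flim_mult; [|apply flim_const]. rewrite <- P2.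
      apply (flim_comp near1 l phi); [|exact P3]. unfold l.
      apply flim_eq with (0 * y)%C; [ring|]. apply flim_mult; [apply near1_ln|apply flim_const]. }
  assert (B : flim near1 (fun q => cexp (- ((1 - s) * ell (l q))) * V s (ell (l q)))%C (/ (1 - s))%C).
  { apply flim_squeeze with (fun q => 2 / g * (3 * (- ln q * Cmod y))).
    - generalize Rng. apply filter_imp. intros q [Hq H8]. assert (L := ln_neg q Hq).
      assert (X := scaled_ell_small (- ln q) y L Hy ltac:(lra)). fold (l q) in X.
      eapply Rle_trans; [apply (V_first_term s _ g); [lra|exact G|lra]|].
      apply Rmult_le_compat_l; [apply Rdiv_le_0_compat; lra|exact X].
    - intros eps He. assert (C0 : 0 <= 2 / g * (3 * Cmod y)).
      { apply Rmult_le_pos; [apply Rdiv_le_0_compat; lra|lra]. }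
      generalize (near1_ln_le _ (eps / 2) C0 (half_pos _ He)). apply filter_imp. intros q Hq.
      replace (2 / g * (3 * (- ln q * Cmod y))) with (- ln q * (2 / g * (3 * Cmod y))) by ring. lra. }
  (* With [v = ell (l q)], inserting [cexp (- s v) cexp v cexp (- (1 - s) v) = 1] splits the
     expression into three factors with known limits. *)
  apply flim_ext_loc with (fun q => theta q z y s * ((cexp (l q) - 1) / RtoC (- ln q))
     * (cexp (- ((1 - s) * ell (l q))) * V s (ell (l q))))%C.
  - generalize near1_range. apply filter_imp. intros q Hq. assert (L := ln_neg q Hq).
    assert (L0 : RtoC (- ln q) <> 0) by (intros Z; apply RtoC_inj in Z; lra).
    unfold theta. fold (l q). rewrite <- cexp_ell by (unfold l; rewrite re_scal_l; nra).
    unfold Psi. set (v := ell (l q)).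
    replace (prefactor q z s / RtoC (- ln q) * V s v)%C
      with (prefactor q z s / RtoC (- ln q) * V s v * (cexp (- (s * v)) * (cexp v * cexp (- ((1 - s) * v)))))%C.
    + field. exact L0.
    + rewrite <- !cexp_plus. replace (- (s * v) + (v + - ((1 - s) * v)))%C with (RtoC 0) by ring. rewrite cexp_0. ring.
  - apply flim_mult; [|exact B]. apply flim_mult; [now apply theta_limit|exact A].
Qed.

Lemma approx_limit a m z N s : 0 < Re z -> not_pos_int s ->
  flim near1 (fun q => approx a m q z N s) (approx0 a m z N s).
Proof.
  intros Hz Hs.
  assert (Hy : forall k, 0 < Re (z + INR k)) by (intros k; rewrite re_plus, re_RtoC; generalize (pos_INR k); lra).
  unfold approx, approx0. apply flim_plus; [apply flim_minus|].
  - apply (csum_limit near1 (fun q k => theta q z (z + INR k) s)). intros k. now apply theta_limit.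
  - now apply V_part_limit.
  - apply (csum_limit near1 (fun q j => a j * fdiff (fun y => theta q z y s) j (z + INR N))%C). intros j.
    apply flim_mult; [apply flim_const|]. apply (fdiff_limit near1 (fun q y => theta q z y s)); [apply Hy|].
    intros y Hy'. now apply theta_limit.
Qed.

(** * The Hurwitz side *)

Lemma hurwitz_term_hpow z k s : hurwitz_term z k s = hpow (z + INR k) s.
Proof.
  unfold hurwitz_term, hpow, cpow. replace (INR k + z)%C with (z + INR k)%C by ring.
  rewrite cexp_opp. unfold Cdiv. ring.
Qed.

Lemma Re_shift_ge z N : 0 < Re z -> INR N < Re (z + INR N).
Proof. intros H. rewrite re_plus, re_RtoC. lra. Qed.

Lemma Re_shift_pos z N : 0 < Re z -> 0 < Re (z + INR N).
Proof. intros H. generalize (Re_shift_ge z N H) (pos_INR N). lra. Qed.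

(** The argument of [z + N] stays bounded by [PI], so the factor [|z + N|^(Re w)] decides; solving
    for it gives the threshold [N0]. *)
Lemma cexp_Clog_tail_0 w z : Re w < 0 -> 0 < Re z ->
  flim eventually (fun N => cexp (w * Clog (z + INR N))) 0.
Proof.
  intros Hw Hz eps He.
  destruct (INR_unbounded (exp ((Cmod w * PI - ln eps) / (- Re w)))) as [N0 HN0].
  exists N0. intros N HN. assert (HN' := le_INR _ _ HN).
  replace (cexp (w * Clog (z + INR N)) - 0)%C with (cexp (w * Clog (z + INR N))) by ring.
  set (y := (z + INR N)%C). assert (Hy : 0 < Re y) by now apply Re_shift_pos.
  assert (E0 := exp_pos ((Cmod w * PI - ln eps) / (- Re w))).
  rewrite Cmod_cexp, <- (exp_ln eps He). apply exp_increasing.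
  rewrite re_mult. change (Re (Clog y)) with (ln (Cmod y)).
  assert (I := Im_Clog_bound y Hy).
  assert (A : - (Im w * Im (Clog y)) <= Cmod w * PI).
  { eapply Rle_trans; [apply RRle_abs|]. rewrite Rabs_Ropp, Rabs_mult.
    apply Rmult_le_compat; try apply Rabs_pos; [apply im_le_Cmod|exact I]. }
  assert (B : (Cmod w * PI - ln eps) / (- Re w) < ln (Cmod y)).
  { rewrite <- (ln_exp ((Cmod w * PI - ln eps) / (- Re w))). apply ln_increasing; [exact E0|].
    generalize (Re_shift_ge z N Hz) (re_le_Cmod y) (RRle_abs (Re y)). fold y. lra. }
  apply Rmult_lt_compat_l with (r := - Re w) in B; [|lra].
  replace (- Re w * ((Cmod w * PI - ln eps) / (- Re w))) with (Cmod w * PI - ln eps) in B by (field; lra).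
  lra.
Qed.

Lemma fdiff_hpow_tail_0 s j z : 0 < Re s -> 0 < Re z ->
  flim eventually (fun N => fdiff (fun y => hpow y s) j (z + INR N)) 0.
Proof.
  intros Hs. revert z. induction j as [|j IH]; intros z Hz.
  - simpl. unfold hpow. apply flim_ext with (fun N => cexp (- s * Clog (z + INR N))).
    + intros N. f_equal. ring.
    + apply cexp_Clog_tail_0; [rewrite re_opp; lra|exact Hz].
  - simpl. apply flim_eq with (0 - 0)%C; [ring|]. apply flim_minus; [now apply IH|].
    apply flim_ext with (fun N => fdiff (fun y => hpow y s) j (z + 1 + INR N)).
    + intros N. f_equal. ring.
    + apply IH. rewrite re_plus, re_RtoC. lra.
Qed.

(** For [Re s > 1] everything added to the partial sum in [approx0] tends to 0 with growing [N]. *)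
Lemma approx0_hurwitz a m z s h : 1 < Re s -> 0 < Re z ->
  series_converges_to (fun k => hurwitz_term z k s) h ->
  flim eventually (fun N => approx0 a m z N s) h.
Proof.
  intros Hs Hz Hh. unfold approx0.
  apply flim_eq with (h - 0 * / (1 - s) + csum (fun _ => 0%C) m)%C.
  { assert (E : csum (fun _ => 0%C) m = 0).
    { induction m as [|m IH]; simpl; [reflexivity|]. rewrite IH. ring. }
    rewrite E. ring. }
  apply flim_plus; [apply flim_minus|].
  - apply flim_ext with (csum (fun k => hurwitz_term z k s)); [|exact Hh].
    intros N. apply csum_ext. intros k _. apply hurwitz_term_hpow.
  - unfold Cdiv. apply flim_mult; [|apply flim_const].
    apply flim_ext with (fun N => cexp ((1 - s) * Clog (z + INR N))).
    + intros N. unfold hpow. rewrite <- (cexp_Clog (z + INR N)) at 3 by now apply Re_shift_pos.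
      rewrite <- cexp_plus. f_equal. ring.
    + apply cexp_Clog_tail_0; [rewrite re_minus, re_RtoC; lra|exact Hz].
  - apply (csum_limit eventually (fun N j => a j * fdiff (fun y => hpow y s) j (z + INR N))%C). intros j.
    apply flim_eq with (a j * 0)%C; [ring|]. apply flim_mult; [apply flim_const|]. apply fdiff_hpow_tail_0; [lra|exact Hz].
Qed.

Lemma cholo_approx0 a m z N s : not_pos_int s -> cholo (approx0 a m z N) s.
Proof.
  intros Hs.
  assert (P : forall y, cholo (hpow y) s).
  { intros y. apply cholo_cexp, cholo_opp, cholo_mult; [apply cholo_id|apply cholo_const]. }
  unfold approx0. apply cholo_plus; [apply cholo_minus|].
  - apply (cholo_csum (fun k s => hpow (z + INR k) s)). auto.
  - apply cholo_div.
    + intros E. apply (Hs O). simpl. replace s with (1 - (1 - s))%C by ring. rewrite E. ring.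
    + apply cholo_mult; [apply P|apply cholo_const].
    + apply cholo_minus; [apply cholo_const|apply cholo_id].
  - apply (cholo_csum (fun j s => a j * fdiff (fun y => hpow y s) j (z + INR N))%C). intros j _.
    apply cholo_mult; [apply cholo_const|]. now apply cholo_fdiff.
Qed.

(** * Meromorphy of the correction term *)

Lemma mer_at_ext f g p : (forall w, f w = g w) -> mer_at f p -> mer_at g p.
Proof.
  intros E [m [M [r [Hr H]]]]. exists m, M, r. split; [exact Hr|]. intros w Hwp Hw.
  destruct (H w Hwp Hw) as [H1 H2]. rewrite <- E. split; [|exact H2].
  revert H1. now apply cholo_ext.
Qed.

Lemma is_cderiv_csin_pi s :
  is_cderiv (fun w => csin (PI * w)) s (PI * ((cexp (Ci * (PI * s)) + cexp (- (Ci * (PI * s)))) / 2))%C.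
Proof.
  apply is_cderiv_ext with (fun w => / (2 * Ci) * (cexp (0 + w * (Ci * PI)) + - (1) * cexp (0 + w * (- (Ci * PI)))))%C.
  { intros w. unfold csin. change Defs.Ci with Ci.
    replace (0 + w * (Ci * PI))%C with (Ci * (PI * w))%C by ring.
    replace (0 + w * - (Ci * PI))%C with (- (Ci * (PI * w)))%C by ring. field. apply Ci_nz. }
  eapply is_cderiv_eq; [|apply is_cderiv_mult; [apply is_cderiv_const|apply is_cderiv_plus;
    [apply (is_cderiv_cexp_comp (fun w => 0 + w * (Ci * PI))%C), is_cderiv_affine|
     apply is_cderiv_mult; [apply is_cderiv_const|apply (is_cderiv_cexp_comp (fun w => 0 + w * - (Ci * PI))%C), is_cderiv_affine]]]].
  cbv beta. replace (0 + s * (Ci * PI))%C with (Ci * (PI * s))%C by ring.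
  replace (0 + s * - (Ci * PI))%C with (- (Ci * (PI * s)))%C by ring. field. apply Ci_nz.
Qed.

Lemma mer_at_inv_csin_pi p : mer_at (fun w => / csin (PI * w))%C p.
Proof.
  assert (Hh : forall w, cholo (fun w => csin (PI * w)) w) by (intros w; eexists; apply is_cderiv_csin_pi).
  destruct (C_eq_dec (csin (PI * p)) 0) as [E|E].
  - apply (mer_at_inv (fun w => csin (PI * w)) p _ (filter_forall (F := cnbhs p) _ Hh) (is_cderiv_csin_pi p) E).
    set (e := cexp (Ci * (PI * p))). assert (He : e <> 0) by apply cexp_neq_0.
    (* At a zero of the sine its two exponentials agree, so the derivative is [PI * e] and the zero
       is simple. *)
    assert (E2 : cexp (- (Ci * (PI * p))) = e).
    { unfold csin in E. change Defs.Ci with Ci in E. fold e in E.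
      assert (Z : (e - cexp (- (Ci * (PI * p))))%C = 0).
      { transitivity ((e - cexp (- (Ci * (PI * p)))) / (2 * Ci) * (2 * Ci))%C; [field; apply Ci_nz|]. rewrite E. ring. }
      replace (cexp (- (Ci * (PI * p)))) with (e - (e - cexp (- (Ci * (PI * p)))))%C by ring. rewrite Z. ring. }
    rewrite E2. replace (PI * ((e + e) / 2))%C with (PI * e)%C by field.
    apply Cmult_neq_0; [|exact He]. intros Z. apply RtoC_inj in Z. generalize PI_RGT_0. lra.
  - apply mer_at_of_cholo. generalize (flim_away_from_0 _ _ E (cholo_cont _ _ (Hh p))). apply filter_imp.
    intros w Hw. apply cholo_inv; [|apply Hh]. apply Cmod_gt_0. generalize (Cmod_ge_0 (csin (PI * p))). lra.
Qed.

Lemma mer_at_qcorr q z p : 0 < q < 1 -> mer_at (qcorr q z) p.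
Proof.
  intros Hq. apply mer_at_ext with (fun w => - (prefactor q z w / RtoC (- ln q) * PI) * / csin (PI * w))%C.
  { intros w. rewrite qcorr_prefactor by exact Hq. unfold Cdiv. ring. }
  apply mer_at_mult; [|apply mer_at_inv_csin_pi]. apply mer_at_of_cholo. apply filter_forall. intros w.
  apply cholo_opp, cholo_mult; [|apply cholo_const]. apply cholo_mult; [apply cholo_prefactor|apply cholo_const].
Qed.

(** * Comparison along segments *)

Lemma punctured_limit_of_zero_near f g p : zero_near (fun w => f w - g w)%C p -> ccont g p ->
  has_punctured_limit f p (g p).
Proof.
  intros [r [Hr Z]] Hg eps He. destruct (Hg eps He) as [d [Hd K]].
  exists (Rmin r d). split; [now apply Rmin_glb_lt|]. intros w Hwp Hw.
  assert (L1 := Rmin_l r d). assert (L2 := Rmin_r r d).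
  replace (f w) with ((f w - g w) + g w)%C by ring. rewrite (Z w Hwp) by lra.
  replace (0 + g w - g p)%C with (g w - g p)%C by ring. apply K. lra.
Qed.

Lemma punctured_limit_unique f p u v : has_punctured_limit f p u -> has_punctured_limit f p v -> u = v.
Proof.
  intros Hu Hv. apply eq_of_Cmod_small. intros eps He.
  destruct (Hu (eps / 2) (half_pos _ He)) as [d1 [D1 K1]].
  destruct (Hv (eps / 2) (half_pos _ He)) as [d2 [D2 K2]].
  set (t := Rmin d1 d2 / 2). assert (Ht : 0 < t) by (unfold t; generalize (Rmin_glb_lt d1 d2 0 D1 D2); lra).
  assert (T1 : t < d1) by (unfold t in *; generalize (Rmin_l d1 d2); lra).
  assert (T2 : t < d2) by (unfold t in *; generalize (Rmin_r d1 d2); lra).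
  assert (E : Cmod (p + t - p) = t).
  { replace (p + t - p)%C with (RtoC t) by ring. rewrite Cmod_R, Rabs_pos_eq; lra. }
  assert (N : (p + t)%C <> p).
  { intros Z. rewrite Z, Cmod_sub_self in E. lra. }
  rewrite <- E in T1, T2. specialize (K1 _ N T1). specialize (K2 _ N T2).
  generalize (Cmod_triangle_sub u (f (p + t)%C) v). rewrite (Cmod_sub_sym u (f (p + t)%C)). lra.
Qed.

(** Joining [s] to a non-real point on a given vertical line avoids the positive integers. *)
Definition target (b : R) (s : C) : C := (b, if Req_EM_T (Im s) 0 then 1 else Im s).

Lemma target_Cmod b s : 0 <= b -> Cmod (target b s) <= b + 1 + Cmod s.
Proof.
  intros Hb. eapply Rle_trans; [apply Cmod_le_parts|]. unfold target. simpl Re. simpl Im.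
  rewrite Rabs_pos_eq by exact Hb. generalize (im_le_Cmod s) (Cmod_ge_0 s). intros I P.
  destruct (Req_EM_T (Im s) 0); [rewrite Rabs_R1|]; lra.
Qed.

Lemma target_segment_not_pos_int b s t : not_pos_int s -> 0 <= t <= 1 ->
  not_pos_int (s + RtoC t * (target b s - s))%C.
Proof.
  intros Hs Ht n E. assert (Ei := f_equal Im E).
  rewrite im_plus, im_scal_l, im_minus, im_RtoC in Ei. unfold target in Ei, E. simpl Im in Ei.
  destruct (Req_EM_T (Im s) 0) as [H0|H0].
  - assert (T0 : t = 0) by (rewrite H0 in Ei; lra). apply (Hs n).
    rewrite <- E, T0. ring.
  - apply H0. lra.
Qed.

Lemma locally_discrete_avoid P w : locally_discrete P ->
  exists r, 0 < r /\ forall v, v <> w -> Cmod (v - w) < r -> ~ P v.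
Proof.
  intros H. destruct (H w) as [r [Hr K]]. exists r. split; [exact Hr|].
  intros v Hv Hd Pv. specialize (K v Pv Hv). lra.
Qed.

Lemma INR_2_le m : (2 <= m)%nat -> 2 <= INR m.
Proof. intros H. replace 2 with (INR 2) by (simpl; lra). now apply le_INR. Qed.

Lemma Re_shift_ge_2 z N : 0 < Re z -> (2 <= N)%nat -> 2 <= Re (z + INR N).
Proof. intros Hz H. generalize (Re_shift_ge z N Hz) (INR_2_le N H). lra. Qed.

Lemma rate_small z K' eps : 0 < Re z -> 0 <= K' -> 0 < eps -> exists N, (2 <= N)%nat /\
  forall n, (N <= n)%nat -> 2 * K' / Re (z + INR n) <= eps.
Proof.
  intros Hz HK' He. destruct (INR_unbounded (2 * K' / eps)) as [N HN]. exists (Nat.max N 2).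
  split; [lia|]. intros n Hn. assert (Hn' : INR N <= INR n) by (apply le_INR; lia).
  assert (Y := Re_shift_ge z n Hz). assert (Y2 := Re_shift_ge_2 z n Hz ltac:(lia)).
  apply Rmult_le_reg_r with (Re (z + INR n)); [lra|].
  unfold Rdiv. rewrite Rmult_assoc, Rinv_l, Rmult_1_r by lra.
  assert (A : 2 * K' / eps < Re (z + INR n)) by lra.
  apply Rmult_lt_compat_l with (r := eps) in A; [|exact He].
  replace (eps * (2 * K' / eps)) with (2 * K') in A by (field; lra). lra.
Qed.

(** * Identification of the two continuations, and the bounds that link them *)

Section Main.
Variables (z : C) (a : nat -> C) (m : nat) (K d : R).
Hypothesis Hz : 0 < Re z.
Hypothesis HK : 0 <= K.
Hypothesis Hd : 0 < d <= 1 / 16.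
Hypothesis Hm : (2 <= m)%nat.
Hypothesis Hg : forall u : C, u <> 0 -> Rabs (Im u) <= d -> - d <= Re u ->
  Cmod (gregory_rem a m u) <= K * Cmod u ^ m.

(** Candidate for the continuation of q-zeta plus correction, holomorphic off the positive integers
    on [Re s > 1 - m], within a disc that grows as [q -> 1]. *)
Definition gcont (q : R) (N : nat) (s : C) : C :=
  (approx a m q z N s + prefactor q z s * rem a m (- ln q) (z + INR N) s)%C.

Lemma cholo_gcont S0 q N s : 0 < q < 1 -> - ln q * S0 <= d -> - ln q * Cmod (z + INR N) <= 1 / 4 ->
  not_pos_int s -> Cmod s < S0 -> 1 < Re s + INR m -> cholo (gcont q N) s.
Proof.
  intros Hq HLS HLy Hs HsS Hr. apply cholo_plus; [now apply cholo_approx|].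
  apply cholo_mult; [apply cholo_prefactor|].
  apply (cholo_rem a m K d HK Hd Hm Hg S0); auto using ln_neg, Re_shift_pos.
Qed.

Lemma cnbhs_domain S0 s : not_pos_int s -> Cmod s < S0 -> 1 < Re s + INR m ->
  cnbhs s (fun w => not_pos_int w /\ Cmod w < S0 /\ 1 < Re w + INR m).
Proof.
  intros H1 H2 H3. apply filter_and; [now apply not_pos_int_open|]. apply filter_and.
  - exists (S0 - Cmod s). split; [lra|]. intros w Hw.
    generalize (Cmod_triangle (w - s) s). replace (w - s + s)%C with w by ring. lra.
  - exists (Re s + INR m - 1). split; [lra|]. intros w Hw.
    assert (R1 := re_le_Cmod (w - s)). rewrite re_minus in R1. apply Rabs_le_between in R1. lra.
Qed.

(** Both functions are meromorphic along a segment from [s] to a point with real part 1/2, near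
    which [qzeta_strip] identifies them. The margin 3 in [S0] leaves room for that point, of modulus
    at most [|s| + 3 / 2], and for a neighbourhood of it. *)
Lemma gcont_continues (Zq : C -> C) S0 q N s :
  is_meromorphic_continuation (qzeta_term q z) (fun w => 0 < Re w) Zq ->
  0 < q < 1 -> - ln q * S0 <= d -> - ln q * Cmod (z + INR N) <= 1 / 4 ->
  not_pos_int s -> Cmod s + 3 <= S0 -> 1 < Re s + INR m ->
  has_punctured_limit (fun w => Zq w + qcorr q z w)%C s (gcont q N s).
Proof.
  intros HZ Hq HLS HLy Hs HsS Hr. assert (M2 := INR_2_le m Hm).
  apply punctured_limit_of_zero_near.
  2: { apply cholo_cont, (cholo_gcont S0); auto. lra. }
  set (e := target (1/2) s). assert (He : Cmod e <= 1/2 + 1 + Cmod s) by (apply target_Cmod; lra).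
  apply identity_segment with e.
  - intros t Ht. set (w := (s + RtoC t * (e - s))%C).
    assert (Gw : not_pos_int w) by now apply target_segment_not_pos_int.
    assert (Cw : Cmod w < S0).
    { apply Rle_lt_trans with (1/2 + 1 + Cmod s); [|lra]. apply segment_Cmod; [lra|exact He|exact Ht]. }
    assert (Rw : 1 < Re w + INR m).
    { assert (Rmin (Re s) (1/2) <= Re w).
      { apply segment_Re; [apply Rmin_l| |exact Ht]. apply Rmin_r. }
      assert (1 - INR m < Rmin (Re s) (1/2)) by (apply Rmin_glb_lt; lra). lra. }
    apply mer_at_minus.
    + apply mer_at_plus; [exact (mer_at_of_continuation _ _ _ HZ w)|now apply mer_at_qcorr].
    + apply mer_at_of_cholo. generalize (cnbhs_domain S0 w Gw Cw Rw). apply filter_imp.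
      intros v [V1 [V2 V3]]. now apply (cholo_gcont S0).
  - destruct HZ as [P [HP [_ [_ HS]]]]. destruct (locally_discrete_avoid P e HP) as [r [Hr0 Av]].
    exists (Rmin r (1/4)). split; [apply Rmin_glb_lt; lra|]. intros w Hwe Hw.
    assert (L1 := Rmin_l r (1/4)). assert (L2 := Rmin_r r (1/4)).
    assert (R1 := re_le_Cmod (w - e)). rewrite re_minus in R1. change (Re e) with (1/2) in R1.
    apply Rabs_le_between in R1.
    assert (Hw1 : 0 < Re w < 1) by lra.
    assert (Cw : Cmod w <= S0).
    { generalize (Cmod_triangle (w - e) e). replace (w - e + e)%C with w by ring. lra. }
    assert (A := HS w (proj1 Hw1) (Av w Hwe ltac:(lra))).
    assert (B := qzeta_strip a m K d S0 z w q N HK Hd Hm Hg Hq HLS HLy Hz Hw1 Cw).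
    rewrite (scv_unique _ _ _ A B). unfold gcont. ring.
Qed.

Variable (Zq : R -> C -> C).
Hypothesis HZ : forall q, 0 < q < 1 ->
  is_meromorphic_continuation (qzeta_term q z) (fun w => 0 < Re w) (Zq q).

Lemma near1_small S0 N : 0 <= S0 -> near1 (fun q => 0 < q < 1 /\ - ln q <= 1 /\ - ln q * S0 <= d /\
  - ln q * Cmod (z + INR N) <= 1 / 4).
Proof.
  intros HS. apply filter_and; [apply near1_range|]. apply filter_and.
  - generalize (near1_ln_le 1 1 Rle_0_1 Rlt_0_1). apply filter_imp. intros q. lra.
  - apply filter_and; apply near1_ln_le; try lra. apply Cmod_ge_0.
Qed.

(** For fixed [q] the continued function does not depend on [N], so two values of [approx] differ by
    two remainders, each at most [K' / Re (z + N)]. This bound survives [q -> 1]; the Hurwitz side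
    thus inherits its estimate from the q-side and needs none of its own. *)
Lemma approx0_cauchy S0 : 0 <= S0 -> exists K', 0 <= K' /\
  (forall q y s, 0 < q < 1 -> - ln q <= 1 -> - ln q * S0 <= d -> - ln q * Cmod y <= 1 / 4 ->
    2 <= Re y -> Cmod s <= S0 -> 1 <= Re s + INR m ->
    Cmod (prefactor q z s * rem a m (- ln q) y s) <= K' / Re y) /\
  forall s N M, not_pos_int s -> Cmod s + 3 <= S0 -> 1 < Re s + INR m -> (2 <= N)%nat -> (N <= M)%nat ->
    Cmod (approx0 a m z N s - approx0 a m z M s) <= 2 * K' / Re (z + INR N).
Proof.
  intros HS. destruct (rem_estimate a m K d HK Hd Hg S0 z HS) as [K' [HK' Est]].
  exists K'. split; [exact HK'|]. split; [exact Est|]. intros s N M Hs HsS Hr HN HM.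
  assert (YN := Re_shift_ge_2 z N Hz HN). assert (YM := Re_shift_ge_2 z M Hz ltac:(lia)).
  assert (YNM : Re (z + INR N) <= Re (z + INR M)).
  { rewrite !re_plus, !re_RtoC. generalize (le_INR _ _ HM). lra. }
  replace (approx0 a m z N s - approx0 a m z M s)%C with (approx0 a m z N s - approx0 a m z M s - 0)%C by ring.
  apply (flim_Cmod_le (F := near1) (fun q => approx a m q z N s - approx a m q z M s)%C).
  { apply flim_minus; now apply approx_limit. }
  generalize (filter_and _ _ (near1_small S0 N HS) (near1_small S0 M HS)). apply filter_imp.
  intros q [[Hq [HL [HLS HLN]]] [_ [_ [_ HLM]]]].
  assert (GN := gcont_continues (Zq q) S0 q N s (HZ q Hq) Hq HLS HLN Hs HsS Hr).
  assert (GM := gcont_continues (Zq q) S0 q M s (HZ q Hq) Hq HLS HLM Hs HsS Hr).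
  assert (E := punctured_limit_unique _ _ _ _ GN GM). unfold gcont in E.
  set (RN := (prefactor q z s * rem a m (- ln q) (z + INR N) s)%C) in *.
  set (RM := (prefactor q z s * rem a m (- ln q) (z + INR M) s)%C) in *.
  replace (approx a m q z N s - approx a m q z M s - 0)%C with (RM - RN)%C.
  2: { replace (approx a m q z N s) with (approx a m q z N s + RN - RN)%C by ring. rewrite E. ring. }
  assert (BN : Cmod RN <= K' / Re (z + INR N)) by (apply Est; auto; lra).
  assert (BM : Cmod RM <= K' / Re (z + INR M)) by (apply Est; auto; lra).
  assert (BMN : K' / Re (z + INR M) <= K' / Re (z + INR N)).
  { apply Rmult_le_compat_l; [exact HK'|]. apply Rinv_le_contravar; lra. }
  eapply Rle_trans; [apply Cmod_sub_le|]. unfold Rdiv in *. lra.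
Qed.

Definition hcont (s : C) : C := Clim (fun N => approx0 a m z N s).

Lemma hcont_limit s : not_pos_int s -> 1 < Re s + INR m ->
  flim eventually (fun N => approx0 a m z N s) (hcont s).
Proof.
  intros Hs Hr. assert (S0 : 0 <= Cmod s + 3) by (generalize (Cmod_ge_0 s); lra).
  destruct (approx0_cauchy _ S0) as [K' [HK' [_ C]]].
  destruct (Ccomplete (fun N => approx0 a m z N s)) as [l Hl].
  - intros eps He. destruct (rate_small z K' (eps / 2) Hz HK' (half_pos _ He)) as [N [N2 HN]].
    exists N. intros n k Hn Hk.
    assert (B := HN N (le_n _)). assert (B1 := HN n Hn). assert (B2 := HN k Hk).
    destruct (Nat.le_ge_cases n k) as [L|L].
    + generalize (C s n k Hs (Rle_refl _) Hr ltac:(lia) L). lra.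
    + rewrite Cmod_sub_sym. generalize (C s k n Hs (Rle_refl _) Hr ltac:(lia) L). lra.
  - unfold hcont. now rewrite (Clim_unique _ l Hl).
Qed.

Lemma hcont_rate S0 K' s N :
  (forall s N M, not_pos_int s -> Cmod s + 3 <= S0 -> 1 < Re s + INR m -> (2 <= N)%nat -> (N <= M)%nat ->
    Cmod (approx0 a m z N s - approx0 a m z M s) <= 2 * K' / Re (z + INR N)) ->
  not_pos_int s -> Cmod s + 3 <= S0 -> 1 < Re s + INR m -> (2 <= N)%nat ->
  Cmod (approx0 a m z N s - hcont s) <= 2 * K' / Re (z + INR N).
Proof.
  intros C Hs HS Hr HN. rewrite Cmod_sub_sym.
  apply (flim_Cmod_le (F := eventually) _ _ _ _ (hcont_limit s Hs Hr)).
  exists N. intros n Hn. rewrite Cmod_sub_sym. now apply C.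
Qed.

Lemma cholo_hcont s : not_pos_int s -> 1 < Re s + INR m -> cholo hcont s.
Proof.
  (* This leaves the margin 3 for all points within distance 1 of [s]. *)
  intros Hs Hr. set (S0 := Cmod s + 4). assert (HS0 : 0 <= S0) by (unfold S0; generalize (Cmod_ge_0 s); lra).
  destruct (approx0_cauchy S0 HS0) as [K' [HK' [_ C]]].
  destruct (cnbhs_domain (Cmod s + 1) s Hs ltac:(lra) Hr) as [r [Hr0 D]].
  (* The shift by 2 meets the requirement [2 <= N] of the rate. *)
  apply (cholo_uniform_limit (fun n w => approx0 a m z (n + 2) w) hcont s (r / 4)); [lra| |].
  - intros n w Hw. apply cholo_approx0. apply D. lra.
  - intros eps He. destruct (rate_small z K' eps Hz HK' He) as [N [N2 HN]]. exists N. intros n w Hn Hw.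
    destruct (D w ltac:(lra)) as [D1 [D2 D3]].
    eapply Rle_trans; [apply (hcont_rate S0 K' w (n + 2) C D1); [unfold S0; lra|exact D3|lia]|].
    apply HN. lia.
Qed.

(** The identity is propagated from a point with real part 2, inside the half-plane where the
    Hurwitz series converges. *)
Lemma hcont_continues (H : C -> C) s :
  is_meromorphic_continuation (hurwitz_term z) (fun w => 1 < Re w) H ->
  not_pos_int s -> 1 < Re s + INR m -> has_punctured_limit H s (hcont s).
Proof.
  intros HH Hs Hr. assert (M2 := INR_2_le m Hm).
  apply punctured_limit_of_zero_near; [|now apply cholo_cont, cholo_hcont].
  set (e := target 2 s). apply identity_segment with e.
  - intros t Ht. set (w := (s + RtoC t * (e - s))%C).
    assert (Gw : not_pos_int w) by now apply target_segment_not_pos_int.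
    assert (Rw : 1 < Re w + INR m).
    { assert (Rmin (Re s) 2 <= Re w).
      { apply segment_Re; [apply Rmin_l| |exact Ht]. apply Rmin_r. }
      assert (1 - INR m < Rmin (Re s) 2) by (apply Rmin_glb_lt; lra). lra. }
    apply mer_at_minus; [exact (mer_at_of_continuation _ _ _ HH w)|].
    apply mer_at_of_cholo. generalize (cnbhs_domain (Cmod w + 1) w Gw ltac:(lra) Rw). apply filter_imp.
    intros v [V1 [_ V3]]. now apply cholo_hcont.
  - destruct HH as [P [HP [_ [_ HS]]]]. destruct (locally_discrete_avoid P e HP) as [r [Hr0 Av]].
    exists (Rmin r 1). split; [apply Rmin_glb_lt; lra|]. intros w Hwe Hw.
    assert (L1 := Rmin_l r 1). assert (L2 := Rmin_r r 1).
    assert (R1 := re_le_Cmod (w - e)). rewrite re_minus in R1. change (Re e) with 2 in R1.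
    apply Rabs_le_between in R1. assert (Hw1 : 1 < Re w) by lra.
    assert (A := HS w Hw1 (Av w Hwe ltac:(lra))).
    unfold hcont. rewrite (Clim_unique _ _ (approx0_hurwitz a m z w _ Hw1 Hz A)). ring.
Qed.

End Main.

Theorem theorem2 (z s : C) (Zq : R -> C -> C) (H : C -> C) :
  0 < Re z ->
  (forall n : nat, s <> RtoC (INR (S n))) ->
  (forall q : R, 0 < q < 1 ->
     is_meromorphic_continuation (qzeta_term q z) (fun w => 0 < Re w) (Zq q)) ->
  is_meromorphic_continuation (hurwitz_term z) (fun w => 1 < Re w) H ->
  exists h : C, has_punctured_limit H s h /\
    forall eps, 0 < eps -> exists del, 0 < del /\
      forall q : R, 0 < q -> 1 - del < q < 1 ->
        exists v : C,
          has_punctured_limit (fun w => (Zq q w + qcorr q z w)%C) s v /\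
          Cmod (v - h) < eps.
Proof.
  intros Hz Hs HZ HH.
  (* The order [m] must satisfy [1 < Re s + m] for the remainder to be controlled at [s], and
     [m >= 2] for it to be holomorphic. *)
  destruct (INR_unbounded (1 - Re s)) as [m0 Hm0]. set (m := Nat.max m0 2).
  assert (Hm : (2 <= m)%nat) by lia.
  assert (Hr : 1 < Re s + INR m).
  { assert (INR m0 <= INR m) by (apply le_INR; lia). lra. }
  destruct (gregory m) as [a [K [d [HK [Hd Hg]]]]].
  set (S0 := Cmod s + 3). assert (HS : 0 <= S0) by (unfold S0; generalize (Cmod_ge_0 s); lra).
  exists (hcont z a m s). split; [now apply (hcont_continues z a m K d Hz HK Hd Hm Hg Zq HZ)|].
  intros eps He.
  destruct (approx0_cauchy z a m K d Hz HK Hd Hm Hg Zq HZ S0 HS) as [K' [HK' [Est Ca]]].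
  (* [N] is fixed before [q]. Three errors of at most [eps / 4] then add up: letting [q -> 1] in
     [approx], letting [N -> oo] in [approx0], and the remainder. *)
  destruct (rate_small z K' (eps / 4) Hz HK') as [N [HN Sm]]; [lra|].
  specialize (Sm N (le_n _)).
  assert (Rate := hcont_rate z a m K d Hz HK Hd Hm Hg Zq HZ S0 K' s N Ca Hs (Rle_refl _) Hr HN).
  assert (Lim := approx_limit a m z N s Hz Hs (eps / 4)).
  destruct (filter_and _ _ (near1_small z d Hd S0 N HS) (Lim ltac:(lra))) as [del [Hdel Q]].
  exists del. split; [exact Hdel|]. intros q Hq0 Hq1.
  destruct (Q q Hq0 Hq1) as [[Hq [HL [HLS HLy]]] App].
  exists (gcont z a m q N s). split.
  - apply (gcont_continues z a m K d Hz HK Hd Hm Hg (Zq q) S0); auto. apply Rle_refl.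
  - unfold gcont.
    assert (B := Est q (z + INR N)%C s Hq HL HLS HLy (Re_shift_ge_2 z N Hz HN) ltac:(unfold S0; lra) ltac:(lra)).
    assert (Y := Re_shift_ge_2 z N Hz HN).
    assert (B2 : K' / Re (z + INR N) <= 2 * K' / Re (z + INR N)).
    { apply Rmult_le_compat_r; [apply Rlt_le, Rinv_0_lt_compat; lra|lra]. }
    set (X := (prefactor q z s * rem a m (- ln q) (z + INR N) s)%C) in *.
    replace (approx a m q z N s + X - hcont z a m s)%C
      with ((approx a m q z N s - approx0 a m z N s) + ((approx0 a m z N s - hcont z a m s) + X))%C by ring.
    eapply Rle_lt_trans; [apply Cmod_triangle|].
    generalize (Cmod_triangle (approx0 a m z N s - hcont z a m s) X). lra.
Qed.
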